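(* Let $n\ge1$ and $r>0$. For each $q\in\mathbb C^\times=\mathbb C\setminus\{0\}$, the algebra $\mathcal O_q^{\mathrm{hol}}(\mathbb D_r^n)$ of holomorphic functions on the quantum $n$-polydisk of radius $r$ is topologically isomorphic to the quotient of $\mathcal F(\mathbb D_r^n)$ by the closed two-sided ideal generated by the elements $\zeta_i\zeta_j-q\zeta_j\zeta_i$ for all $i<j$. As a corollary, $\mathcal O_q^{\mathrm{hol}}(\mathbb D_r^n)$ is a holomorphically finitely generated algebra.
   Context: All algebras are associative unital $\mathbb C$-algebras and all homomorphisms are unital. An Arens-Michael algebra is a complete (Hausdorff) topological algebra whose topology is defined by a family of submultiplicative seminorms; a Fréchet-Arens-Michael algebra is one whose underlying space is Fréchet. Topologically isomorphic means isomorphic via an algebra isomorphism that is a homeomorphism. Quantum polydisk. $\mathcal O_q^{\mathrm{reg}}(\mathbb C^n)$ is the algebra generated by $x_1,\dots,x_n$ with relations $x_ix_j=q\,x_jx_i$ for $i<j$; the monomials $x^\alpha=x_1^{\alpha_1}\cdots x_n^{\alpha_n}$ ($\alpha\in\mathbb Z_+^n$) form a basis. Put $|\alpha|=\sum_i\alpha_i$, and $w_q(\alpha)=1$ if $|q|\ge1$, $w_q(\alpha)=|q|^{\sum_{i<j}\alpha_i\alpha_j}$ if $|q|<1$. Then $$\mathcal O_q^{\mathrm{hol}}(\mathbb D_r^n)=\Bigl\{a=\sum_{\alpha\in\mathbb Z_+^n}c_\alpha x^\alpha:\ \|a\|_\rho=\sum_\alpha|c_\alpha|w_q(\alpha)\rho^{|\alpha|}<\infty\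 \ \forall\,0<\rho<r\Bigr\},$$ with topology given by the seminorms $\|\cdot\|_\rho$ ($0<\rho<r$) and the continuous product determined by $x_ix_j=q\,x_jx_i$ for $i<j$. Free polydisk. The analytic free product $A_1\mathbin{\widehat *}A_2$ is the coproduct in the category of Arens-Michael algebras and continuous homomorphisms (it exists). Let $\mathbb D_r=\{z\in\mathbb C:|z|<r\}$ and let $\mathcal O(\mathbb D_r)$ be the algebra of holomorphic functions on $\mathbb D_r$ with the topology of compact convergence. Put $\mathcal F(\mathbb D_r^n)=\mathcal O(\mathbb D_r)\mathbin{\widehat *}\cdots\mathbin{\widehat *}\mathcal O(\mathbb D_r)$ ($n$ factors). The element $\zeta_i\in\mathcal F(\mathbb D_r^n)$ is the image of the coordinate function $z\in\mathcal O(\mathbb D_r)$ under the canonical map of the $i$-th factor. HFG algebras. Let $W_m=\bigsqcup_{k\ge 0}\{1,\dots,m\}^k$, and for $\alpha=(\alpha_1,\dots,\alpha_k)\in W_m$ put $|\alpha|=k$, $\zeta_\alpha=\zeta_{\alpha_1}\cdots\zeta_{\alpha_k}$ ($\zeta_\emptyset=1$). Let $\mathcal F_m=\{a=\sum_{\alpha\in W_m}c_\alpha\zeta_\alpha:\sum_\alpha|c_\alpha|\rho^{|\alpha|}<\infty\ \forall\rho>0\}$ (formal series in free noncommuting variables $\zeta_1,\dots,\zeta_m$, concatenation product). For an Arens-Michael algebra $A$, $a\in A^m$ and $f=\sum_\alpha c_\alpha\zeta_\alpha\in\mathcal F_m$ put $f(a)=\sum_\alpha c_\alpha a_\alpha$,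 where $a_\alpha=a_{\alpha_1}\cdots a_{\alpha_k}$, $a_\emptyset=1$. A subalgebra $B$ of a Fréchet-Arens-Michael algebra $A$ is holomorphically closed if $f(b)\in B$ for all $m\in\mathbb N$, $b\in B^m$, $f\in\mathcal F_m$. $\mathrm{Hol}(S)$ is the intersection of all holomorphically closed subalgebras of $A$ containing $S\subseteq A$. A Fréchet-Arens-Michael algebra $A$ is holomorphically finitely generated (HFG) if $\mathrm{Hol}(S)=A$ for some finite $S\subseteq A$. *)

(* Defs.v *)
From HB Require Import structures.
From mathcomp Require Import all_boot all_order all_algebra finmap complex.
From mathcomp Require Import ring_quotient ring.
From mathcomp Require Import all_classical reals ereal topology normedtype.
From mathcomp Require Import esum derive showcase.summability.

Set Implicit Arguments.
Unset Strict Implicit.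
Unset Printing Implicit Defensive.

Import Order.TTheory GRing.Theory Num.Theory.
Import numFieldNormedType.Exports.
Import Normc.

Local Open Scope classical_set_scope.
Local Open Scope ring_scope.
Local Open Scope complex_scope.

(* As for [PreTopologicalLmodule], the continuity of the operations is not part
   of the structure; it follows from [arens_michael] below.  [GRing.Algebra]
   excludes the zero algebra, which is harmless for universal properties: every
   algebra has exactly one morphism to it. *)
#[short(type="preTopAlgType")]
HB.structure Definition PreTopologicalAlgebra (K : numDomainType) :=
  {A of Topological A & GRing.Algebra K A}.

Section TopologicalAlgebras.
Variable R : realType.
Implicit Types A B : preTopAlgType R[i].

Definition seminorm (A : lmodType R[i]) (p : A -> R) : Prop :=
  (forall x y, p (x + y) <= p x + p y) /\
  (forall (c : R[i]) x, p (c *: x) = normc c * p x).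

Definition submultiplicative A (p : A -> R) : Prop :=
  forall x y, p (x * y) <= p x * p y.

(* The neighbourhoods of [a] for the topology defined by the family [p]. *)
Definition seminorm_nbhs (A : zmodType) (I : Type) (p : I -> A -> R) (a : A) :
    set_system A :=
  [set U | exists J : set I, exists e : R,
    [/\ finite_set J, 0 < e &
        [set b | forall j, J j -> p j (b - a) < e] `<=` U]].

Definition topology_defined_by A (I : Type) (p : I -> A -> R) : Prop :=
  forall a : A, nbhs a = seminorm_nbhs p a.

Definition cauchy_filter A (F : set_system A) : Prop :=
  (fun xy : A * A => xy.1 - xy.2) @ (F, F) --> (0 : A).

Definition complete_space A : Prop :=
  forall F : set_system A, ProperFilter F -> cauchy_filter F ->
    exists a : A, F --> a.

(* Continuity of the product follows from submultiplicativity. *)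
Definition arens_michael A : Prop :=
  [/\ exists I : Type, exists p : I -> A -> R,
        (forall i, seminorm (p i) /\ submultiplicative (p i)) /\
        topology_defined_by p,
      hausdorff_space A &
      complete_space A].

(* Metrizability of a complete Hausdorff locally convex space, expressed as the
   existence of a countable defining family of seminorms. *)
Definition frechet_arens_michael A : Prop :=
  arens_michael A /\
  exists p : nat -> A -> R, (forall k, seminorm (p k)) /\ topology_defined_by p.

Definition continuous_hom A B (f : A -> B) : Prop :=
  [/\ linear f, monoid_morphism f & continuous f].

(* [F], with the canonical maps [iota i], is a coproduct of the [A i] in the
   category of Arens-Michael algebras and continuous homomorphisms. *)
Definition analytic_free_product (I : Type) (A : I -> preTopAlgType R[i])
    (F : preTopAlgType R[i]) (iota : forall i, A i -> F) : Prop :=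
  [/\ arens_michael F,
      forall i, continuous_hom (iota i) &
      forall (B : preTopAlgType R[i]) (f : forall i, A i -> B),
        arens_michael B -> (forall i, continuous_hom (f i)) ->
        exists! g : F -> B,
          continuous_hom g /\ forall i a, g (iota i a) = f i a].

Definition two_sided_ideal A (J : set A) : Prop :=
  [/\ J 0, forall x y, J x -> J y -> J (x + y),
      forall x y, J y -> J (x * y) & forall x y, J x -> J (x * y)].

Definition closed_ideal_gen A (S : set A) : set A :=
  smallest [set J | two_sided_ideal J /\ closed J] S.

Definition subalgebra A (B : set A) : Prop :=
  [/\ B 1, forall x y, B x -> B y -> B (x + y),
      forall (c : R[i]) x, B x -> B (c *: x) &
      forall x y, B x -> B y -> B (x * y)].

(* [c] is the coefficient family of an element of F_m, the words in m letters
   being encoded as [seq 'I_m]. *)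
Definition free_entire (m : nat) (c : seq 'I_m -> R[i]) : Prop :=
  forall rho : R, 0 < rho ->
    (\esum_(w in [set: seq 'I_m]) (normc (c w) * rho ^+ size w)%:E < +oo)%E.

(* f(a) = s, for the element f of F_m with coefficients [c]: the family
   (c_w a_w) indexed by words is summable (unconditionally) with sum [s].  It is
   a relation because [lim] needs a pointed type; sums are unique in a Hausdorff
   space, and exist when [A] is Arens-Michael and [free_entire c] holds. *)
Definition free_eval A (m : nat) (c : seq 'I_m -> R[i]) (a : 'I_m -> A)
    (s : A) : Prop :=
  partial_sum (fun w : seq 'I_m => c w *: \prod_(i <- w) a i) @ totally --> s.

Definition holomorphically_closed A (B : set A) : Prop :=
  subalgebra B /\
  forall (m : nat) (b : 'I_m -> A) (c : seq 'I_m -> R[i]) (s : A),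
    (forall i, B (b i)) -> free_entire c -> free_eval c b s -> B s.

Definition Hol A (S : set A) : set A := smallest (@holomorphically_closed A) S.

Definition holomorphically_finitely_generated A : Prop :=
  frechet_arens_michael A /\
  exists S : set A, finite_set S /\ Hol S = [set: A].

End TopologicalAlgebras.

Section SeminormTopology.
Variables (R : realType) (A : zmodType) (I : Type) (p : I -> A -> R).
Hypothesis p0 : forall i, p i 0 = 0.
Hypothesis pD : forall i x y, p i (x + y) <= p i x + p i y.

Lemma seminorm_nbhs_singleton a U : seminorm_nbhs p a U -> U a.
Proof. by move=> [J [e [_ e0]]]; apply => j _ /=; rewrite subrr p0. Qed.

Lemma seminorm_nbhs_filter a : ProperFilter (seminorm_nbhs p a).
Proof.
apply: Build_ProperFilter_ex => [U|]; first by exists a; exact: seminorm_nbhs_singleton.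
split.
- by exists set0, 1; split.
- move=> U V [J [e [finJ e0 JU]]] [J' [e' [finJ' e'0 JV]]].
  exists (J `|` J'), (Num.min e e'); split.
  + by rewrite finite_setU.
  + by rewrite lt_min e0.
  + move=> b /= pb; split; [apply: JU|apply: JV] => j Jj.
    * by have := pb j (or_introl Jj); rewrite lt_min => /andP[].
    * by have := pb j (or_intror Jj); rewrite lt_min => /andP[].
- by move=> U V UV [J [e [finJ e0 JU]]]; exists J, e; split=> // b /JU /UV.
Qed.

Lemma seminorm_nbhs_nbhs a U :
  seminorm_nbhs p a U -> seminorm_nbhs p a (fun x => seminorm_nbhs p x U).
Proof.
move=> [J [e [finJ e0 JU]]]; exists J, (e / 2); split=> //.
  by rewrite divr_gt0.
move=> b /= pb; exists J, (e / 2); split=> //; first by rewrite divr_gt0.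
move=> c /= pc; apply: JU => j Jj; rewrite -(subrK b c) -addrA.
rewrite (le_lt_trans (pD _ _ _))// [e](splitr e) ltrD//; [exact: pc|exact: pb].
Qed.

End SeminormTopology.

Section ClosedQuotient.
Variables (R : realType) (A : preTopAlgType R[i]) (S : set A).

Let I : {pred A} := fun x => x \in closed_ideal_gen S.

Lemma closed_ideal_gen_ideal : two_sided_ideal (closed_ideal_gen S).
Proof.
split.
- by move=> J [[[]]].
- by move=> x y Ix Iy J CJ; case: (CJ) => -[[_ + _ _] _] _; apply; [exact: Ix|exact: Iy].
- by move=> x y Iy J CJ; case: (CJ) => -[[_ _ + _] _] _; apply; exact: Iy.
- by move=> x y Ix J CJ; case: (CJ) => -[[_ _ _ +] _] _; apply; exact: Ix.
Qed.

Lemma closed_ideal_gen_zmod_closed : zmod_closed I.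
Proof.
have [I0 ID IMl _] := closed_ideal_gen_ideal.
split; first exact/mem_set.
move=> x y /set_mem Ix /set_mem Iy; apply/mem_set.
by have := ID _ _ Ix (IMl (- 1) _ Iy); rewrite mulN1r.
Qed.

HB.instance Definition _ :=
  GRing.isZmodClosed.Build A I closed_ideal_gen_zmod_closed.

Local Open Scope quotient_scope.

(* The quotient of [A] by the closed two-sided ideal generated by [S].  It may be
   zero, so it is a [pzRingType] and an [lmodType] but not an [algType]. *)
Definition closed_quotient : Type := Quotient.quot I.

HB.instance Definition _ := GRing.Zmodule.on closed_quotient.

Definition closed_quotient_proj (x : A) : closed_quotient :=
  \pi_(Quotient.quot I) x.
Local Notation proj := closed_quotient_proj.

Lemma closed_quotient_projP (x y : A) :
  proj x = proj y <-> closed_ideal_gen S (x - y).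
Proof.
have := Quotient.idealrBE I x y; rewrite -[_ \in I]/(_ \in closed_ideal_gen S).
by move=> E; split=> [/eqP|Ixy]; [rewrite -E => /set_mem|apply/eqP; rewrite -E; exact/mem_set].
Qed.

Lemma closed_quotient_projD : {morph proj : x y / x + y}.
Proof. by move=> x y; rewrite /proj !piE. Qed.

Let projK (x : closed_quotient) : proj (repr x) = x.
Proof. exact: reprK. Qed.

Let one : closed_quotient := proj 1.
Let mul (x y : closed_quotient) : closed_quotient := proj (repr x * repr y).
Let scale (c : R[i]) (x : closed_quotient) : closed_quotient :=
  proj (c *: repr x).

Let repr_proj x : closed_ideal_gen S (repr (proj x) - x).
Proof. exact/closed_quotient_projP. Qed.

Let projM x y : proj (x * y) = mul (proj x) (proj y).
Proof.
have [_ ID IMl IMr] := closed_ideal_gen_ideal.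
apply/esym/closed_quotient_projP; rewrite -[X in X - _](subrK (repr (proj x) * y)).
rewrite -mulrBr -addrA -mulrBl.
by apply: ID; [exact: IMl|exact: IMr].
Qed.

Let projZ c x : proj (c *: x) = scale c (proj x).
Proof.
have [_ ID IMl IMr] := closed_ideal_gen_ideal.
apply/esym/closed_quotient_projP; rewrite -scalerBr -[X in _ *: X]mul1r scalerAl.
exact: IMl.
Qed.

Let mulA : associative mul.
Proof.
by move=> x y z; rewrite -(projK x) -(projK y) -(projK z) -!projM mulrA.
Qed.

Let mul1 : left_id one mul.
Proof. by move=> x; rewrite -(projK x) -projM mul1r. Qed.

Let mulr1' : right_id one mul.
Proof. by move=> x; rewrite -(projK x) -projM mulr1. Qed.

Let mulDl : left_distributive mul +%R.
Proof.
move=> x y z; rewrite -(projK x) -(projK y) -(projK z) -!projM.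
by rewrite -!closed_quotient_projD -projM mulrDl.
Qed.

Let mulDr : right_distributive mul +%R.
Proof.
move=> x y z; rewrite -(projK x) -(projK y) -(projK z) -!projM.
by rewrite -!closed_quotient_projD -projM mulrDr.
Qed.

HB.instance Definition _ :=
  GRing.Zmodule_isPzRing.Build closed_quotient mulA mul1 mulr1' mulDl mulDr.

Let scaleA a b x : scale a (scale b x) = scale (a * b) x.
Proof. by rewrite -(projK x) -!projZ scalerA. Qed.

Let scale1 : left_id 1 scale.
Proof. by move=> x; rewrite -(projK x) -projZ scale1r. Qed.

Let scaleDr : right_distributive scale +%R.
Proof.
move=> a x y; rewrite -(projK x) -(projK y) -!projZ.
by rewrite -!closed_quotient_projD -projZ scalerDr.
Qed.

Let scaleDl x : {morph scale^~ x : a b / a + b}.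
Proof.
by move=> a b; rewrite -(projK x) -!projZ -!closed_quotient_projD scalerDl.
Qed.

HB.instance Definition _ :=
  GRing.Zmodule_isLmodule.Build R[i] closed_quotient
    scaleA scale1 scaleDr scaleDl.

Let op : set_system closed_quotient := [set U | open (proj @^-1` U)].

Let opT : op setT.
Proof. exact: openT. Qed.

Let opI : setI_closed op.
Proof. by move=> U V oU oV; exact: openI. Qed.

Let op_bigU (J : Type) (f : J -> set closed_quotient) :
  (forall j, op (f j)) -> op (\bigcup_j f j).
Proof. by move=> oU; apply: bigcup_open => j _; exact: oU. Qed.

HB.instance Definition _ :=
  isOpenTopological.Build closed_quotient opT opI op_bigU.

Lemma closed_quotient_proj_linear : linear proj.
Proof. by move=> c x y; rewrite closed_quotient_projD projZ. Qed.

Lemma closed_quotient_proj_monoid_morphism : monoid_morphism proj.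
Proof. by split=> // x y; exact: projM. Qed.

Lemma closed_quotient_openE (U : set closed_quotient) :
  open U = open (proj @^-1` U).
Proof. by []. Qed.

End ClosedQuotient.

Definition isomorphic_to_closed_quotient (R : realType)
    (A B : preTopAlgType R[i]) (S : set B) : Prop :=
  exists f : A -> closed_quotient S, exists g : closed_quotient S -> A,
    [/\ linear f, monoid_morphism f, continuous f, continuous g &
        cancel f g /\ cancel g f].

Section HolomorphicFunctions.
Variables (R : realType) (r : {posnum R}).

Definition disk : set R[i]^o := [set z | `|z| < (r%:num)%:C].

(* [derivable g z 1], over the scalars R[i], is complex differentiability; as the
   disk is open, it only depends on the restriction of [g] to the disk. *)
Definition holomorphic : {pred disk -> R[i]^o} :=
  [pred f | `[< exists2 g : R[i]^o -> R[i]^o,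
      (forall z : disk, f z = g (\val z)) &
      (forall z, disk z -> derivable g z 1) >]].

Lemma holomorphic_subring_closed : subring_closed holomorphic.
Proof.
split.
- by apply/asboolP; exists (cst 1) => // z _; exact: derivable_cst.
- move=> f1 f2 /asboolP[g1 fg1 d1] /asboolP[g2 fg2 d2]; apply/asboolP.
  exists (g1 - g2) => [z|z Dz]; last by apply: derivableB; [exact: d1|exact: d2].
  by rewrite [LHS]/(f1 z - f2 z) fg1 fg2.
- move=> f1 f2 /asboolP[g1 fg1 d1] /asboolP[g2 fg2 d2]; apply/asboolP.
  exists (g1 * g2) => [z|z Dz]; last by apply: derivableM; [exact: d1|exact: d2].
  by rewrite [LHS]/(f1 z * f2 z) fg1 fg2.
Qed.

HB.instance Definition _ :=
  GRing.isSubringClosed.Build _ holomorphic holomorphic_subring_closed.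

Lemma holomorphic_scaler_closed : scaler_closed holomorphic.
Proof.
move=> c f /asboolP[g fg dg]; apply/asboolP.
exists (c \*: g) => [z|z Dz]; first by rewrite [LHS]/(c *: f z) fg.
by apply: derivableZ; exact: dg.
Qed.

HB.instance Definition _ :=
  GRing.isScaleClosed.Build R[i] (disk -> R[i]^o) holomorphic
    holomorphic_scaler_closed.

Record holo_disk := HoloDisk
  { holo_fun :> disk -> R[i]^o; _ : holo_fun \in holomorphic }.

HB.instance Definition _ := [isSub for holo_fun].
HB.instance Definition _ := [Choice of holo_disk by <:].
HB.instance Definition _ :=
  GRing.SubChoice_isSubPzRing.Build _ _ holo_disk holomorphic_subring_closed.
HB.instance Definition _ := [SubZmodule_isSubLmodule of holo_disk by <:].

Lemma disk0 : 0 \in disk.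
Proof. by rewrite inE /disk/= normr0 ltcR. Qed.

Let holo1_neq0 : 1 != 0 :> holo_disk.
Proof.
apply/eqP => /(congr1 (fun f : holo_disk => f (exist _ 0 disk0))) /eqP.
by rewrite [_ == _](@oner_eq0 R[i]).
Qed.

HB.instance Definition _ :=
  GRing.PzSemiRing_isNonZero.Build holo_disk holo1_neq0.

Let holo_scalerAl (k : R[i]) (x y : holo_disk) : k *: (x * y) = k *: x * y.
Proof. by apply/val_inj/funext => z; exact: mulrA. Qed.

HB.instance Definition _ :=
  GRing.Lmodule_isLalgebra.Build R[i] holo_disk holo_scalerAl.

Let holo_scalerAr (k : R[i]) (x y : holo_disk) : k *: (x * y) = x * (k *: y).
Proof. by apply/val_inj/funext => z; exact: mulrCA. Qed.

HB.instance Definition _ :=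
  GRing.Lalgebra_isAlgebra.Build R[i] holo_disk holo_scalerAr.

(* The topology of compact convergence. *)
HB.instance Definition _ := Topological.copy holo_disk
  (initial_topology (holo_fun : holo_disk -> {family compact, disk -> R[i]^o})).

Lemma disk_coord_holomorphic : (fun z : disk => \val z) \in holomorphic.
Proof. by apply/asboolP; exists id => // z _; exact: derivable_id. Qed.

Definition disk_coord : holo_disk := HoloDisk disk_coord_holomorphic.

End HolomorphicFunctions.

(* [F], with the canonical maps [iota i], is the free polydisk algebra. *)
Definition free_polydisk (R : realType) (n : nat) (r : {posnum R})
    (F : preTopAlgType R[i]) (iota : 'I_n -> holo_disk r -> F) : Prop :=
  analytic_free_product iota.

Definition q_relations (R : realType) (n : nat) (q : R[i])
    (F : preTopAlgType R[i]) (zeta : 'I_n -> F) : set F :=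
  [set x | exists i j : 'I_n,
    (i < j)%N /\ x = zeta i * zeta j - q *: (zeta j * zeta i)].

Section MultiIndices.
Variable n : nat.
Local Notation M := {ffun 'I_n -> nat}.
Implicit Types a b c : M.

Definition mdeg a : nat := (\sum_(i < n) a i)%N.

(* The sum of the a_i * b_j over i < j. *)
Definition mcross a b : nat := (\sum_(i < n) \sum_(j < n | i < j) a i * b j)%N.

(* The exponent of the generator x_k. *)
Definition munit (k : 'I_n) : M := [ffun i => (i == k) : nat].

Lemma mdegD a b : mdeg (a + b) = (mdeg a + mdeg b)%N.
Proof. by rewrite /mdeg -big_split; apply: eq_bigr => i _; rewrite ffunE. Qed.

Lemma mcrossDl a b c : mcross (a + b) c = (mcross a c + mcross b c)%N.
Proof.
rewrite /mcross -big_split; apply: eq_bigr => i _ /=; rewrite -big_split.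
by apply: eq_bigr => j _ /=; rewrite ffunE mulnDl.
Qed.

Lemma mcrossDr a b c : mcross a (b + c) = (mcross a b + mcross a c)%N.
Proof.
rewrite /mcross -big_split; apply: eq_bigr => i _ /=; rewrite -big_split.
by apply: eq_bigr => j _ /=; rewrite ffunE mulnDr.
Qed.

Lemma mcross0l a : mcross 0 a = 0%N.
Proof. by rewrite /mcross big1// => i _; rewrite big1// => j _; rewrite ffunE. Qed.

Lemma mcross0r a : mcross a 0 = 0%N.
Proof.
by rewrite /mcross big1// => i _; rewrite big1// => j _; rewrite ffunE muln0.
Qed.

Lemma mcross_munit i j : mcross (munit i) (munit j) = (i < j)%N.
Proof.
rewrite /mcross (bigD1 i)//= [X in (_ + X)%N]big1 ?addn0 => [|k ki]; last first.
  by rewrite big1// => l _; rewrite ffunE (negPf ki).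
have [ij|ij] := boolP (i < j)%N.
  rewrite (bigD1 j)//= big1 ?addn0 => [|l /andP[_ lj]].
    by rewrite !ffunE !eqxx.
  by rewrite !ffunE (negPf lj) muln0.
rewrite big1// => l il; rewrite !ffunE; have [lj|//] := eqVneq l j.
  by rewrite -lj il in ij.
by rewrite muln0.
Qed.

Lemma mcrossMn a b k l : mcross (a *+ k) (b *+ l) = (k * l * mcross a b)%N.
Proof.
have Ml c d m : mcross (c *+ m) d = (m * mcross c d)%N.
  elim: m => [|m IH]; first by rewrite mulr0n mcross0l.
  by rewrite mulrS mcrossDl IH mulSn.
have Mr c d m : mcross c (d *+ m) = (m * mcross c d)%N.
  elim: m => [|m IH]; first by rewrite mulr0n mcross0r.
  by rewrite mulrS mcrossDr IH mulSn.
by rewrite Ml Mr mulnA.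
Qed.

(* The multi-indices with all entries at most [N]. *)
Definition mbox (N : nat) : seq M :=
  [seq [ffun i => f i : nat] | f : {ffun 'I_n -> 'I_N.+1}].

Lemma mem_mbox N a : (a \in mbox N) = [forall i, (a i <= N)%N].
Proof.
apply/mapP/forallP => [[f _ ->] i|aN]; first by rewrite ffunE -ltnS.
exists [ffun i => inord (a i)]; first by rewrite mem_enum.
by apply/ffunP => i; rewrite !ffunE inordK// ltnS.
Qed.

Lemma mbox_uniq N : uniq (mbox N).
Proof.
rewrite map_inj_uniq ?enum_uniq// => f g fg; apply/ffunP => i.
by move/ffunP: fg => /(_ i); rewrite !ffunE => /val_inj.
Qed.

Lemma mem_mboxD N a b : a + b \in mbox N -> (a \in mbox N) && (b \in mbox N).
Proof.
rewrite !mem_mbox => /forallP abN; apply/andP; split; apply/forallP => i;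
  apply: leq_trans (abN i); rewrite ffunE; [exact: leq_addr|exact: leq_addl].
Qed.

Lemma mem_mbox_mdeg a : a \in mbox (mdeg a).
Proof.
by rewrite mem_mbox; apply/forallP => i; rewrite /mdeg (bigD1 i)//= leq_addr.
Qed.

Lemma mbox_cover (X : seq M) : exists N, {subset X <= mbox N}.
Proof.
exists (\max_(a <- X) mdeg a) => a aX; rewrite mem_mbox; apply/forallP => i.
rewrite (@leq_trans (mdeg a))//; last exact: leq_bigmax_seq.
by rewrite /mdeg (bigD1 i)//= leq_addr.
Qed.

Lemma big_mboxD (V : nmodType) N a (F : M -> V) : a \in mbox N ->
  \sum_(b <- mbox N | a == b) F b = F a.
Proof.
move=> aN; rewrite big_mkcond (bigD1_seq a) ?mbox_uniq//= eqxx.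
by rewrite big1 ?addr0// => b; rewrite eq_sym => /negPf ->.
Qed.

End MultiIndices.
Arguments munit {n} k.
Arguments mbox {n} N.

(* Formal series \sum_a f(a) x^a in q-commuting variables.  The parameter [q] is
   only used to attach to this type the product [qmul] below. *)
Definition qseries (R : realType) (n : nat) (q : R[i]) : Type :=
  {ffun 'I_n -> nat} -> R[i]^o.

Section QuantumSeries.
Variables (R : realType) (n : nat) (q : R[i]).
Local Notation M := {ffun 'I_n -> nat}.
Local Notation qseries := (qseries n q).

HB.instance Definition _ := GRing.Lmodule.copy qseries (M -> R[i]^o).

(* x^a x^b = qtwist a b x^(a + b): for i < j, each of the a_j factors x_j of x^a
   has to be moved past each of the b_i factors x_i of x^b, and
   x_j x_i = q^-1 x_i x_j. *)
Definition qtwist (a b : M) : R[i] := q^-1 ^+ mcross b a.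

Definition qmul (f g : qseries) : qseries := fun c =>
  \sum_(p \in [set p : M * M | p.1 + p.2 = c]) qtwist p.1 p.2 * (f p.1 * g p.2).

Definition qmonomial (a : M) : qseries := fun b => (a == b)%:R.

Lemma qmulE N f g c : c \in mbox N ->
  qmul f g c = \sum_(a <- mbox N) \sum_(b <- mbox N | a + b == c)
                 qtwist a b * (f a * g b).
Proof.
move=> cN; rewrite /qmul; set S := [set p | _].
pose r := [seq p <- [seq (a, b) | a <- mbox N, b <- mbox N] | p.1 + p.2 == c].
have rS : [set` r] = S :> set (M * M).
  apply/seteqP; split=> p /=; first by rewrite mem_filter => /andP[/eqP].
  move=> pc; have := cN; rewrite -pc => /mem_mboxD /andP[p1 p2].
  rewrite mem_filter pc eqxx/=; apply/allpairsP; exists p => //.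
  by case: (p) p1 p2.
rewrite -rS -(fsbig_seq _ _); last first.
  rewrite filter_uniq// allpairs_uniq ?mbox_uniq//.
  by move=> [? ?] [? ?] _ _ /=.
rewrite big_filter big_mkcond big_allpairs; apply: eq_bigr => a _.
by rewrite [RHS]big_mkcond.
Qed.

Let assocl (u v w x y z : R[i]) :
  (u * v) * (x * (w * (y * z))) = u * v * w * (x * y * z).
Proof. by ring. Qed.

Let assocr (u v w x y z : R[i]) :
  (v * w) * ((u * (x * y)) * z) = u * v * w * (x * y * z).
Proof. by ring. Qed.

Lemma qmulA : associative qmul.
Proof.
move=> f g h; apply/funext => d.
have dN := mem_mbox_mdeg d; set N := mdeg d in dN.
rewrite !(qmulE _ _ dN).
pose F a b c : R[i] :=
  if a + b + c == d
  then q^-1 ^+ (mcross b a + mcross c a + mcross c b) * (f a * g b * h c)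
  else 0.
transitivity (\sum_(a <- mbox N) \sum_(b <- mbox N) \sum_(c <- mbox N) F a b c).
- apply: eq_bigr => a _.
  transitivity (\sum_(e <- mbox N) \sum_(b <- mbox N) \sum_(c <- mbox N)
     if b + c == e then F a b c else 0).
    rewrite big_mkcond; rewrite !big_seq; apply: eq_bigr => e eN.
    case: ifPn => [/eqP aed|aed]; last first.
      rewrite big1// => b _; rewrite big1// => c _; case: ifPn => // /eqP bce.
      by rewrite /F -addrA bce (negPf aed).
    rewrite (qmulE _ _ eN) !mulr_sumr; apply: eq_bigr => b _.
    rewrite !mulr_sumr big_mkcond; apply: eq_bigr => c _.
    case: ifPn => // /eqP bce; rewrite /F -addrA bce aed eqxx.
    rewrite /qtwist -bce mcrossDl !exprD; exact: assocl.
  rewrite exchange_big/=; rewrite !big_seq; apply: eq_bigr => b bN.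
  rewrite exchange_big/=; rewrite !big_seq; apply: eq_bigr => c cN.
  rewrite -big_mkcond/=.
  have [bcN|bcN] := boolP (b + c \in mbox N).
    by rewrite (@big_mboxD _ _ _ _ (fun=> F a b c)).
  rewrite big_seq_cond big1 => [|e /andP[eN /eqP bce]]; last first.
    by rewrite bce eN in bcN.
  rewrite /F; case: ifPn => // /eqP abcd.
  have := dN; rewrite -abcd -addrA => /mem_mboxD /andP[_ bcN'].
  by rewrite bcN' in bcN.
- apply: esym.
  transitivity (\sum_(e <- mbox N) \sum_(c <- mbox N) \sum_(a <- mbox N)
     \sum_(b <- mbox N) if a + b == e then F a b c else 0).
    rewrite !big_seq; apply: eq_bigr => e eN.
    rewrite big_mkcond; apply: eq_bigr => c _.
    case: ifPn => [/eqP ecd|ecd]; last first.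
      rewrite big1// => a _; rewrite big1// => b _; case: ifPn => // /eqP abe.
      by rewrite /F abe (negPf ecd).
    rewrite (qmulE _ _ eN) mulr_suml mulr_sumr; apply: eq_bigr => a _.
    rewrite mulr_suml mulr_sumr big_mkcond; apply: eq_bigr => b _.
    case: ifPn => // /eqP abe; rewrite /F abe ecd eqxx.
    rewrite /qtwist -abe mcrossDr !exprD; exact: assocr.
  rewrite exchange_big/= [RHS](eq_bigr (fun a => \sum_(c <- mbox N) \sum_(b <- mbox N) F a b c)); last first.
    by move=> a _; exact: exchange_big.
  rewrite [RHS]exchange_big/=; rewrite !big_seq; apply: eq_bigr => c cN.
  rewrite exchange_big/=; rewrite !big_seq; apply: eq_bigr => a aN.
  rewrite exchange_big/=; rewrite !big_seq; apply: eq_bigr => b bN.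
  rewrite -big_mkcond/=.
  have [abN|abN] := boolP (a + b \in mbox N).
    by rewrite (@big_mboxD _ _ _ _ (fun=> F a b c)).
  rewrite big_seq_cond big1 => [|e /andP[eN /eqP abe]]; last first.
    by rewrite abe eN in abN.
  rewrite /F; case: ifPn => // /eqP abcd.
  have := dN; rewrite -abcd => /mem_mboxD /andP[abN' _].
  by rewrite abN' in abN.
Qed.

Let one : qseries := qmonomial 0.

Lemma qmonomial_mul a b :
  qmul (qmonomial a) (qmonomial b) = qtwist a b *: qmonomial (a + b).
Proof.
apply/funext => c; have cN := mem_mbox_mdeg c; rewrite (qmulE _ _ cN).
set N := mdeg c in cN *.
have -> : (qtwist a b *: qmonomial (a + b)) c = qtwist a b * (a + b == c)%:R.
  by [].
have [abc|abc] := eqVneq (a + b) c; last first.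
  rewrite [RHS]mulr0 big1// => a' _; rewrite big1// => b' /eqP abc'.
  rewrite /qmonomial; have [aa'|] := eqVneq a a'; last by rewrite mul0r mulr0.
  have [bb'|] := eqVneq b b'; last by rewrite !mulr0.
  by move: abc; rewrite aa' bb' abc' eqxx.
have /andP[aN bN] : (a \in mbox N) && (b \in mbox N).
  by apply: mem_mboxD; rewrite abc.
rewrite [RHS]mulr1 (bigD1_seq a) ?mbox_uniq//= [X in _ + X]big1 ?addr0; last first.
  move=> a' a'a; rewrite big1// => b' _.
  by rewrite /qmonomial eq_sym (negPf a'a) mul0r mulr0.
rewrite big_mkcond (bigD1_seq b) ?mbox_uniq//= abc eqxx big1 ?addr0.
  by rewrite /qmonomial !eqxx !mulr1.
move=> b' b'b; case: ifP => // _.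
by rewrite /qmonomial [b == b']eq_sym (negPf b'b) !mulr0.
Qed.

Lemma qmul1l : left_id one qmul.
Proof.
move=> f; apply/funext => c; have cN := mem_mbox_mdeg c.
rewrite (qmulE _ _ cN); set N := mdeg c in cN *.
have zN : (0 : M) \in mbox N.
  by rewrite mem_mbox; apply/forallP => i; rewrite ffunE.
rewrite (bigD1_seq 0) ?mbox_uniq//= [X in _ + X]big1 ?addr0; last first.
  move=> a a0; rewrite big1// => b _.
  by rewrite /one /qmonomial eq_sym (negPf a0) mul0r mulr0.
under eq_bigl do rewrite add0r eq_sym.
rewrite (big_mboxD (fun b => _) cN).
by rewrite /one /qmonomial eqxx /qtwist mcross0r expr0 !mul1r.
Qed.

Lemma qmul1r : right_id one qmul.
Proof.
move=> f; apply/funext => c; have cN := mem_mbox_mdeg c.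
rewrite (qmulE _ _ cN); set N := mdeg c in cN *.
have zN : (0 : M) \in mbox N.
  by rewrite mem_mbox; apply/forallP => i; rewrite ffunE.
transitivity (\sum_(a <- mbox N | c == a) qtwist a 0 * (f a * one 0)).
  rewrite [RHS]big_mkcond; apply: eq_bigr => a _.
  rewrite big_mkcond (bigD1_seq 0) ?mbox_uniq//= addr0 eq_sym.
  rewrite [X in _ + X]big1 ?addr0// => b b0; case: ifP => // _.
  by rewrite /one /qmonomial [0 == b]eq_sym (negPf b0) !mulr0.
rewrite (big_mboxD (fun b => _) cN).
by rewrite /one /qmonomial eqxx /qtwist mcross0l expr0 mul1r mulr1.
Qed.

Let sumD (I : Type) (s : seq I) (P : pred I) (F G : I -> R[i]) :
  \sum_(i <- s | P i) (F i + G i) =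
  \sum_(i <- s | P i) F i + \sum_(i <- s | P i) G i.
Proof. exact: big_split. Qed.

Lemma qmulDl : left_distributive qmul +%R.
Proof.
move=> f g h; apply/funext => c; have cN := mem_mbox_mdeg c.
apply/esym; transitivity ((qmul f h c : R[i]) + qmul g h c); first by [].
rewrite !(qmulE _ _ cN) -sumD; apply: eq_bigr => a _.
by rewrite -sumD; apply: eq_bigr => b _; rewrite -mulrDr -mulrDl.
Qed.

Lemma qmulDr : right_distributive qmul +%R.
Proof.
move=> f g h; apply/funext => c; have cN := mem_mbox_mdeg c.
apply/esym; transitivity ((qmul f g c : R[i]) + qmul f h c); first by [].
rewrite !(qmulE _ _ cN) -sumD; apply: eq_bigr => a _.
by rewrite -sumD; apply: eq_bigr => b _; rewrite -mulrDr -mulrDr.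
Qed.

Lemma qone_neq0 : one != 0.
Proof.
apply/eqP => /(congr1 (fun f : qseries => f 0)).
rewrite /one /qmonomial eqxx => E.
have /eqP : (1 : R[i]) = 0 by exact: E.
by rewrite oner_eq0.
Qed.

HB.instance Definition _ :=
  GRing.Zmodule_isNzRing.Build qseries
    qmulA qmul1l qmul1r qmulDl qmulDr qone_neq0.

Let qscalerAl (k : R[i]) (x y : qseries) : k *: (x * y) = k *: x * y.
Proof.
apply/funext => c; have cN := mem_mbox_mdeg c.
transitivity (k * (qmul x y c : R[i])); first by [].
transitivity (qmul (k *: x) y c); last by [].
rewrite !(qmulE _ _ cN) mulr_sumr; apply: eq_bigr => a _.
rewrite mulr_sumr; apply: eq_bigr => b _; rewrite mulrCA; congr (_ * _).
exact: mulrA.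
Qed.

HB.instance Definition _ :=
  GRing.Lmodule_isLalgebra.Build R[i] qseries qscalerAl.

Let qscalerAr (k : R[i]) (x y : qseries) : k *: (x * y) = x * (k *: y).
Proof.
apply/funext => c; have cN := mem_mbox_mdeg c.
transitivity (k * (qmul x y c : R[i])); first by [].
transitivity (qmul x (k *: y) c); last by [].
rewrite !(qmulE _ _ cN) mulr_sumr; apply: eq_bigr => a _.
rewrite mulr_sumr; apply: eq_bigr => b _; rewrite mulrCA; congr (_ * _).
exact: mulrCA.
Qed.

HB.instance Definition _ :=
  GRing.Lalgebra_isAlgebra.Build R[i] qseries qscalerAr.

Definition qgen (i : 'I_n) : qseries := qmonomial (munit i).

(* The two lemmas below pin down the product: the generators satisfy the
   defining relations, and [qmonomial a] is x_1^a_1 ... x_n^a_n. *)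
Lemma qgen_comm (i j : 'I_n) : q != 0 -> (i < j)%N ->
  qgen i * qgen j = q *: (qgen j * qgen i).
Proof.
move=> q0 ij; have E (a b : M) : qmonomial a * qmonomial b =
  qtwist a b *: qmonomial (a + b) by exact: qmonomial_mul.
rewrite /qgen !E scalerA [munit j + _]addrC; congr (_ *: _).
rewrite /qtwist !mcross_munit ij ltnNge (ltnW ij)/= expr0 expr1.
by rewrite mulfV.
Qed.

Lemma qmonomialE (a : M) : qmonomial a = \prod_(i < n) qgen i ^+ a i.
Proof.
have E (b c : M) : mcross c b = 0%N ->
    qmonomial b * qmonomial c = qmonomial (b + c).
  move=> bc; transitivity (qtwist b c *: qmonomial (b + c)).
    exact: qmonomial_mul.
  by rewrite /qtwist bc expr0 scale1r.
have X (i : 'I_n) k : qgen i ^+ k = qmonomial (munit i *+ k).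
  elim: k => [|k IH]; first by rewrite expr0 mulr0n.
  rewrite exprS IH E ?mulrS// -{2}[munit i]mulr1n mcrossMn mcross_munit.
  by rewrite ltnn muln0.
under eq_bigr do rewrite X.
have P (s : seq 'I_n) : sorted (fun i j : 'I_n => i < j)%N s ->
    \prod_(i <- s) qmonomial (munit i *+ a i) =
    qmonomial (\sum_(i <- s) munit i *+ a i).
  elim: s => [|i s IH] /=; first by rewrite !big_nil.
  move=> is_; rewrite !big_cons IH ?(path_sorted is_)//; apply: E.
  have {is_} : all (fun j : 'I_n => i < j)%N s.
    by apply: order_path_min is_ => x y z; exact: ltn_trans.
  elim: s {IH} => [|j s IH] /=; first by rewrite big_nil mcross0l.
  move=> /andP[ij /IH E0]; rewrite big_cons mcrossDl E0 addn0 mcrossMn.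
  by rewrite mcross_munit ltnNge (ltnW ij) muln0.
rewrite P; last first.
  rewrite -(@map_id 'I_n (index_enum _)).
  have : sorted ltn [seq val i | i <- enum 'I_n].
    by rewrite val_enum_ord iota_ltn_sorted.
  by rewrite sorted_map enumT map_id.
have Mn (b : M) k l : (b *+ k) l = (k * b l)%N.
  elim: k => [|k IH]; first by rewrite mulr0n ffunE.
  by rewrite mulrS ffunE IH mulSn.
congr qmonomial; apply/ffunP => k; rewrite sum_ffunE (bigD1 k)//= big1 => [|i ik].
  by rewrite addr0 Mn ffunE eqxx muln1.
by rewrite Mn ffunE eq_sym (negPf ik) muln0.
Qed.

End QuantumSeries.

Section QuantumPolydisk.
Variables (R : realType) (n : nat) (q : R[i]) (r : R).
Local Notation M := {ffun 'I_n -> nat}.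
Local Notation qseries := (qseries n q).

Definition qweight (a : M) : R :=
  if 1 <= normc q then 1 else normc q ^+ mcross a a.

Definition qterm (rho : R) (f : qseries) (a : M) : R :=
  normc (f a) * qweight a * rho ^+ mdeg a.

(* The norm of index [rho] of a formal series, possibly infinite. *)
Definition qenorm (rho : R) (f : qseries) : \bar R :=
  (\esum_(a in [set: M]) (qterm rho f a)%:E)%E.

Definition qpolydisk_pred : {pred qseries} :=
  [pred f | `[< forall rho, 0 < rho < r -> (qenorm rho f < +oo)%E >]].

Lemma normc_ge0 (z : R[i]) : 0 <= normc z.
Proof. by case: z => x y /=; exact: sqrtr_ge0. Qed.

Lemma ler_normcD (x y : R[i]) : normc (x + y) <= normc x + normc y.
Proof. exact: (@le_normcD R x y). Qed.

Lemma normcX (z : R[i]) k : normc (z ^+ k) = normc z ^+ k.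
Proof. by elim: k => [|k IH]; rewrite ?expr0 ?normc1// !exprS normcM IH. Qed.

Lemma normc_sum (I : Type) (s : seq I) (P : pred I) (F : I -> R[i]) :
  normc (\sum_(i <- s | P i) F i) <= \sum_(i <- s | P i) normc (F i).
Proof.
elim/big_ind2 : _ => [|x a y b xa yb|//]; first by rewrite normc0.
by rewrite (le_trans (ler_normcD _ _))// lerD.
Qed.

Lemma qweight_ge0 a : 0 <= qweight a.
Proof. by rewrite /qweight; case: ifP => // _; exact/exprn_ge0/normc_ge0. Qed.

Lemma qweightD a b :
  normc (qtwist q a b) * qweight (a + b) <= qweight a * qweight b.
Proof.
rewrite /qweight /qtwist normcX normcV; case: ifPn => [q1|].
  by rewrite !mulr1 exprn_ile1 ?invr_ge0 ?normc_ge0// invf_le1// (lt_le_trans _ q1).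
rewrite -ltNge => /ltW q1; have q0 := normc_ge0 q.
rewrite mcrossDl !mcrossDr !exprD; set t := normc q in q0 q1 *.
have inv_le1 k : t^-1 ^+ k * t ^+ k <= 1.
  rewrite -exprMn; have [->|tn0] := eqVneq t 0; last by rewrite mulVf// expr1n.
  by rewrite mulr0 exprn_ile1.
set x := t ^+ mcross a a; set y := t ^+ mcross b b.
set z := t ^+ mcross b a; set w := t ^+ mcross a b.
rewrite [leLHS](_ : _ = (t^-1 ^+ mcross b a * z) * (w * (x * y))); last by ring.
have xy0 : 0 <= x * y by rewrite mulr_ge0// exprn_ge0.
have wxy0 : 0 <= w * (x * y) by rewrite mulr_ge0// exprn_ge0.
rewrite (le_trans (ler_piMl wxy0 (inv_le1 _)))//.
by rewrite ler_piMl// exprn_ile1.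
Qed.

Lemma qterm_ge0 rho f a : 0 <= rho -> 0 <= qterm rho f a.
Proof.
by move=> rho0; rewrite !mulr_ge0 ?normc_ge0 ?qweight_ge0 ?exprn_ge0.
Qed.

Lemma qenorm_boxP rho f : 0 <= rho ->
  (qenorm rho f < +oo)%E <->
  exists K : R, forall N, \sum_(a <- mbox N) qterm rho f a <= K.
Proof.
move=> rho0; split=> [fin|[K fK]].
- exists (fine (qenorm rho f)) => N.
  rewrite -lee_fin fineK; last first.
    rewrite ge0_fin_numE//; apply: esum_ge0 => a _.
    by rewrite lee_fin qterm_ge0.
  rewrite -sumEFin; apply: esum_ge; exists [set` mbox N].
    by split=> //; exact: finite_seq.
  by rewrite -fsbig_seq// mbox_uniq.
- rewrite (@le_lt_trans _ _ K%:E) ?ltry//.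
  apply: ge_ereal_sup => _ [X [finX _] <-].
  rewrite fsbig_finite//=; have [N XN] := mbox_cover (fset_set X).
  rewrite sumEFin lee_fin (le_trans _ (fK N))//.
  rewrite [leRHS](bigID (mem (fset_set X)))/= -[leLHS]addr0 lerD//; last first.
    by apply: sumr_ge0 => a _; exact: qterm_ge0.
  rewrite -[leRHS]big_filter (perm_big [seq a <- mbox N | a \in fset_set X])//.
  apply: uniq_perm => [||a]; rewrite ?filter_uniq ?mbox_uniq ?fset_uniq//.
  rewrite mem_filter; have [/XN ->|] := boolP (a \in fset_set X); rewrite ?andbT//.
Qed.

Lemma qpolydisk_subalg_closed : subalg_closed qpolydisk_pred.
Proof.
split.
- apply/asboolP => rho /andP[/ltW rho0 _]; apply/(qenorm_boxP _ rho0).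
  exists (qterm rho 1 0) => N; rewrite (bigD1_seq 0) ?mbox_uniq//=; last first.
    by rewrite mem_mbox; apply/forallP => i; rewrite ffunE.
  rewrite gerDl big1// => a a0.
  transitivity (normc (0 : R[i]) * qweight a * rho ^+ mdeg a); last first.
    by rewrite normc0 !mul0r.
  congr (normc _ * _ * _); transitivity ((0 == a)%:R : R[i]); first by [].
  by rewrite eq_sym (negPf a0).
- move=> c f g /asboolP hf /asboolP hg; apply/asboolP => rho rho0r.
  have /andP[/ltW rho0 _] := rho0r.
  have /(qenorm_boxP _ rho0)[K fK] := hf _ rho0r.
  have /(qenorm_boxP _ rho0)[L gL] := hg _ rho0r.
  apply/(qenorm_boxP _ rho0); exists (normc c * K + L) => N.
  rewrite (le_trans _ (lerD (ler_wpM2l (normc_ge0 c) (fK N)) (gL N)))//.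
  rewrite mulr_sumr -big_split ler_sum//= => a _.
  rewrite /qterm !mulrA -!mulrDl; do 2! rewrite ler_wpM2r ?exprn_ge0 ?qweight_ge0//.
  by rewrite -normcM; exact: ler_normcD.
- move=> f g /asboolP hf /asboolP hg; apply/asboolP => rho rho0r.
  have /andP[/ltW rho0 _] := rho0r.
  have /(qenorm_boxP _ rho0)[K fK] := hf _ rho0r.
  have /(qenorm_boxP _ rho0)[L gL] := hg _ rho0r.
  apply/(qenorm_boxP _ rho0); exists (K * L) => N.
  pose s := mbox N : seq M.
  pose F a b := qterm rho f a * qterm rho g b.
  have F0 a b : 0 <= F a b by rewrite mulr_ge0 ?qterm_ge0.
  apply: (@le_trans _ _ (\sum_(a <- s) \sum_(b <- s) F a b)); last first.
    rewrite -big_distrlr/=; apply: ler_pM; [| |exact: fK|exact: gL];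
      by apply: sumr_ge0 => a _; exact: qterm_ge0.
  apply: (@le_trans _ _ (\sum_(c <- s) \sum_(a <- s) \sum_(b <- s | a + b == c) F a b)).
    rewrite big_seq [leRHS]big_seq ler_sum// => c cN.
    rewrite /qterm -[(f * g) c]/(qmul f g c) (qmulE _ _ cN).
    rewrite -mulrA (le_trans (ler_wpM2r _ (normc_sum _ _ _)))//.
      by rewrite mulr_ge0 ?qweight_ge0 ?exprn_ge0.
    rewrite mulr_suml ler_sum// => a _.
    rewrite (le_trans (ler_wpM2r _ (normc_sum _ _ _)))//.
      by rewrite mulr_ge0 ?qweight_ge0 ?exprn_ge0.
    rewrite mulr_suml ler_sum// => b /eqP <-.
    rewrite !normcM mdegD exprD /F /qterm.
    set t := normc (qtwist _ _ _); set x := normc (f a); set y := normc (g b).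
    rewrite [leLHS](_ : _ =
      (t * qweight (a + b)) * (x * y * (rho ^+ mdeg a * rho ^+ mdeg b))); last by ring.
    rewrite [leRHS](_ : _ =
      (qweight a * qweight b) * (x * y * (rho ^+ mdeg a * rho ^+ mdeg b))); last by ring.
    by rewrite ler_wpM2r ?qweightD// !mulr_ge0 ?normc_ge0 ?exprn_ge0.
  rewrite exchange_big/= ler_sum// => a _.
  under eq_bigr do rewrite big_mkcond.
  rewrite exchange_big/= ler_sum// => b _.
  rewrite -big_mkcond/=; have [abN|abN] := boolP (a + b \in s).
    by rewrite (big_mboxD (fun=> F a b) abN).
  rewrite big_seq_cond big1// => c /andP[cN /eqP abc].
  by rewrite abc cN in abN.
Qed.

HB.instance Definition _ :=
  GRing.isSubalgClosed.Build R[i] qseries qpolydisk_pred qpolydisk_subalg_closed.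

Record qpolydisk := QPolydisk
  { qpolydisk_series :> qseries; _ : qpolydisk_series \in qpolydisk_pred }.

HB.instance Definition _ := [isSub for qpolydisk_series].
HB.instance Definition _ := [Choice of qpolydisk by <:].
HB.instance Definition _ := [SubChoice_isSubAlgebra of qpolydisk by <:].

Definition qradius : Type := {rho : R | 0 < rho < r}.

Definition qnorm (rho : qradius) (f : qpolydisk) : R :=
  fine (qenorm (sval rho) f).

Let qnorm0 rho : qnorm rho 0 = 0.
Proof.
rewrite /qnorm /qenorm esum1// => a _; rewrite /qterm.
by rewrite [X in normc X](_ : _ = 0)// normc0 !mul0r.
Qed.

Let qnormD rho f g : qnorm rho (f + g) <= qnorm rho f + qnorm rho g.
Proof.
have rho0 : 0 <= sval rho by have /andP[/ltW] := svalP rho.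
have fin (h : qpolydisk) : qenorm (sval rho) h \is a fin_num.
  rewrite ge0_fin_numE; last by apply: esum_ge0 => a _; rewrite lee_fin qterm_ge0.
  by have /asboolP := valP h; apply; exact: (svalP rho).
rewrite /qnorm -fineD// fine_le// ?fin_numD ?fin//.
rewrite /qenorm -esumD; try by move=> a _; rewrite lee_fin qterm_ge0.
apply: le_esum => a _; rewrite -EFinD lee_fin /qterm -!mulrDl.
by do 2! rewrite ler_wpM2r ?exprn_ge0 ?qweight_ge0//; exact: ler_normcD.
Qed.

HB.instance Definition _ := hasNbhs.Build qpolydisk (seminorm_nbhs qnorm).
HB.instance Definition _ := Nbhs_isNbhsTopological.Build qpolydisk
  (seminorm_nbhs_filter qnorm0)
  (@seminorm_nbhs_singleton _ _ _ _ qnorm0)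
  (seminorm_nbhs_nbhs qnormD).

End QuantumPolydisk.

(* Main.v *)
From HB Require Import structures.
Require Import Defs.
From mathcomp Require Import all_boot all_order all_algebra finmap complex.
From mathcomp Require Import ring lra.
From mathcomp Require Import all_classical reals ereal interval_inference topology normedtype.
From mathcomp Require Import sequences esum derive realfun exp trigo showcase.summability.
From mathcomp Require Import measure lebesgue_measure lebesgue_integral ftc.

(** Write Q for the quantum polydisk, with generators x_i, and F for the free one,
    with generators zeta_i.

    Q as a quotient of F. A function holomorphic on the disk is the sum of its Taylor
    series ([taylor]), with Cauchy estimates at every radius; hence f |-> sum_k c_k
    x_i^k is a continuous morphism to Q ([holo_calc]), and these morphisms
    induce phi : F -> Q because Q is an Arens-Michael algebra. Its inverse modulo
    the relations is obtained from ordered monomials: taken in increasing order of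
    the variables if |q| >= 1 and in decreasing order otherwise, they have norm
    rho^|a| in Q, and at most D rho^|a|, for some rho < r, for any continuous
    seminorm of F ([generator_growth]). So sum_a c_a x^a |-> sum_a c_a zeta^a is a
    continuous linear map G : Q -> F ([qsum]), and phi G = id. The elements x of F
    such that G (phi x) - x lies in the closed ideal J of the relations form a closed
    subspace that contains 1 and is stable under left multiplication by each
    zeta_i, because rewriting zeta_i zeta^a in order modulo J involves the same
    coefficient as in Q ([straighten_omon]). As F is topologically generated by its
    factors ([free_product_generated]), every x has this property, so phi and G
    induce inverse isomorphisms between F / J and Q.

    Taylor's theorem for a function that is merely differentiable at every point is
    derived by Goursat's bisection ([rectangle_function_eq0]), applied in polar
    coordinates around the point w to the form f z dz / (z - w): its integral over
    the circle of radius sigma is the same as over a contour shrinking to w.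

    Holomorphic generation of Q. The disk has a proper embedding in a finite
    dimensional space, given by the coordinate and two lacunary series. Accordingly
    Q is generated by the x_i and, for each i, by the sums gamma_0 and gamma_1 of
    the terms A_j x_i^(N_j) with j even and j odd, where the exponents increase so
    fast that the term of index j dominates the later ones up to a radius
    rho_(2j+3), the radii rho_k increasing to r ([lacunary_exists]). Subtracting
    the terms of index less than j and dividing by A_j, one recovers x_i^(N_j) up to
    higher order by a Picard iteration ([lacunary_power]): it is approximated, in
    the norm of radius rho_(2j+2), by polynomials in the generators whose l^1 norm,
    with letters of weight j, is at most rho_(2j)^(N_j). Consequently any f in Q is
    approximated at the radius rho_(2j+2) by such polynomials of norm at most a
    constant times the norm of f at the radius rho_(2j) ([word_approximation]).
    Approximating f, then the error, and so on, f becomes a series of polynomials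
    u_j in the generators, the l^1 norm of u_j with letters of weight j being
    O(2^-j) ([word_series]); collecting the coefficients of each word gives an
    entire series in free variables whose value at the generators is f
    ([holomorphically_closed_wseries]). *)

Set Implicit Arguments.
Unset Strict Implicit.
Unset Printing Implicit Defensive.

Import Order.TTheory GRing.Theory Num.Theory.
Import numFieldNormedType.Exports.
Import Normc.

Local Open Scope classical_set_scope.
Local Open Scope ring_scope.
Local Open Scope complex_scope.

Local Notation Re := complex.Re.
Local Notation Im := complex.Im.

(** * The complex plane *)

Lemma half01 (R : realType) : 0 <= (2^-1 : R) < 1.
Proof. by rewrite invr_ge0 ler0n invf_lt1// ltr1n. Qed.

Lemma le_of_eq (R : realType) (x y : R) : x = y -> x <= y.
Proof. by move->. Qed.

Lemma geometric_small (R : realType) (B x e : R) : 0 <= x < 1 -> 0 < e ->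
  exists N, forall k, (N <= k)%N -> B * x ^+ k < e.
Proof.
move=> /andP[x0 x1] e0; have : (fun k => B * x ^+ k) @ \oo --> (0 : R).
  rewrite -[X in _ --> X](mulr0 B); apply: cvgM; first exact: cvg_cst.
  by apply: cvg_expr; rewrite ger0_norm.
move=> /cvgrPdist_lt/(_ _ e0)[N _ HN]; exists N => k /HN /=.
by rewrite sub0r normrN; apply: le_lt_trans; exact: ler_norm.
Qed.

Lemma geometric_sum_le (R : realType) (u : nat -> R) (B t : R) N :
  0 <= B -> 0 <= t < 1 -> (forall k, u k <= B * t ^+ k) ->
  \sum_(k < N) u k <= B / (1 - t).
Proof.
move=> B0 /andP[t0 t1] uB; have t1' : 0 < 1 - t by rewrite subr_gt0.
suff : \sum_(k < N) u k <= B / (1 - t) * (1 - t ^+ N).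
  move=> /le_trans; apply; rewrite ler_piMr ?gerBl ?exprn_ge0//.
  by rewrite divr_ge0// ltW.
elim: N => [|N IH]; first by rewrite big_ord0 expr0 subrr mulr0.
rewrite big_ord_recr/=; apply: le_trans (lerD IH (uB N)) _.
by apply: le_of_eq; rewrite exprS; field; rewrite gt_eqF.
Qed.

Section ComplexPlane.
Variable R : realType.
Local Notation C := (R[i]^o).
Implicit Types (z w : C) (x y e : R).

Lemma normcR x : normc x%:C = `|x|.
Proof. by rewrite /= expr0n/= addr0 sqrtr_sqr. Qed.

Lemma normc_Re z : `|Re z| <= normc z.
Proof.
case: z => a b /=; rewrite -sqrtr_sqr ler_wsqrtr//.
by rewrite lerDl sqr_ge0.
Qed.

Lemma normc_Im z : `|Im z| <= normc z.
Proof.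
case: z => a b /=; rewrite -sqrtr_sqr ler_wsqrtr//.
by rewrite lerDr sqr_ge0.
Qed.

Lemma normc_ReIm z : normc z <= `|Re z| + `|Im z|.
Proof.
case: z => a b /=; rewrite -[leRHS]ger0_norm ?addr_ge0// -sqrtr_sqr ler_wsqrtr//.
rewrite sqrrD !real_normK ?num_real//; have : 0 <= `|a| * `|b| by rewrite mulr_ge0.
by lra.
Qed.

Lemma cReD z w : Re (z + w) = Re z + Re w. Proof. by case: z w => ? ? []. Qed.

Lemma cImD z w : Im (z + w) = Im z + Im w. Proof. by case: z w => ? ? []. Qed.

Lemma cReB z w : Re (z - w) = Re z - Re w. Proof. by case: z w => ? ? []. Qed.

Lemma cImB z w : Im (z - w) = Im z - Im w. Proof. by case: z w => ? ? []. Qed.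

Lemma cReM z w : Re (z * w) = Re z * Re w - Im z * Im w.
Proof. by case: z w => ? ? []. Qed.

Lemma cImM z w : Im (z * w) = Re z * Im w + Im z * Re w.
Proof. by case: z w => ? ? []. Qed.

Lemma normcB z w : normc (z - w) = normc (w - z).
Proof. by rewrite -normcN opprB. Qed.

Lemma nbhsCP z (U : set C) :
  nbhs z U <-> exists2 e, 0 < e & forall w, normc (w - z) < e -> U w.
Proof.
split.
- move=> /nbhs_ballP[e /= e0 eU]; case: e e0 eU => a b; rewrite ltcE/= => /andP[/eqP b0 a0] eU.
  exists a => // w wz; apply: eU; rewrite /ball/= ltcE/= b0 eqxx/=.
  by rewrite -normcB in wz.
- move=> [e e0 eU]; apply/nbhs_ballP; exists e%:C => /=; first by rewrite ltcR.
  by move=> w; rewrite /ball/= ltcR => wz; apply: eU; rewrite normcB.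
Qed.

Lemma cvgCP (T : Type) (F : set_system T) {FF : Filter F} (f : T -> C) z :
  f @ F --> z <-> forall e, 0 < e -> \forall t \near F, normc (f t - z) < e.
Proof.
split=> [fz e e0|H U /nbhsCP[e e0 eU]]; last first.
  by near=> t; apply: eU; near: t; exact: H.
by apply: (fz [set w | normc (w - z) < e]); apply/nbhsCP; exists e.
Unshelve. all: by end_near. Qed.

Lemma cvgC_ReIm (T : Type) (F : set_system T) {FF : Filter F} (f : T -> C) z :
  f @ F --> z <-> (Re (f t) @[t --> F] --> Re z) /\ (Im (f t) @[t --> F] --> Im z).
Proof.
split=> [/cvgCP H|[H1 H2]].
  split; apply/cvgrPdist_lt => e e0; near=> t.
    rewrite distrC -raddfB; apply: le_lt_trans (normc_Re _) _.
    by near: t; exact: H.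
  rewrite distrC -raddfB; apply: le_lt_trans (normc_Im _) _.
  by near: t; exact: H.
apply/cvgCP => e e0; near=> t; apply: le_lt_trans (normc_ReIm _) _.
rewrite !raddfB/= [e]splitr ltrD// distrC; near: t.
  by move/cvgrPdist_lt: H1; apply; rewrite divr_gt0.
by move/cvgrPdist_lt: H2; apply; rewrite divr_gt0.
Unshelve. all: by end_near. Qed.

Lemma continuous_normc : continuous (fun w : C => normc w : R).
Proof.
move=> w; apply/(@cvgrPdist_lt _ _ _ (nbhs w) (nbhs_filter w)) => e e0.
apply/nbhsCP; exists e => // w' ww'; apply: le_lt_trans ww'.
rewrite ler_norml; have := ler_normcD (w - w') w'; have := ler_normcD (w' - w) w.
by rewrite !subrK (normcB w); lra.
Qed.

Lemma compact_cdisk (rho : R) : compact [set z : C | normc z <= rho].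
Proof.
have [rho0|rho0] := leP 0 rho; last first.
  rewrite (_ : [set _ | _] = set0); first exact: compact0.
  apply/seteqP; split=> // z /= zr; have := le_lt_trans zr rho0.
  by rewrite ltNge normc_ge0.
have cK : compact (`[- rho, rho]%classic `*` `[- rho, rho]%classic : set (R * R)).
  by apply: compact_setX; exact: segment_compact.
have cI : compact ((fun p : R * R => (p.1 +i* p.2 : C)) @`
    (`[- rho, rho]%classic `*` `[- rho, rho]%classic)).
  apply: continuous_compact => //; apply: continuous_subspaceT => -[x y].
  by apply/cvgC_ReIm; split; [exact: cvg_fst|exact: cvg_snd].
apply: subclosed_compact cI _; last first.
  move=> z /= zr; exists (Re z, Im z); last by case: (z).
  by split=> /=; rewrite in_itv/= -ler_norml; apply: le_trans zr;
    [exact: normc_Re|exact: normc_Im].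
rewrite -openC openE => z /= /negP; rewrite -ltNge => zr.
apply/nbhsCP; exists (normc z - rho); rewrite ?subr_gt0// => w wz /= wr.
have : normc z <= normc w + normc (w - z).
  rewrite -[normc (w - z)]normcB; apply: le_trans (ler_normcD _ _).
  by rewrite addrC subrK.
by move: wz wr; lra.
Qed.

End ComplexPlane.

(** * Antiderivatives and integrals along an interval *)

Section Antiderivative.
Variable R : realType.
Implicit Types (h H : R -> R) (a b x y : R).

Lemma antiderivative_right h a : continuous h ->
  exists H, forall x, a < x -> is_derive x 1 H (h x).
Proof.
move=> ch; exists (fun x => \int[lebesgue_measure]_(t in `[a, x]) h t) => x ax.
have xx1 : x < x + 1 by rewrite ltrDl.
have hi : lebesgue_measure.-integrable `[a, x + 1] (EFin \o h).
  apply: continuous_compact_integrable; first exact: segment_compact.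
  exact: continuous_subspaceT.
have [dH <-] := continuous_FTC1_closed xx1 hi ax (ch x).
by rewrite derive1E; exact/derivableP.
Qed.

Lemma derive0_constant H a b : a <= b ->
  (forall x, a <= x <= b -> is_derive x 1 H 0) -> H a = H b.
Proof.
move=> ab dH; have [||c _ /eqP] := @MVT_segment R H (fun=> 0) a b ab.
- by move=> x /[!in_itv]/= /andP[ax xb]; apply: dH; rewrite !ltW.
- apply: derivable_within_continuous => x /[!in_itv]/= xab.
  by have [] := dH x xab.
- by rewrite mul0r subr_eq0 => /eqP.
Qed.

(** Antiderivatives exist on half-lines bounded below; normalised to vanish at 0,
    they agree wherever two of them are defined, so they glue. *)
Lemma antiderivative h : continuous h ->
  exists H, forall x, is_derive x 1 H (h x).
Proof.
move=> ch.
have /choice[G dG] (n : nat) : exists H : R -> R,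
    H 0 = 0 /\ forall x, - n.+1%:R < x -> is_derive x 1 H (h x).
  have [H dH] := antiderivative_right (- n.+1%:R) ch.
  exists (H - cst (H 0)); split; first by rewrite /= !fctE subrr.
  move=> x nx; rewrite -[h x]subr0; apply: is_deriveB; exact: dH.
have GE m n x : - m.+1%:R < x -> - n.+1%:R < x -> G m x = G n x.
  move=> mx nx; suff : (G m - G n) 0 = (G m - G n) x.
    rewrite !fctE (dG m).1 (dG n).1 subrr => /esym/eqP.
    by rewrite subr_eq0 => /eqP.
  have D y : Num.min 0 x <= y -> is_derive y 1 (G m - G n) 0.
    move=> y0; rewrite -[0](subrr (h y)); apply: is_deriveB; apply: (dG _).2;
      by apply: lt_le_trans y0; rewrite lt_min oppr_lt0 ltr0Sn.
  have [x0|x0] := leP 0 x.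
    by apply: derive0_constant => // y /andP[y0 _]; apply: D; rewrite ge_min y0.
  by apply/esym; apply: derive0_constant => [|y /andP[y0 _]]; rewrite ?ltW//;
    apply: D; rewrite ge_min y0 orbT.
pose k x := Num.trunc `|x|.
have kx x : `|x| < (k x).+1%:R by rewrite truncnS_gt.
exists (fun x => G (k x) x) => x.
have xk := kx x.
have dGx : is_derive x 1 (G (k x)) (h x).
  by apply: (dG _).2; move: xk; rewrite ltr_norml => /andP[].
have near_G : {near x, G (k x) =1 (fun x => G (k x) x)}.
  have : \forall y \near x, y \in `]- (k x).+1%:R, (k x).+1%:R[.
    by apply: near_in_itvoo; rewrite in_itv/= -ltr_norml.
  apply: filterS => y; rewrite in_itv/= => /andP[ky _]; apply: GE => //.
  by have := kx y; rewrite ltr_norml => /andP[].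
exact: near_eq_is_derive near_G dGx.
Qed.

Lemma derive_increment_le H h a b M : a <= b ->
  (forall x, is_derive x 1 H (h x)) ->
  (forall x, a <= x <= b -> `|h x| <= M) -> `|H b - H a| <= M * (b - a).
Proof.
move=> ab dH hM; have [|c /[!in_itv]/= /hM cM ->] := @MVT_segment R H h a b ab (fun x _ => dH x).
  by apply: derivable_within_continuous => x _; have [] := dH x.
by rewrite normrM (@ger0_norm _ (b - a)) ?subr_ge0// ler_wpM2r// subr_ge0.
Qed.

Lemma derive_lipschitz H h a b M : (forall x, is_derive x 1 H (h x)) ->
  (forall x, Num.min a b <= x <= Num.max a b -> `|h x| <= M) ->
  `|H a - H b| <= M * `|a - b|.
Proof.
move=> dH; wlog ab : a b / a <= b => [W hM|].
  have [/W|/ltW ba] := leP a b; first exact.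
  by rewrite distrC [ `|a - b| ]distrC; apply: W; rewrite // minC maxC.
rewrite min_l// max_r// => hM; rewrite distrC [ `|a - b| ]distrC.
by rewrite (@ger0_norm _ (b - a)) ?subr_ge0//; exact: derive_increment_le dH hM.
Qed.

End Antiderivative.

Section ComplexIntegral.
Variable R : realType.
Local Notation C := (R[i]^o).
Implicit Types (h H : R -> C) (a b x y M : R).

Definition cderives H h : Prop := forall x,
  is_derive x 1 (fun y => Re (H y)) (Re (h x)) /\
  is_derive x 1 (fun y => Im (H y)) (Im (h x)).

(** The integral is defined as the increment of an antiderivative: additivity over
    intervals is then immediate, and every explicit integral is a computation of
    derivatives. *)
Definition cprimitive h : R -> C := xget (cst 0) [set H | cderives H h].

Definition cint h a b : C := cprimitive h b - cprimitive h a.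

Lemma continuous_ReIm h : continuous h ->
  continuous (fun x => Re (h x)) /\ continuous (fun x => Im (h x)).
Proof. by move=> ch; split=> x; have /cvgC_ReIm[] := ch x. Qed.

Lemma cprimitiveP h : continuous h -> cderives (cprimitive h) h.
Proof.
move=> /continuous_ReIm[/antiderivative[H1 dH1] /antiderivative[H2 dH2]].
rewrite /cprimitive; case: xgetP => [_ -> //|/(_ (fun x => H1 x +i* H2 x))[]].
by move=> x; split; [exact: dH1|exact: dH2].
Qed.

Lemma cintE H h a b : cderives H h -> cint h a b = H b - H a.
Proof.
move=> dH; have dP : cderives (cprimitive h) h.
  by rewrite /cprimitive; case: xgetP => [_ -> //|/(_ H)].
suff E x y : x <= y -> cprimitive h x - H x = cprimitive h y - H y.
  have {}E : cprimitive h b - H b = cprimitive h a - H a.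
    by have [/E|/ltW/E] := leP a b.
  by rewrite /cint -[cprimitive h b](subrK (H b)) E; ring.
move=> xy; apply/eqP; rewrite eq_complex; apply/andP; split; apply/eqP.
- have := @derive0_constant R ((fun t => Re (cprimitive h t)) - (fun t => Re (H t))) x y xy.
  rewrite !fctE -!cReB; apply => t _; rewrite -(subrr (Re (h t))).
  by apply: is_deriveB; [exact: (dP t).1|exact: (dH t).1].
- have := @derive0_constant R ((fun t => Im (cprimitive h t)) - (fun t => Im (H t))) x y xy.
  rewrite !fctE -!cImB; apply => t _; rewrite -(subrr (Im (h t))).
  by apply: is_deriveB; [exact: (dP t).2|exact: (dH t).2].
Qed.

Lemma cint_cat h a b c : cint h a b + cint h b c = cint h a c.
Proof. by rewrite /cint addrC addrA subrK. Qed.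

Lemma cderives_cst (c : C) : cderives (cst c) (cst 0).
Proof. by move=> x; split; exact: is_derive_cst. Qed.

Lemma cderivesD H1 H2 h1 h2 : cderives H1 h1 -> cderives H2 h2 ->
  cderives (fun x => H1 x + H2 x) (fun x => h1 x + h2 x).
Proof.
move=> d1 d2 x; have [[d1r d1i] [d2r d2i]] := (d1 x, d2 x); split.
  rewrite cReD (_ : (fun y => _) = (fun y => Re (H1 y)) + (fun y => Re (H2 y))).
    exact: is_deriveD.
  by apply/funext => y; rewrite cReD.
rewrite cImD (_ : (fun y => _) = (fun y => Im (H1 y)) + (fun y => Im (H2 y))).
  exact: is_deriveD.
by apply/funext => y; rewrite cImD.
Qed.

Lemma cderivesZ (c : C) H h : cderives H h ->
  cderives (fun x => c * H x) (fun x => c * h x).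
Proof.
move=> d x; have [dr di] := d x; split.
  rewrite cReM (_ : (fun y => _) =
      (Re c \*: (fun y => Re (H y))) - (Im c \*: (fun y => Im (H y)))).
    by apply: is_deriveB; apply: is_deriveZ.
  by apply/funext => y; rewrite cReM.
rewrite cImM (_ : (fun y => _) =
    (Re c \*: (fun y => Im (H y))) + (Im c \*: (fun y => Re (H y)))).
  by apply: is_deriveD; apply: is_deriveZ.
by apply/funext => y; rewrite cImM.
Qed.

Lemma cintD h1 h2 a b : continuous h1 -> continuous h2 ->
  cint (fun x => h1 x + h2 x) a b = cint h1 a b + cint h2 a b.
Proof.
move=> /cprimitiveP d1 /cprimitiveP d2.
by rewrite (cintE _ _ (cderivesD d1 d2)) /cint opprD addrACA.
Qed.

Lemma cintZ (c : C) h a b : continuous h ->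
  cint (fun x => c * h x) a b = c * cint h a b.
Proof.
by move=> /cprimitiveP d; rewrite (cintE _ _ (cderivesZ c d)) /cint mulrBr.
Qed.

(** The factor 2 comes from applying the mean value inequality to the real and to
    the imaginary part separately. *)
Lemma normc_cint h a b M : a <= b -> continuous h ->
  (forall x, a <= x <= b -> normc (h x) <= M) ->
  normc (cint h a b) <= 2 * M * (b - a).
Proof.
move=> ab /cprimitiveP d hM; have H1 : `|Re (cint h a b)| <= M * (b - a).
  rewrite /cint cReB.
  apply: (@derive_increment_le R (fun t => Re (cprimitive h t))
    (fun t => Re (h t)) a b M ab (fun t => (d t).1)) => x xab.
  exact: le_trans (normc_Re _) (hM _ xab).
have H2 : `|Im (cint h a b)| <= M * (b - a).
  rewrite /cint cImB.
  apply: (@derive_increment_le R (fun t => Im (cprimitive h t))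
    (fun t => Im (h t)) a b M ab (fun t => (d t).2)) => x xab.
  exact: le_trans (normc_Im _) (hM _ xab).
have H3 := normc_ReIm (cint h a b).
rewrite -mulrA; move: H1 H2 H3; set X := M * _; lra.
Qed.

End ComplexIntegral.

(** * Goursat's bisection *)

Section Bisection.
Variable R : realType.
Local Notation C := (R[i]^o).

Lemma nested_intervals (u l : nat -> R) :
  (forall n, u n <= u n.+1) -> (forall n, u n.+1 + l n.+1 <= u n + l n) ->
  (forall n, 0 <= l n) ->
  exists p, forall n, u n <= p <= u n + l n.
Proof.
move=> uS lS l0.
have ui m n : (m <= n)%N -> u m <= u n.
  by move=> /subnK <-; elim: (n - m)%N => [//|k IH]; exact: le_trans IH (uS _).
have li m n : (m <= n)%N -> u n + l n <= u m + l m.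
  by move=> /subnK <-; elim: (n - m)%N => [//|k IH]; exact: le_trans (lS _) IH.
have ul m n : u m <= u n + l n.
  have [mn|/ltnW nm] := leqP m n.
    by rewrite (le_trans (ui _ _ mn))// lerDl.
  by apply: le_trans (li _ _ nm); rewrite lerDl.
have hu : has_sup (range u).
  by split; [exists (u 0), 0|exists (u 0 + l 0) => _ [m _ <-]; exact: ul].
exists (sup (range u)) => n; apply/andP; split.
  by apply: ub_le_sup; [case: hu|exists n].
by apply: ge_sup; [case: hu|move=> _ [m _ <-]; exact: ul].
Qed.

(** Goursat's argument. If [mu a b c d] had norm [eta > 0], one of the four
    quarters of the rectangle would carry at least [eta / 4], one of its quarters
    at least [eta / 16], and so on; the quarters shrink to a point near which the
    last hypothesis bounds [mu] by less. *)
Lemma rectangle_function_eq0 (mu : R -> R -> R -> R -> C) (a b c d : R) :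
  a <= b -> c <= d ->
  (forall s1 s2 s3 t1 t2, mu s1 s2 t1 t2 + mu s2 s3 t1 t2 = mu s1 s3 t1 t2) ->
  (forall s1 s2 t1 t2 t3, mu s1 s2 t1 t2 + mu s1 s2 t2 t3 = mu s1 s2 t1 t3) ->
  (forall p q e, a <= p <= b -> c <= q <= d -> 0 < e ->
    exists2 del, 0 < del & forall l s t, 0 < l < del ->
      a <= s -> s + l * (b - a) <= b -> s <= p <= s + l * (b - a) ->
      c <= t -> t + l * (d - c) <= d -> t <= q <= t + l * (d - c) ->
      normc (mu s (s + l * (b - a)) t (t + l * (d - c))) <= e * l ^+ 2) ->
  mu a b c d = 0.
Proof.
move=> ab cd muDl muDr small; apply: contrapT => mu0.
pose eta : R := normc (mu a b c d).
have eta0 : 0 < eta.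
  by rewrite lt_def normc_ge0 andbT; apply/eqP => /eq0_normc.
pose h n : R := 2^-1 ^+ n.
have h0 n : 0 < h n by rewrite exprn_gt0.
have hS n : h n = h n.+1 + h n.+1.
  by rewrite /h exprS; set x := _ ^+ _; lra.
pose big n (st : R * R) := eta * h n ^+ 2 <=
  normc (mu st.1 (st.1 + h n * (b - a)) st.2 (st.2 + h n * (d - c))).
pose near n (st st' : R * R) :=
  (st'.1 = st.1 \/ st'.1 = st.1 + h n.+1 * (b - a)) /\
  (st'.2 = st.2 \/ st'.2 = st.2 + h n.+1 * (d - c)).
have step n st : exists st', big n st -> big n.+1 st' /\ near n st st'.
  have [B|] := pselect (big n st); last by exists st.
  case: st B => s t; rewrite /big/= => B.
  set s' := s + h n.+1 * (b - a); set t' := t + h n.+1 * (d - c).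
  suff [st' [? ?]] : exists st', big n.+1 st' /\ near n (s, t) st' by exists st'.
  apply: contrapT => /forallNP nobig.
  have no x y : (x = s \/ x = s') -> (y = t \/ y = t') ->
      normc (mu x (x + h n.+1 * (b - a)) y (y + h n.+1 * (d - c))) <
      eta * h n.+1 ^+ 2.
    move=> xs yt; rewrite ltNge; apply/negP => ge.
    by apply: (nobig (x, y)); split.
  have := B.
  have -> : s + h n * (b - a) = s' + h n.+1 * (b - a).
    by rewrite /s' (hS n); ring.
  have -> : t + h n * (d - c) = t' + h n.+1 * (d - c).
    by rewrite /t' (hS n); ring.
  rewrite -(muDl s s') -(muDr s s' t t') -(muDr s' _ t t').
  have := no s t (or_introl erefl) (or_introl erefl).
  have := no s t' (or_introl erefl) (or_intror erefl).
  have := no s' t (or_intror erefl) (or_introl erefl).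
  have := no s' t' (or_intror erefl) (or_intror erefl).
  rewrite -/s' -/t'.
  set A := mu s _ t _; set A' := mu s _ t' _; set D := mu s' _ t _; set D' := mu s' _ t' _.
  have := ler_normcD (A + A') (D + D'); have := ler_normcD A A'.
  have := ler_normcD D D'; rewrite (hS n).
  rewrite (_ : eta * (h n.+1 + h n.+1) ^+ 2 = 4 * (eta * h n.+1 ^+ 2)); last by ring.
  set x := eta * _; move: (normc _) (normc _) (normc _) (normc _) => *; lra.
have /choice[nxt nxtP] : forall nst : nat * (R * R), exists st',
    big nst.1 nst.2 -> big nst.1.+1 st' /\ near nst.1 nst.2 st'.
  by move=> [n st]; exact: step.
pose u := fix u n := if n is m.+1 then nxt (m, u m) else (a, c).
have bu n : big n (u n).
  elim: n => [|n /= IH]; last by have [] := nxtP (n, u n) IH.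
  by rewrite /big/= /h !expr0 expr1n !mul1r mulr1 !subrKC.
have nu n : near n (u n) (u n.+1) by have [] := nxtP (n, u n) (bu n).
have ba : 0 <= b - a by rewrite subr_ge0.
have dc : 0 <= d - c by rewrite subr_ge0.
have hba n : 0 <= h n * (b - a) by rewrite mulr_ge0// ltW.
have hdc n : 0 <= h n * (d - c) by rewrite mulr_ge0// ltW.
have u1 n : (u n).1 <= (u n.+1).1.
  by have [[->|->] _] := nu n; rewrite // lerDl.
have u2 n : (u n).2 <= (u n.+1).2.
  by have [_ [->|->]] := nu n; rewrite // lerDl.
have l1 n : (u n.+1).1 + h n.+1 * (b - a) <= (u n).1 + h n * (b - a).
  by have := hba n.+1; rewrite (hS n); have [[->|->] _] := nu n; lra.
have l2 n : (u n.+1).2 + h n.+1 * (d - c) <= (u n).2 + h n * (d - c).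
  by have := hdc n.+1; rewrite (hS n); have [_ [->|->]] := nu n; lra.
have [p pP] := nested_intervals u1 l1 hba.
have [q qP] := nested_intervals u2 l2 hdc.
have pab : a <= p <= b by have := pP 0; rewrite /= /h expr0 mul1r subrKC.
have qcd : c <= q <= d by have := qP 0; rewrite /= /h expr0 mul1r subrKC.
have [|del del0 Hdel] := small p q (eta / 2) pab qcd; first by rewrite divr_gt0.
have [n hn] : exists n, h n < del.
  have [n Hn] := geometric_small 1 (half01 R) del0.
  by exists n; have := Hn n (leqnn n); rewrite mul1r.
have au k : a <= (u k).1 by elim: k => [//|k IH]; exact: le_trans IH (u1 k).
have cu k : c <= (u k).2 by elim: k => [//|k IH]; exact: le_trans IH (u2 k).
have ub k : (u k).1 + h k * (b - a) <= b.
  by elim: k => [|k IH]; [rewrite /h expr0 mul1r subrKC|exact: le_trans (l1 k) IH].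
have ud k : (u k).2 + h k * (d - c) <= d.
  by elim: k => [|k IH]; [rewrite /h expr0 mul1r subrKC|exact: le_trans (l2 k) IH].
have hn0 : 0 < h n < del by rewrite h0.
have := Hdel (h n) (u n).1 (u n).2 hn0 (au n) (ub n) (pP n) (cu n) (ud n) (qP n).
move/(le_trans (bu n)); rewrite leNgt => /negP; apply.
(* [bu n] and [Hdel] would give [eta <= eta / 2]. *)
have hn2 : 0 < h n ^+ 2 by rewrite exprn_gt0.
by rewrite ltr_pM2r//; lra.
Qed.

End Bisection.

(** * The unit circle *)

Section CircleIntegral.
Variable R : realType.
Local Notation C := (R[i]^o).
Implicit Types (s t x y : R) (z w : C).

Definition cis t : C := cos t +i* sin t.

Lemma normc_cis t : normc (cis t) = 1.
Proof. by rewrite /= cos2Dsin2 sqrtr1. Qed.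

Lemma normc_circle sigma t : 0 < sigma -> normc (sigma%:C * cis t : C) = sigma.
Proof. by move=> s0; rewrite normcM normcR normc_cis mulr1 gtr0_norm. Qed.

Lemma cis_neq0 t : cis t != 0.
Proof.
apply/eqP => /(congr1 (@normc R)); rewrite normc_cis normc0.
by move/eqP; rewrite oner_eq0.
Qed.

Lemma cisD x y : cis (x + y) = cis x * cis y.
Proof. by rewrite /cis cosD sinD; congr (_ +i* _); rewrite addrC. Qed.

Lemma cis0 : cis 0 = 1.
Proof. by rewrite /cis cos0 sin0. Qed.

Lemma cis_2pi : cis (2 * pi) = 1.
Proof. by rewrite /cis mulr_natl cos2pi sin2pi. Qed.

Lemma cisX t k : cis t ^+ k = cis (k%:R * t).
Proof.
elim: k => [|k IH]; first by rewrite expr0 mul0r cis0.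
by rewrite exprS IH -cisD mulrSr mulrDl mul1r addrC.
Qed.

Lemma cisV t : (cis t)^-1 = cis (- t).
Proof.
apply: (mulfI (cis_neq0 t)); rewrite mulfV ?cis_neq0// -cisD subrr.
by rewrite cis0.
Qed.

Lemma cderives_cis : cderives cis (fun t => 'i * cis t).
Proof.
move=> x; rewrite cReM cImM/= !mul0r !mul1r sub0r add0r.
by split; [exact: is_derive_cos|exact: is_derive_sin].
Qed.

Lemma continuous_cis : continuous cis.
Proof.
move=> x; apply/cvgC_ReIm; split; [exact: continuous_cos|exact: continuous_sin].
Qed.

Lemma cis_lipschitz x y : normc (cis x - cis y) <= 2 * `|x - y|.
Proof.
apply: le_trans (normc_ReIm _) _; rewrite cReB cImB /= mulrDl; apply: lerD.
  by apply: (@derive_lipschitz R (@cos R) (fun t => - sin t)) => t _; rewrite normrN sin_max.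
by apply: (@derive_lipschitz R (@sin R) (@cos R)) => t _; exact: cos_max.
Qed.

(** The functions exp (- i k t) with k > 0 have periodic antiderivatives. *)
Lemma cint_cis_exp k : cint (fun t => (cis t)^-1 ^+ k) 0 (2 * pi) =
  (if k == 0 then (2 * pi)%:C else 0 : C).
Proof.
have [->|k0] := eqVneq.
  rewrite (@cintE _ (fun t => t%:C)) ?raddf0 ?subr0 ?addr0// => x; rewrite expr0 /=.
  by split; [exact: is_derive_id|exact: is_derive_cst].
have k0' : k%:R != 0 :> R by rewrite pnatr_eq0.
rewrite (@cintE _ (fun t => (k%:R^-1 * sin (k%:R * t)) +i* (k%:R^-1 * cos (k%:R * t)))).
  have : cis (k%:R * (2 * pi)) = 1 by rewrite -cisX cis_2pi expr1n.
  by move=> [-> ->]; rewrite !mulr0 cos0 sin0 !mulr0 subrr.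
move=> x; rewrite cisV cisX mulrN /cis cosN sinN/=.
have kx : is_derive x 1 (fun t => k%:R * t) (k%:R : R).
  by rewrite -[X in is_derive _ _ _ X]mulr1; exact: (@is_deriveZ _ _ _ id).
split.
  have := @is_derive1_comp R (@sin R) (fun t => k%:R * t) x _ _ (is_derive_sin _) kx.
  move=> /(@is_deriveZ _ _ _ _ (k%:R^-1)) H; apply: (is_derive_eq H).
  by rewrite /GRing.scale/=; field.
have := @is_derive1_comp R (@cos R) (fun t => k%:R * t) x _ _ (is_derive_cos _) kx.
move=> /(@is_deriveZ _ _ _ _ (k%:R^-1)) H; apply: (is_derive_eq H).
by rewrite /GRing.scale/=; field.
Qed.

End CircleIntegral.

(** * Boundary integrals over polar rectangles *)

Section RectangleFunction.
Variable R : realType.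
Local Notation C := (R[i]^o).
Implicit Types (s t : R) (K : R -> C) (H G : R -> R -> C).

Definition sep_continuous H : Prop :=
  (forall s, continuous (H s)) /\ (forall t, continuous (H^~ t)).

(** In the coordinates z = w + exp s * P t, with P' = P K, the form
    f z dz / (z - w) is H (ds + K dt), where [H s t] is f z; this is its integral
    along the boundary of the rectangle [s1, s2] x [t1, t2]. *)
Definition rect_int K H s1 s2 t1 t2 : C :=
  cint (fun t => (H s2 t - H s1 t) * K t) t1 t2 -
  cint (fun s => H s t2 - H s t1) s1 s2.

Lemma continuousCD (f g : R -> C) : continuous f -> continuous g ->
  continuous (fun x => f x + g x).
Proof. by move=> cf cg x; apply: cvgD; [exact: cf|exact: cg]. Qed.

Lemma continuousCB (f g : R -> C) : continuous f -> continuous g ->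
  continuous (fun x => f x - g x).
Proof. by move=> cf cg x; apply: cvgB; [exact: cf|exact: cg]. Qed.

Lemma continuousCM (f g : R -> C) : continuous f -> continuous g ->
  continuous (fun x => f x * g x).
Proof. by move=> cf cg x; apply: cvgM; [exact: cf|exact: cg]. Qed.

Lemma continuousCV (f : R -> C) : continuous f -> (forall x, f x != 0) ->
  continuous (fun x => (f x)^-1).
Proof. by move=> cf f0 x; apply: cvgV; [exact: f0|exact: cf]. Qed.

Lemma continuousC_cst (c : C) : continuous (fun _ : R => c).
Proof. by move=> x; exact: cvg_cst. Qed.

Lemma continuousCX (f : R -> C) k : continuous f -> continuous (fun x => f x ^+ k).
Proof.
move=> cf; elim: k => [|k IH]; last first.
  rewrite (_ : (fun _ => _) = (fun x => f x * f x ^+ k)); first exact: continuousCM.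
  by apply/funext => x; rewrite exprS.
rewrite (_ : (fun _ => _) = cst 1); first exact: continuousC_cst.
by apply/funext => x; rewrite expr0.
Qed.

Lemma continuousCR (f : R -> R) : continuous f -> continuous (fun x => (f x)%:C : C).
Proof. by move=> cf x; apply/cvgC_ReIm; split; [exact: cf|exact: cvg_cst]. Qed.

Lemma continuous_circle (sigma : R) : continuous (fun t => sigma%:C * cis t : C).
Proof. exact: (continuousCM (@continuousC_cst _) (@continuous_cis R)). Qed.

Section Additivity.
Variables (K : R -> C) (H : R -> R -> C).
Hypotheses (cK : continuous K) (cH : sep_continuous H).

Lemma continuous_slice_fst s1 s2 : continuous (fun t => (H s2 t - H s1 t) * K t).
Proof. exact: (continuousCM (continuousCB (cH.1 s2) (cH.1 s1)) cK). Qed.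

Lemma continuous_slice_snd t1 t2 : continuous (fun s => H s t2 - H s t1).
Proof. exact: (continuousCB (cH.2 t2) (cH.2 t1)). Qed.

Lemma rect_int_addl s1 s2 s3 t1 t2 :
  rect_int K H s1 s2 t1 t2 + rect_int K H s2 s3 t1 t2 = rect_int K H s1 s3 t1 t2.
Proof.
rewrite /rect_int addrACA -opprD cint_cat; congr (_ - _).
rewrite -(cintD _ _ (@continuous_slice_fst s1 s2) (@continuous_slice_fst s2 s3)).
congr cint; apply/funext => t; rewrite -mulrDl; congr (_ * _).
by rewrite addrC addrA subrK.
Qed.

Lemma rect_int_addr s1 s2 t1 t2 t3 :
  rect_int K H s1 s2 t1 t2 + rect_int K H s1 s2 t2 t3 = rect_int K H s1 s2 t1 t3.
Proof.
rewrite /rect_int addrACA -opprD cint_cat; congr (_ - _).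
rewrite -(cintD _ _ (@continuous_slice_snd t1 t2) (@continuous_slice_snd t2 t3)).
by congr cint; apply/funext => s; rewrite addrC addrA subrK.
Qed.

Lemma rect_int_le s1 s2 t1 t2 (E k : R) : s1 <= s2 -> t1 <= t2 ->
  (forall t, normc (K t) <= k) ->
  (forall s t, s1 <= s <= s2 -> t1 <= t <= t2 -> normc (H s t) <= E) ->
  normc (rect_int K H s1 s2 t1 t2) <= 4 * E * (k * (t2 - t1) + (s2 - s1)).
Proof.
move=> s12 t12 hK hH.
have E0 : 0 <= E.
  by apply: le_trans (normc_ge0 _) (hH s1 t1 _ _); rewrite lexx.
have HB (x y x' y' : R) : s1 <= x <= s2 -> t1 <= y <= t2 -> s1 <= x' <= s2 -> t1 <= y' <= t2 ->
    normc (H x y - H x' y') <= 2 * E.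
  move=> hx hy hx' hy'; apply: le_trans (ler_normcD _ _) _.
  by rewrite normcN; have := hH _ _ hx hy; have := hH _ _ hx' hy'; lra.
have I1 : normc (cint (fun t => (H s2 t - H s1 t) * K t) t1 t2) <=
    2 * (2 * E * k) * (t2 - t1).
  apply: normc_cint => [//||]; first exact: (@continuous_slice_fst s1 s2).
  move=> t ht; rewrite normcM; apply: ler_pM; rewrite ?normc_ge0//.
  by apply: HB; rewrite ?lexx ?s12.
have I2 : normc (cint (fun s => H s t2 - H s t1) s1 s2) <= 2 * (2 * E) * (s2 - s1).
  apply: normc_cint => [//||]; first exact: (@continuous_slice_snd t1 t2).
  by move=> s hs; apply: HB; rewrite ?lexx ?t12.
apply: le_trans (ler_normcD _ _) _; rewrite normcN.
by move: I1 I2; lra.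
Qed.

End Additivity.

(** Subtracting from f an affine function A + B (z - w) does not change the
    boundary integral: the form (A + B (z - w)) dz / (z - w) is exact, because
    dz / (z - w) = ds + K dt and dz both are. *)
Lemma rect_int_affine K p (A B : C) H s1 s2 t1 t2 :
  continuous K -> continuous p -> sep_continuous H ->
  cderives p (fun t => p t * K t) ->
  rect_int K H s1 s2 t1 t2 =
  rect_int K (fun s t => H s t - (A + B * ((expR s)%:C * p t))) s1 s2 t1 t2.
Proof.
move=> cK cp cH dp.
have cexp : continuous (fun s => (expR s)%:C : C).
  by apply: continuousCR; exact: continuous_expR.
have dexp : cderives (fun s => (expR s)%:C : C) (fun s => (expR s)%:C).
  by move=> x; split; [exact: is_derive_expR|exact: is_derive_cst].
rewrite /rect_int.
have -> : (fun t => (H s2 t - (A + B * ((expR s2)%:C * p t)) -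
    (H s1 t - (A + B * ((expR s1)%:C * p t)))) * K t) =
  (fun t => (H s2 t - H s1 t) * K t +
    - (B * ((expR s2)%:C - (expR s1)%:C)) * (p t * K t)).
  by apply/funext => t; ring.
have -> : (fun s => H s t2 - (A + B * ((expR s)%:C * p t2)) -
    (H s t1 - (A + B * ((expR s)%:C * p t1)))) =
  (fun s => (H s t2 - H s t1) + - (B * (p t2 - p t1)) * (expR s)%:C).
  by apply/funext => t; ring.
have cpK := continuousCM cp cK.
rewrite (cintD _ _ (@continuous_slice_fst K H cK cH s1 s2)
  (continuousCM (@continuousC_cst (- (B * ((expR s2)%:C - (expR s1)%:C)))) cpK)).
rewrite (cintD _ _ (@continuous_slice_snd H cH t1 t2)
  (continuousCM (@continuousC_cst (- (B * (p t2 - p t1)))) cexp)).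
rewrite (cintZ _ _ _ cpK) (cintZ _ _ _ cexp) (cintE _ _ dp) (cintE _ _ dexp).
by ring.
Qed.

End RectangleFunction.

(** * Cauchy's formula on a circle *)

Section CauchyKernel.
Variable R : realType.
Local Notation C := (R[i]^o).
Implicit Types (s t : R) (f : C -> C) (z w : C).

(** Complex differentiability without quotients: the affine approximation is what
    Goursat's argument consumes. *)
Definition cdifferentiable f z : Prop := exists B : C, forall e : R, 0 < e ->
  exists2 d : R, 0 < d & forall z', normc (z' - z) < d ->
    normc (f z' - (f z + B * (z' - z))) <= e * normc (z' - z).

Lemma derivable_cdifferentiable f z : derivable f z 1 -> cdifferentiable f z.
Proof.
move=> /cvg_ex[/= B fB]; exists B => e e0.
move/cvgCP: fB => /(_ _ e0) /nbhsCP[d d0 dB]; exists d => // z' z'd.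
have [->|zz'] := eqVneq z' z.
  by rewrite !subrr mulr0 addr0 subrr normc0 mulr0.
have h0 : z' - z != 0 by rewrite subr_eq0.
have := dB (z' - z); rewrite subr0 => /(_ z'd h0) /ltW.
have -> : (z' - z) *: 1 + z = z' by rewrite /GRing.scale/= mulr1 subrK.
move=> /(ler_wpM2r (normc_ge0 (z' - z))); apply: le_trans.
rewrite -normcM; apply: le_of_eq; congr normc.
rewrite /GRing.scale/= mulrBl [X in _ = X - _]mulrC mulrA mulfV// mul1r.
by rewrite opprD addrA.
Qed.

Lemma cdifferentiable_continuous f z : cdifferentiable f z -> {for z, continuous f}.
Proof.
move=> [B HB]; apply/(@cvgCP R C (nbhs z) (nbhs_filter z)) => e e0.
have [d d0 Hd] := HB 1 ltr01.
have B0 : 0 < normc B + 1 by rewrite ltr_wpDl ?normc_ge0.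
apply/nbhsCP; exists (Num.min d (e / (normc B + 1))).
  by rewrite lt_min d0 divr_gt0.
move=> z'; rewrite lt_min => /andP[/Hd H]; rewrite ltr_pdivlMr// => He.
apply: le_lt_trans He.
have -> : f z' - f z = (f z' - (f z + B * (z' - z))) + B * (z' - z) by ring.
apply: le_trans (ler_normcD _ _) _; rewrite normcM.
by move: H; lra.
Qed.

Variables (r sigma : R) (w : C) (f : C -> C).
Hypotheses (sr : sigma < r) (ws : normc w < sigma).
Hypothesis df : forall z, normc z < r -> cdifferentiable f z.

Let s0 : 0 < sigma. Proof. exact: le_lt_trans (normc_ge0 _) ws. Qed.

Let P t : C := sigma%:C * cis t - w.
Let K t : C := 'i * (sigma%:C * cis t) / P t.
(* The truncation at 0 keeps w + a s * P t in the disk for every real s, so that H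
   is continuous in s on the whole line. *)
Let a s : R := expR (Num.min s 0).
Let H s t : C := f (w + (a s)%:C * P t).

Let normc_circ t : normc (sigma%:C * cis t) = sigma.
Proof. exact: normc_circle. Qed.

Let P_ge t : sigma - normc w <= normc (P t).
Proof.
have := ler_normcD (P t) w; rewrite /P subrK normc_circ; lra.
Qed.

Let P_le t : normc (P t) <= 2 * sigma.
Proof. by apply: le_trans (ler_normcD _ _) _; rewrite normcN normc_circ; move: ws; lra. Qed.

Let P0 t : P t != 0.
Proof.
apply/eqP => P0; have := P_ge t; rewrite P0 normc0; move: ws; lra.
Qed.

Let cP : continuous P.
Proof.
by apply: continuousCB; [exact: continuous_circle|exact: continuousC_cst].
Qed.

Let cK : continuous K.
Proof.
apply: continuousCM; last exact: continuousCV.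
by apply: continuousCM; [exact: continuousC_cst|exact: continuous_circle].
Qed.

Let k := sigma / (sigma - normc w).

Let K_le t : normc (K t) <= k.
Proof.
rewrite !normcM normcV normcR normc_cis mulr1.
have -> : normc ('i : C) = 1 by rewrite /= expr0n/= expr1n add0r sqrtr1.
rewrite mul1r gtr0_norm// ler_pM2l// lef_pV2 ?P_ge// posrE ?subr_gt0//.
by apply: lt_le_trans (P_ge t); rewrite subr_gt0.
Qed.

Let a01 s : 0 < a s <= 1.
Proof. by rewrite expR_gt0 -(expR0 R) ler_expR ge_min lexx orbT. Qed.

Let in_disk (b : R) t : 0 <= b <= 1 -> normc (w + b%:C * P t) <= sigma.
Proof.
move=> /andP[b0 b1].
have -> : w + b%:C * P t = (1 - b)%:C * w + b%:C * (sigma%:C * cis t).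
  by rewrite /P rmorphB rmorph1; ring.
apply: le_trans (ler_normcD _ _) _; rewrite (normcM (1 - b)%:C) (normcM b%:C) normc_circ !normcR.
rewrite (ger0_norm b0) ger0_norm ?subr_ge0//.
have : (1 - b) * normc w <= (1 - b) * sigma by rewrite ler_wpM2l ?subr_ge0// ltW.
by lra.
Qed.

Let cH : sep_continuous H.
Proof.
have cf z : normc z <= sigma -> {for z, continuous f}.
  by move=> zs; apply/cdifferentiable_continuous/df/(le_lt_trans zs sr).
have as_ s t : normc (w + (a s)%:C * P t) <= sigma.
  by apply: in_disk; have /andP[/ltW -> ->] := a01 s.
split=> [s|t].
- have cg : continuous (fun t => w + (a s)%:C * P t).
    apply: continuousCD; first exact: continuousC_cst.
    by apply: continuousCM; [exact: continuousC_cst|exact: cP].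
  by move=> t; apply: continuous_comp; [exact: cg|exact: cf].
- have ca : continuous a.
    move=> s; apply: continuous_comp; last exact: continuous_expR.
    by apply: continuous_min; [exact: cvg_id|exact: cvg_cst].
  have cg : continuous (fun s => w + (a s)%:C * P t).
    apply: continuousCD; first exact: continuousC_cst.
    by apply: continuousCM; [exact: continuousCR|exact: continuousC_cst].
  by move=> s; apply: continuous_comp; [exact: cg|exact: cf].
Qed.

Let dP : cderives P (fun t => P t * K t).
Proof.
have -> : (fun t => P t * K t) = (fun t => sigma%:C * ('i * cis t) + cst 0 t).
  by apply/funext => t; rewrite /K mulrC divfK// mulrCA addr0.
exact: cderivesD (cderivesZ _ (@cderives_cis R)) (@cderives_cst R (- w)).
Qed.

Let expR_lipschitz (x y : R) : x <= 0 -> y <= 0 -> `|expR x - expR y| <= `|x - y|.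
Proof.
move=> x0 y0; rewrite -[leRHS]mul1r.
apply: (@derive_lipschitz R (@expR R) (@expR R)) => t /andP[_ txy].
rewrite gtr0_norm ?expR_gt0// -(expR0 R) ler_expR; apply: le_trans txy _.
by rewrite ge_max x0.
Qed.

Let P_lipschitz (x y : R) : normc (P x - P y) <= sigma * (2 * `|x - y|).
Proof.
have -> : P x - P y = sigma%:C * (cis x - cis y) by rewrite /P; ring.
by rewrite normcM normcR gtr0_norm// ler_pM2l//; exact: cis_lipschitz.
Qed.

Let point_lipschitz (s t p q : R) : s <= 0 -> p <= 0 ->
  normc ((w + (expR s)%:C * P t) - (w + (expR p)%:C * P q)) <=
  2 * sigma * (`|s - p| + `|t - q|).
Proof.
move=> s_le0 p_le0.
have -> : (w + (expR s)%:C * P t) - (w + (expR p)%:C * P q) =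
    (expR s - expR p)%:C * P t + (expR p)%:C * (P t - P q).
  by rewrite rmorphB; ring.
apply: le_trans (ler_normcD _ _) _; rewrite (mulrDr (2 * sigma)); apply: lerD.
  rewrite normcM normcR mulrC; apply: ler_pM => //; first exact: normc_ge0.
  exact: expR_lipschitz.
rewrite normcM normcR gtr0_norm ?expR_gt0//.
apply: le_trans (ler_wpM2l (ltW (expR_gt0 _)) (P_lipschitz _ _)) _.
have e1 : expR p <= 1 by rewrite -(expR0 R) ler_expR.
have X0 : 0 <= sigma * (2 * `|t - q|) by rewrite !mulr_ge0// ltW.
by apply: le_trans (ler_wpM2r X0 e1) _; rewrite mul1r mulrCA mulrA.
Qed.

Let k_gt0 : 0 < k.
Proof. by rewrite divr_gt0// subr_gt0. Qed.

(** Up to a form with zero boundary integral, f is e |z - z0| small near z0; on a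
    rectangle of size [l] both this and the length of the boundary are O(l), which
    gives the bound e l^2 required by the bisection. *)
Let rect_eq0 (b : R) : b <= 0 -> rect_int K H b 0 0 (2 * pi) = 0.
Proof.
move=> b0; have pi0 : 0 <= 2 * pi :> R by rewrite mulr_ge0// pi_ge0.
apply: rectangle_function_eq0 => //.
- by move=> *; exact: rect_int_addl.
- by move=> *; exact: rect_int_addr.
move=> p q e /andP[bp p0] /andP[q0 qpi] e0; rewrite !subr0 sub0r.
set z0 := w + (expR p)%:C * P q.
have z0r : normc z0 < r.
  apply: le_lt_trans sr; apply: in_disk.
  by rewrite (ltW (expR_gt0 _)) -(expR0 R) ler_expR.
have [B HB] := df z0r.
set L1 := - b; set L2 := 2 * pi.
have L10 : 0 <= L1 by rewrite oppr_ge0.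
(* [D * l] bounds |z - z0| on a rectangle of size [l], and [Q] collects the other
   constants of the boundary estimate; the final + 1 makes it positive. *)
pose D := 2 * sigma * (L1 + L2).
have D0 : 0 <= D by rewrite !mulr_ge0 ?addr_ge0// ltW.
pose Q := 4 * D * (k * L2 + L1) + 1.
have kL : 0 <= k * L2 + L1 by rewrite addr_ge0// mulr_ge0// ltW.
have Q0 : 0 < Q by rewrite ltr_wpDl// mulr_ge0// mulr_ge0.
have eQ : 0 < e / Q by rewrite divr_gt0.
have [d d0 Hd] := HB _ eQ.
have D1 : 0 < D + 1 by rewrite ltr_wpDl.
exists (d / (D + 1)); first by rewrite divr_gt0.
move=> l s t /andP[l0 ld] bs sl /andP[sp ps] t0 tl /andP[tq qt].
have ld' : D * l < d.
  by move: ld; rewrite ltr_pdivlMr//; move: l0; lra.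
pose A := f z0 + B * (w - z0).
rewrite (@rect_int_affine R K P A B)//.
have cG : sep_continuous (fun s t => H s t - (A + B * ((expR s)%:C * P t))).
  split=> x; apply: continuousCB; [exact: cH.1| |exact: cH.2|].
    apply: continuousCD; first exact: continuousC_cst.
    apply: continuousCM; first exact: continuousC_cst.
    by apply: continuousCM; [exact: continuousC_cst|exact: cP].
  apply: continuousCD; first exact: continuousC_cst.
  apply: continuousCM; first exact: continuousC_cst.
  apply: continuousCM; last exact: continuousC_cst.
  by apply: continuousCR; exact: continuous_expR.
have lL1 : 0 <= l * L1 by rewrite mulr_ge0// ltW.
have lL2 : 0 <= l * L2 by rewrite mulr_ge0// ltW.
apply: le_trans (@rect_int_le R K _ cK cG s (s + l * L1) t (t + l * L2)
  (e / Q * (D * l)) k _ _ K_le _) _; rewrite ?lerDl//.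
- move=> x y /andP[sx xs] /andP[ty yt].
  have x0 : x <= 0 by apply: le_trans xs sl.
  rewrite /H /a min_l//; set z := w + _.
  have dz : normc (z - z0) <= D * l.
    apply: le_trans (point_lipschitz _ _ x0 p0) _.
    rewrite /D -[leRHS]mulrA ler_pM2l ?mulr_gt0// mulrDl lerD//.
      by rewrite ler_norml; move: sx xs sp ps; lra.
    by rewrite ler_norml; move: ty yt tq qt; lra.
  have -> : A + B * ((expR x)%:C * P y) = f z0 + B * (z - z0).
    by rewrite /A /z; ring.
  apply: le_trans (Hd _ (le_lt_trans dz ld')) _.
  by rewrite ler_pM2l.
- rewrite (addrC s) addrK (addrC t) addrK.
  have -> : 4 * (e / Q * (D * l)) * (k * (l * L2) + l * L1) =
      e * l ^+ 2 * ((Q - 1) / Q).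
    by rewrite /Q; field; rewrite gt_eqF.
  rewrite ler_piMr//; first by rewrite mulr_ge0 ?sqr_ge0// ltW.
  by rewrite ler_pdivrMr// mul1r gerBl.
Qed.

(** The contour t |-> w + exp s * P t is the circle of radius sigma for s = 0 and
    shrinks to w when s tends to -oo; by the vanishing of boundary integrals the
    integral of f dz / (z - w) along it does not depend on s. The value of the
    integral of K itself will result from the same expansion that yields the
    Taylor series. *)
Lemma cauchy_kernel :
  cint (fun t => f (sigma%:C * cis t) * K t) 0 (2 * pi) =
  f w * cint K 0 (2 * pi).
Proof.
have pi0 : 0 <= 2 * pi :> R by rewrite mulr_ge0// pi_ge0.
have J (b : R) : b <= 0 -> cint (fun t => f (sigma%:C * cis t) * K t) 0 (2 * pi) =
    cint (fun t => H b t * K t) 0 (2 * pi).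
  move=> b0; have := rect_eq0 b0; rewrite /rect_int.
  have -> : (fun s => H s (2 * pi) - H s 0) = (fun s => 0 * (0 : C)).
    by apply/funext => s; rewrite /H /P cis_2pi cis0 subrr mul0r.
  rewrite (cintZ _ _ _ (@continuousC_cst R 0)) mul0r subr0.
  have -> : (fun t => (H 0 t - H b t) * K t) =
      (fun t => f (sigma%:C * cis t) * K t + - 1 * (H b t * K t)).
    apply/funext => t; rewrite mulrBl mulN1r; congr (f _ * _ - _).
    by rewrite /a minxx expR0 mul1r /P addrC subrK.
  have c1 : continuous (fun t => H b t * K t).
    by apply: continuousCM; [exact: cH.1|exact: cK].
  have c0 : continuous (fun t => f (sigma%:C * cis t) * K t).
    apply: continuousCM; last exact: cK.
    rewrite (_ : (fun _ => _) = H 0); first exact: cH.1.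
    by apply/funext => t; rewrite /H /a minxx expR0 mul1r /P addrC subrK.
  have c2 : continuous (fun t => - 1 * (H b t * K t)).
    by apply: continuousCM; [exact: continuousC_cst|exact: c1].
  rewrite (cintD _ _ c0 c2) (cintZ _ _ _ c1) mulN1r => /eqP.
  by rewrite subr_eq0 => /eqP.
apply/eqP; rewrite -subr_eq0; apply/eqP/eq0_normc.
apply/eqP; rewrite eq_le normc_ge0 andbT; apply/ler_addgt0Pl => e e0.
rewrite addr0.
have cfw : {for w, continuous f}.
  by apply/cdifferentiable_continuous/df/(lt_trans ws).
pose M := 2 * k * (2 * pi) + 1.
have M0 : 0 < M by rewrite ltr_wpDl// mulr_ge0// mulr_ge0// ltW.
have eM : 0 < e / M by rewrite divr_gt0.
move/(@cvgCP R C (nbhs w) (nbhs_filter w)): cfw => /(_ _ eM)/nbhsCP[d d0 fd].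
(* For s = b the contour lies within distance d of w, since |P t| <= 2 sigma. *)
pose b := Num.min 0 (ln (d / (3 * sigma))).
have b0 : b <= 0 by rewrite ge_min lexx.
have eb : expR b * (3 * sigma) <= d.
  rewrite -ler_pdivlMr ?mulr_gt0//.
  rewrite -[leRHS]lnK ?posrE ?divr_gt0 ?mulr_gt0//.
  by rewrite ler_expR /b ge_min lexx orbT.
rewrite (J _ b0) -(cintZ _ _ _ cK).
have -> : cint (fun t => H b t * K t) 0 (2 * pi) - cint (fun t => f w * K t) 0 (2 * pi)
   = cint (fun t => (H b t - f w) * K t) 0 (2 * pi).
  have -> : (fun t => (H b t - f w) * K t) = (fun t => H b t * K t + - (f w) * K t).
    by apply/funext => t; ring.
  have c1 : continuous (fun t => H b t * K t).
    by apply: continuousCM; [exact: cH.1|exact: cK].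
  have c2 : continuous (fun t => - f w * K t).
    by apply: continuousCM; [exact: continuousC_cst|exact: cK].
  by rewrite (cintD _ _ c1 c2) !(cintZ _ _ _ cK) mulNr.
apply: le_trans (@normc_cint R _ 0 (2 * pi) (e / M * k) pi0 _ _) _.
- apply: continuousCM; last exact: cK.
  by apply: continuousCB; [exact: cH.1|exact: continuousC_cst].
- move=> t _; rewrite normcM; apply: ler_pM; rewrite ?normc_ge0//.
  apply/ltW/fd; rewrite /a min_l// addrC addKr normcM normcR gtr0_norm ?expR_gt0//.
  apply: lt_le_trans eb; rewrite ltr_pM2l ?expR_gt0//.
  by apply: le_lt_trans (P_le t) _; rewrite ltr_pM2r// ltr_nat.
- rewrite subr0.
  have -> : 2 * (e / M * k) * (2 * pi) = e * ((M - 1) / M).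
    rewrite (_ : M - 1 = 2 * k * (2 * pi)); last by rewrite /M addrK.
    by field; rewrite gt_eqF.
  by rewrite ler_piMr ?ltW// ltr_pdivrMr// mul1r ltrBlDr ltrDl.
Qed.

End CauchyKernel.

(** * Taylor expansion *)

Section TaylorExpansion.
Variable R : realType.
Local Notation C := (R[i]^o).
Implicit Types (s t : R) (f : C -> C) (z w : C).

Lemma cvg_geometric_bound (u : nat -> C) (l : C) (B x : R) : 0 <= x < 1 ->
  (forall N, normc (u N - l) <= B * x ^+ N) -> u @ \oo --> l.
Proof.
move=> x01 uB; apply/cvgCP => e e0; have [N HN] := geometric_small B x01 e0.
by exists N => // k /HN; apply: le_lt_trans; exact: uB.
Qed.

Section KernelExpansion.
Variables (sigma : R) (w : C) (g : R -> C) (M : R).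
Hypotheses (ws : normc w < sigma) (cg : continuous g).
Hypothesis gM : forall t, normc (g t) <= M.

Let zeta t : C := sigma%:C * cis t.

Let s0 : 0 < sigma. Proof. exact: le_lt_trans (normc_ge0 _) ws. Qed.

Let normc_zeta t : normc (zeta t) = sigma.
Proof. exact: normc_circle. Qed.

Let zeta0 t : zeta t != 0.
Proof. by apply/eqP => z0; have := normc_zeta t; rewrite z0 normc0; move: s0; lra. Qed.

Let zetaw t : sigma - normc w <= normc (zeta t - w).
Proof. have := ler_normcD (zeta t - w) w; rewrite subrK normc_zeta; lra. Qed.

Let zetaw0 t : zeta t - w != 0.
Proof.
by apply/eqP => z0; have := zetaw t; rewrite z0 normc0; move: ws; lra.
Qed.

Let czeta : continuous zeta.
Proof. exact: continuous_circle. Qed.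

Let cI k : continuous (fun t => g t * (zeta t)^-1 ^+ k).
Proof.
apply: continuousCM; first exact: cg.
by apply: continuousCX; apply: continuousCV; [exact: czeta|exact: zeta0].
Qed.

Let cT k : continuous (fun t => g t * (zeta t)^-1 ^+ k * (zeta t / (zeta t - w))).
Proof.
apply: continuousCM; first exact: cI.
apply: continuousCM; first exact: czeta.
apply: continuousCV; last exact: zetaw0.
by apply: continuousCB; [exact: czeta|exact: continuousC_cst].
Qed.

Let T k := cint (fun t => g t * (zeta t)^-1 ^+ k * (zeta t / (zeta t - w))) 0 (2 * pi).

Let TS k : T k = cint (fun t => g t * (zeta t)^-1 ^+ k) 0 (2 * pi) + w * T k.+1.
Proof.
rewrite /T -(cintZ _ _ _ (@cT k.+1)).
have cT' : continuous (fun t => w * (g t * (zeta t)^-1 ^+ k.+1 * (zeta t / (zeta t - w)))).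
  by apply: continuousCM; [exact: continuousC_cst|exact: cT].
rewrite -(cintD _ _ (@cI k) cT'); congr cint; apply/funext => t.
rewrite exprS; move: (zeta0 t) (zetaw0 t); move: (zeta t) => x x0 xw0.
by field; rewrite x0 xw0.
Qed.

(** Integrated geometric series: from zeta / (zeta - w) = 1 + w / (zeta - w), the
    remainder after N terms is [w ^+ N * T N], which is O((|w| / sigma)^N). *)
Lemma kernel_expansion :
  (fun N => \sum_(k < N) cint (fun t => g t * (sigma%:C * cis t)^-1 ^+ k) 0 (2 * pi) * w ^+ k)
    @ \oo --> cint (fun t => g t * ((sigma%:C * cis t) / (sigma%:C * cis t - w))) 0 (2 * pi).
Proof.
have -> : cint (fun t => g t * ((sigma%:C * cis t) / (sigma%:C * cis t - w))) 0 (2 * pi) = T 0.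
  by congr cint; apply/funext => t; rewrite expr0 mulr1.
have E N : \sum_(k < N) cint (fun t => g t * (sigma%:C * cis t)^-1 ^+ k) 0 (2 * pi) * w ^+ k
    - T 0 = - (w ^+ N * T N).
  elim: N => [|N IH]; first by rewrite big_ord0 expr0 mul1r sub0r.
  rewrite big_ord_recr/= addrAC IH TS exprSr.
  set X := cint _ _ _; set Y := T _; ring.
apply: (@cvg_geometric_bound _ _ (2 * (M * (sigma / (sigma - normc w))) * (2 * pi))
  (normc w / sigma)).
  by rewrite divr_ge0 ?normc_ge0 ?ltW//= ltr_pdivrMr// mul1r.
move=> N; rewrite E normcN normcM normcX exprMn mulrC mulrAC -mulrA.
rewrite [leRHS](_ : _ = (2 * (M * (sigma / (sigma - normc w))) * (2 * pi) * sigma^-1 ^+ N)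
  * normc w ^+ N); last by ring.
rewrite ler_wpM2r ?exprn_ge0 ?normc_ge0//.
have pi0 : 0 <= 2 * pi :> R by rewrite mulr_ge0// pi_ge0.
apply: le_trans (@normc_cint R _ 0 (2 * pi)
  (M * (sigma / (sigma - normc w)) * sigma^-1 ^+ N) pi0 (@cT N) _) _.
  move=> t _; have M0 : 0 <= M by apply: le_trans (normc_ge0 _) (gM t).
  move: (normc_zeta t) (zetaw t); move: (zeta t) => x xs xw.
  rewrite !normcM normcX !normcV xs mulrAC.
  rewrite ler_wpM2r ?exprn_ge0 ?invr_ge0 ?(ltW s0)//.
  apply: ler_pM; rewrite ?normc_ge0 ?gM ?mulr_ge0 ?invr_ge0 ?normc_ge0 ?(ltW s0)//.
  rewrite ler_pM2l// lef_pV2// posrE ?subr_gt0//.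
  by apply: lt_le_trans xw; rewrite subr_gt0.
by rewrite subr0; move: pi0; set X := 2 * pi; lra.
Qed.

End KernelExpansion.

Definition taylor_coef f (sigma : R) k : C :=
  (2 * pi)%:C^-1 *
  cint (fun t => f (sigma%:C * cis t) * (sigma%:C * cis t)^-1 ^+ k) 0 (2 * pi).

Let pi2_gt0 : 0 < 2 * pi :> R.
Proof. by rewrite mulr_gt0// pi_gt0. Qed.

Let pi2_neq0 : (2 * pi)%:C != 0 :> C.
Proof. by rewrite (inj_eq (@complexI R)) gt_eqF. Qed.

(** Both sides of Cauchy's formula are expanded in powers of w; for the constant
    function 1 only the term of index 0 survives, which evaluates the integral of
    the kernel. *)
Lemma cvg_taylor_circle f (r sigma : R) w : sigma < r -> normc w < sigma ->
  (forall z, normc z < r -> cdifferentiable f z) ->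
  (fun N => \sum_(k < N) taylor_coef f sigma k * w ^+ k) @ \oo --> f w.
Proof.
move=> sr ws df; have s0 : 0 < sigma by exact: le_lt_trans (normc_ge0 _) ws.
have cf z : normc z <= sigma -> {for z, continuous f}.
  by move=> zs; apply/cdifferentiable_continuous/df/(le_lt_trans zs sr).
have cg : continuous (fun t => f (sigma%:C * cis t)).
  move=> t; apply: (@continuous_comp _ _ _ (fun t => sigma%:C * cis t : C) f).
    exact: continuous_circle.
  by apply: cf; rewrite normc_circle.
have [M gM] : exists M, forall z, normc z <= sigma -> normc (f z) <= M.
  have cn : {within [set z : C | normc z <= sigma], continuous (fun z => normc (f z) : R)}.
    apply: continuous_in_subspaceT => z /[!inE]/= zs.
    apply: (@continuous_comp _ _ _ f (fun w : C => normc w : R)); first exact: cf.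
    exact: continuous_normc.
  have := compact_bounded (continuous_compact cn (@compact_cdisk R sigma)).
  move=> [M [_ MP]]; exists (M + 1) => z zs.
  apply: le_trans (ler_norm _) _; apply: (MP (M + 1)); first by rewrite ltrDl.
  by exists z.
have gM' t : normc (f (sigma%:C * cis t)) <= M by apply: gM; rewrite normc_circle.
have H1 := kernel_expansion ws cg gM'.
have c1 : continuous (fun _ : R => 1 : C) by exact: continuousC_cst.
have n1 (t : R) : normc (1 : C) <= 1 by rewrite normc1.
have H2 := kernel_expansion ws c1 n1.
have T1 : cint (fun t => 1 * ((sigma%:C * cis t) / (sigma%:C * cis t - w))) 0 (2 * pi)
    = (2 * pi)%:C.
  apply: cvg_unique H2 _; first exact: norm_hausdorff.
  apply/cvgCP => e e0; exists 1%N => // N /= N0.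
  rewrite -(prednK N0) big_ord_recl big1 => [|i _].
    rewrite expr0 mulr1 addr0 (_ : (fun t => _) = (fun t => (cis t)^-1 ^+ 0)).
      by rewrite cint_cis_exp subrr normc0.
    by apply/funext => t; rewrite !expr0 mulr1.
  rewrite (_ : (fun t => _) = (fun t => sigma%:C^-1 ^+ (bump 0 i) * (cis t)^-1 ^+ (bump 0 i))).
    have cc : continuous (fun t : R => (cis t)^-1 ^+ bump 0 i).
      by apply: continuousCX; apply: continuousCV;
        [exact: continuous_cis|exact: cis_neq0].
    by rewrite (cintZ _ _ _ cc) cint_cis_exp /= mulr0 mul0r.
  by apply/funext => t; rewrite mul1r invfM exprMn.
have CK := cauchy_kernel sr ws df.
have cK : continuous (fun t => (sigma%:C * cis t) / (sigma%:C * cis t - w) : C).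
  apply: continuousCM; first exact: continuous_circle.
  apply: continuousCV => [|t].
    by apply: continuousCB; [exact: continuous_circle|exact: continuousC_cst].
  rewrite subr_eq0; apply/eqP => E; move: ws; rewrite -E normc_circle//.
  by rewrite ltxx.
have Tf : cint (fun t => f (sigma%:C * cis t) *
    ((sigma%:C * cis t) / (sigma%:C * cis t - w))) 0 (2 * pi) = f w * (2 * pi)%:C.
  apply: (@mulfI _ ('i : C)); first by rewrite neq0Ci.
  have c2 : continuous (fun t => 1 * ((sigma%:C * cis t) / (sigma%:C * cis t - w)) : C).
    by apply: continuousCM; [exact: continuousC_cst|exact: cK].
  rewrite -(cintZ _ _ _ (continuousCM cg cK)) [RHS]mulrCA -T1 -(cintZ _ _ _ c2).
  rewrite (_ : (fun t => _) = (fun t => f (sigma%:C * cis t) *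
      ('i * (sigma%:C * cis t) / (sigma%:C * cis t - w)))).
    rewrite CK; congr (_ * cint _ _ _); apply/funext => t.
    by rewrite mul1r !mulrA.
  by apply/funext => t; rewrite mulrCA !mulrA.
rewrite (_ : (fun N => _) = (fun N => (2 * pi)%:C^-1 * \sum_(k < N)
  cint (fun t => f (sigma%:C * cis t) * (sigma%:C * cis t)^-1 ^+ k) 0 (2 * pi) * w ^+ k)).
  rewrite -[f w](mulKf pi2_neq0) [_ * f w]mulrC -Tf.
  by apply: cvgM; [exact: cvg_cst|exact: H1].
by apply/funext => N; rewrite mulr_sumr; apply: eq_bigr => k _; rewrite mulrA.
Qed.

Lemma taylor_coef_le f (r sigma M : R) k : 0 < sigma < r ->
  (forall z, normc z < r -> cdifferentiable f z) ->
  (forall z, normc z = sigma -> normc (f z) <= M) ->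
  normc (taylor_coef f sigma k) * sigma ^+ k <= 2 * M.
Proof.
move=> /andP[s0 sr] df fM.
have cg : continuous (fun t => f (sigma%:C * cis t)).
  move=> t; apply: (@continuous_comp _ _ _ (fun t => sigma%:C * cis t : C) f).
    exact: continuous_circle.
  by apply/cdifferentiable_continuous/df; rewrite normc_circle.
have cI : continuous (fun t => f (sigma%:C * cis t) * (sigma%:C * cis t)^-1 ^+ k).
  apply: continuousCM; first exact: cg.
  apply: continuousCX; apply: continuousCV => [|t]; first exact: continuous_circle.
  by apply/eqP => E; have := normc_circle t s0; rewrite E normc0; move: s0; lra.
rewrite /taylor_coef normcM normcV normcR gtr0_norm//.
rewrite -ler_pdivlMr ?exprn_gt0// ler_pdivrMl//.
apply: le_trans (@normc_cint R _ 0 (2 * pi) (M / sigma ^+ k) (ltW pi2_gt0) cI _) _.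
  move=> t _; rewrite normcM normcX normcV normc_circle// exprVn.
  apply: ler_wpM2r; first by rewrite invr_ge0 exprn_ge0// ltW.
  by apply: fM; rewrite normc_circle.
by rewrite subr0; apply: le_of_eq; ring.
Qed.

End TaylorExpansion.

(** * Uniqueness of power series *)

Section PowerSeriesUniqueness.
Variable R : realType.
Local Notation C := (R[i]^o).

Lemma power_series_terms_bounded (a : nat -> C) (l z : C) :
  (fun N => \sum_(k < N) a k * z ^+ k) @ \oo --> l ->
  exists2 B : R, 0 < B & forall k, normc (a k) * normc z ^+ k <= B.
Proof.
move=> /(@cvgCP R nat \oo _ _ l)/(_ 1 ltr01)[n _ Hn].
exists (2 + \sum_(k < n) normc (a k) * normc z ^+ k).
  by rewrite ltr_wpDr// sumr_ge0// => k _; rewrite mulr_ge0 ?exprn_ge0 ?normc_ge0.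
move=> k; have [nk|kn] := leqP n k; last first.
  rewrite (bigD1 (Ordinal kn))//= addrCA lerDl addr_ge0// sumr_ge0// => j _.
  by rewrite mulr_ge0 ?exprn_ge0 ?normc_ge0.
apply: (@le_trans _ _ 2); last first.
  by rewrite lerDl sumr_ge0// => j _; rewrite mulr_ge0 ?exprn_ge0 ?normc_ge0.
have := Hn k.+1 (leqW nk); have := Hn k nk; rewrite /= big_ord_recr/=.
set S := \sum_(_ < _) _; rewrite -normcX -normcM; set t := _ * _ => Sk Sk1.
have -> : t = (S + t - l) - (S - l) by ring.
by apply: le_trans (ler_normcD _ _) _; rewrite normcN; lra.
Qed.

(** If the coefficients of index less than m vanish, then at [t * rho] the terms of
    index greater than m add up to at most [2 * B * t ^+ m.+1], while the term of
    index m is a multiple of [t ^+ m]; letting t tend to 0 gives a m = 0. *)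
Lemma power_series_eq0 (a : nat -> C) (d : R) : 0 < d ->
  (forall z, normc z < d -> (fun N => \sum_(k < N) a k * z ^+ k) @ \oo --> (0 : C)) ->
  forall k, a k = 0.
Proof.
move=> d0 Ha; elim/ltn_ind => m IH.
pose rho := d / 2; have rho0 : 0 < rho by rewrite divr_gt0.
have nx (x : R) : 0 < x -> normc (x%:C : C) = x by move=> x0; rewrite normcR gtr0_norm.
have [|B B0 HB] := @power_series_terms_bounded a 0 rho%:C.
  by apply: Ha; rewrite nx// /rho; move: d0; lra.
have {}HB k : normc (a k) * rho ^+ k <= B by have := HB k; rewrite nx.
suff H t : 0 < t <= 1/2 -> normc (a m) * rho ^+ m <= 2 * B * t.
  apply/eq0_normc/eqP; rewrite eq_le normc_ge0 andbT leNgt; apply/negP => am.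
  pose A := normc (a m) * rho ^+ m; have A0 : 0 < A by rewrite mulr_gt0// exprn_gt0.
  pose t := Num.min (1/2) (A / (4 * B)).
  have t0 : 0 < t by rewrite lt_min !divr_gt0// mulr_gt0.
  have := H t; rewrite t0 ge_min lexx/= => /(_ isT); rewrite -/A.
  have : t <= A / (4 * B) by rewrite ge_min lexx orbT.
  by rewrite ler_pdivlMr ?mulr_gt0//; move: A0; lra.
move=> /andP[t0 t1]; pose x := t * rho.
have x0 : 0 < x by rewrite mulr_gt0.
have tail N : normc (\sum_(k < m.+1 + N) a k * x%:C ^+ k - a m * x%:C ^+ m) <=
    2 * B * t ^+ m.+1.
  have Bt : 0 <= B * t ^+ m.+1 by rewrite mulr_ge0 ?exprn_ge0 ?(ltW t0) ?(ltW B0).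
  rewrite big_split_ord/= big_ord_recr/= big1 => [|k _]; last by rewrite IH// mul0r.
  rewrite add0r addrAC subrr add0r; apply: le_trans (normc_sum _ _ _) _.
  have t1' : 0 <= t < 1 by move: t0 t1; lra.
  apply: le_trans (@geometric_sum_le R (fun k => normc (a (m.+1 + k)%N * x%:C ^+ (m.+1 + k)))
    _ _ N Bt t1' _) _.
    move=> k; rewrite normcM normcX nx// /x exprMn mulrCA -mulrA -exprD mulrC.
    by rewrite ler_wpM2r ?HB// exprn_ge0// ltW.
  rewrite ler_pdivrMr ?subr_gt0; last by case/andP: t1'.
  have : 0 <= B * t ^+ m.+1 * (1 - 2 * t) by rewrite mulr_ge0//; move: t1; lra.
  by rewrite -(mulrA 2 B); set p := B * _; lra.
have am_le e : 0 < e -> normc (a m) * x ^+ m <= 2 * B * t ^+ m.+1 + e.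
  move=> e0; have [|n _ Hn] := (@cvgCP R nat \oo _ _ (0 : C)).1 (Ha x%:C _) e e0.
    by rewrite nx// /x; move: t1 d0; rewrite /rho; nra.
  have := Hn (m.+1 + n)%N (leq_addl _ _); rewrite /= subr0 => Sn.
  have := tail n; set S := \sum_(_ < _) _ in Sn *; set T := a m * _ => ST.
  have -> : normc (a m) * x ^+ m = normc T by rewrite normcM normcX nx.
  have -> : T = S - (S - T) by ring.
  apply: le_trans (ler_normcD _ _) _; rewrite normcN.
  by move: ST Sn; set X := normc S; set Y := normc _; lra.
have : normc (a m) * x ^+ m <= 2 * B * t ^+ m.+1.
  by apply/ler_addgt0Pr => e e0; exact: am_le.
rewrite (_ : normc (a m) * x ^+ m = normc (a m) * rho ^+ m * t ^+ m); last first.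
  by rewrite /x exprMn; ring.
rewrite (_ : 2 * B * t ^+ m.+1 = 2 * B * t * t ^+ m); last by rewrite exprS; ring.
by rewrite ler_pM2r ?exprn_gt0.
Qed.

Lemma power_series_unique (a b : nat -> C) (f : C -> C) (d : R) : 0 < d ->
  (forall z, normc z < d -> (fun N => \sum_(k < N) a k * z ^+ k) @ \oo --> f z) ->
  (forall z, normc z < d -> (fun N => \sum_(k < N) b k * z ^+ k) @ \oo --> f z) ->
  a = b.
Proof.
move=> d0 Ha Hb; apply/funext => k; apply/eqP; rewrite -subr_eq0; apply/eqP.
move: k; apply: (@power_series_eq0 (fun k => a k - b k) d d0) => z zd.
rewrite -[X in _ --> X](subrr (f z)) (_ : (fun N => _) =
  (fun N => \sum_(k < N) a k * z ^+ k - \sum_(k < N) b k * z ^+ k)).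
  by apply: cvgB; [exact: Ha|exact: Hb].
by apply/funext => N; rewrite -sumrB; under eq_bigr do rewrite mulrBl.
Qed.

(** The coefficients obtained on circles of different radii agree because they
    expand the same function near 0; hence a single series represents f on the
    whole disk and obeys the Cauchy estimate at every radius. *)
Theorem taylor (f : C -> C) (r : R) : 0 < r ->
  (forall z, normc z < r -> derivable f z 1) ->
  exists c : nat -> C,
    (forall (sigma M : R) k, 0 < sigma < r ->
      (forall z, normc z = sigma -> normc (f z) <= M) ->
      normc (c k) * sigma ^+ k <= 2 * M) /\
    (forall z, normc z < r ->
      (fun N => \sum_(k < N) c k * z ^+ k) @ \oo --> f z).
Proof.
move=> r0 df.
have {}df z : normc z < r -> cdifferentiable f z.
  by move=> /df; exact: derivable_cdifferentiable.
have cE (s t : R) : 0 < s < r -> 0 < t < r -> taylor_coef f s = taylor_coef f t.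
  move=> /andP[s0 sr] /andP[t0 tr].
  apply: (@power_series_unique _ _ f (Num.min s t)); first by rewrite lt_min s0.
  - by move=> z; rewrite lt_min => /andP[zs zt]; exact: cvg_taylor_circle df.
  - by move=> z; rewrite lt_min => /andP[zs zt]; exact: cvg_taylor_circle df.
have r2 : 0 < r / 2 < r by rewrite divr_gt0//= ltr_pdivrMr// ltr_pMr// ltr1n.
exists (taylor_coef f (r / 2)); split=> [s M k sr fM|z zr].
  by rewrite (cE _ s)//; exact: taylor_coef_le df fM.
have zs : normc z < (normc z + r) / 2 by lra.
have sr : (normc z + r) / 2 < r by lra.
rewrite (cE _ ((normc z + r) / 2))//; first exact: cvg_taylor_circle df.
by rewrite sr andbT; apply: le_lt_trans zs; exact: normc_ge0.
Qed.

End PowerSeriesUniqueness.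

(** * Holomorphic functions on a disk *)

Section HolomorphicDisk.
Variables (R : realType) (r : {posnum R}).
Local Notation C := (R[i]^o).
Local Notation disk := (@disk R r).
Local Notation holo := (holo_disk r).
Implicit Types (f g : holo) (z : disk).

Lemma diskE (w : C) : disk w <-> normc w < r%:num.
Proof. by rewrite /Defs.disk /= ltcR. Qed.

Lemma normc_disk z : normc (\val z) < r%:num.
Proof. by apply/diskE/set_mem; exact: valP. Qed.

Definition to_disk (w : C) (wr : normc w < r%:num) : disk :=
  exist _ w (mem_set ((diskE w).2 wr)).

Lemma holo_taylor f : exists c : nat -> C,
  (forall (sigma M : R) k, 0 < sigma < r%:num ->
    (forall z, normc (\val z) = sigma -> normc (f z) <= M) ->
    normc (c k) * sigma ^+ k <= 2 * M) /\
  (forall z, (fun N => \sum_(k < N) c k * (\val z) ^+ k) @ \oo --> f z).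
Proof.
have /asboolP[g fg dg] : holo_fun f \in @holomorphic R r by exact: valP f.
have dg' (w : C) : normc w < r%:num -> derivable g w 1.
  by move=> /diskE; exact: dg.
have [//|c [cM cg]] := taylor _ dg'; exists c; split=> [sigma M k sr fM|z].
  apply: cM => // w ws; have wr : normc w < r%:num by rewrite ws; case/andP: sr.
  by have := fM (to_disk wr) ws; rewrite fg.
by rewrite fg; apply: cg; exact: normc_disk.
Qed.

Definition holo_coef f : nat -> C := projT1 (cid (holo_taylor f)).

Lemma holo_coef_le f (sigma M : R) k : 0 < sigma < r%:num ->
  (forall z, normc (\val z) = sigma -> normc (f z) <= M) ->
  normc (holo_coef f k) * sigma ^+ k <= 2 * M.
Proof. exact: (projT2 (cid (holo_taylor f))).1. Qed.

Lemma cvg_holo_coef f z :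
  (fun N => \sum_(k < N) holo_coef f k * (\val z) ^+ k) @ \oo --> f z.
Proof. exact: (projT2 (cid (holo_taylor f))).2. Qed.

Lemma holo_coef_unique f (a : nat -> C) :
  (forall z, (fun N => \sum_(k < N) a k * (\val z) ^+ k) @ \oo --> f z) ->
  holo_coef f = a.
Proof.
move=> af; pose F (w : C) : C := if pselect (normc w < r%:num) is left wr
  then f (to_disk wr) else 0.
apply: (@power_series_unique R _ _ F r%:num) => // w wr;
  rewrite /F; case: pselect => // wr'; [exact: cvg_holo_coef|exact: af].
Qed.

Lemma holo_coefD (c : R[i]) f g :
  holo_coef (c *: f + g) = fun k => c * holo_coef f k + holo_coef g k.
Proof.
apply: holo_coef_unique => z.
rewrite (_ : (fun N => _) = (fun N => c * (\sum_(k < N) holo_coef f k * \val z ^+ k) +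
  \sum_(k < N) holo_coef g k * \val z ^+ k)).
  have -> : (c *: f + g) z = c * f z + g z by [].
  by apply: cvgD; [apply: cvgM; [exact: cvg_cst|]|]; exact: cvg_holo_coef.
apply/funext => N; rewrite mulr_sumr -big_split/=; apply: eq_bigr => k _.
by rewrite mulrDl mulrA.
Qed.

Lemma disk_coordX k z : (disk_coord r ^+ k) z = \val z ^+ k.
Proof. by elim: k => [//|k IH]; rewrite !exprS -IH. Qed.

Lemma holo_coef_coordX k : holo_coef (disk_coord r ^+ k) = fun j => (j == k)%:R.
Proof.
apply: holo_coef_unique => z; rewrite disk_coordX.
apply/cvgCP => e e0; exists k.+1 => // N /= kN.
rewrite (bigD1 (Ordinal kN))//= eqxx mul1r big1 => [|j jk].
  by rewrite addr0 subrr normc0.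
by rewrite (_ : (j == k :> nat) = false) ?mul0r//; apply/negbTE.
Qed.

Definition taylor_poly f N : holo := \sum_(k < N) holo_coef f k *: disk_coord r ^+ k.

Lemma taylor_polyE f N z :
  taylor_poly f N z = \sum_(k < N) holo_coef f k * (\val z) ^+ k.
Proof.
rewrite /taylor_poly; elim: N => [|N IH]; first by rewrite !big_ord0.
by rewrite !big_ord_recr/= -IH -disk_coordX.
Qed.

Definition holo_close f (rho e : R) : set holo :=
  [set g | forall z, normc (\val z) <= rho -> normc (g z - f z) < e].

Lemma compact_subdisk (rho : R) : rho < r%:num ->
  compact [set z : disk | normc (\val z) <= rho].
Proof.
move=> rr F PF Frho.
have Fv : ((\val : disk -> C) @ F) [set w : C | normc w <= rho] by exact: Frho.
have [p [/= prho pF]] := compact_cdisk (fmap_proper_filter _ PF) Fv.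
have pr : normc p < r%:num by exact: le_lt_trans prho rr.
exists (to_disk pr); split => //= A B FA [U [[W oW <-] /= Wp WB]].
have Wn : nbhs p W by apply: open_nbhs_nbhs; split.
pose X := [set w : C | exists2 z : disk, A z & w = \val z].
have FX : F [set z | X (\val z)] by apply: filterS FA => z Az; exists z.
have [q [[z Az ->] Wz]] := pF X W FX Wn.
by exists z; split => //; exact: WB.
Qed.

Lemma compact_in_subdisk (A : set disk) : compact A ->
  exists2 rho : R, 0 < rho < r%:num & forall z, A z -> normc (\val z) <= rho.
Proof.
move=> cA; have [A0|/set0P/negP/negPn/eqP A0] := pselect (A !=set0); last first.
  exists (r%:num / 2); first by rewrite divr_gt0//= ltr_pdivrMr// ltr_pMr// ltr1n.
  by rewrite A0.
have cn : {within A, continuous (fun z => normc (\val z) : R)}.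
  apply: continuous_subspaceT => z.
  apply: (@continuous_comp _ _ _ (\val : disk -> C) (fun w => normc w : R)).
    exact: initial_continuous.
  exact: continuous_normc.
have [z0 _ z0M] := compact_EVT_max A0 cA cn.
have z0r := normc_disk z0; exists ((normc (\val z0) + r%:num) / 2).
  by have := normc_ge0 (\val z0); move: z0r; lra.
by move=> z Az; have := z0M z (mem_set Az); lra.
Qed.

(** A compact subset of the open disk lies in a closed disk of smaller radius, so
    the topology of compact convergence is that of the suprema over concentric
    closed disks. *)
Lemma holo_nbhsP f (U : set holo) :
  nbhs f U <-> exists rho e : R, [/\ 0 < rho < r%:num, 0 < e & holo_close f rho e `<=` U].
Proof.
split.
- move=> [_ [[V oV <-] /= Vf VU]].
  have nV : nbhs (holo_fun f : {family compact, disk -> C}) V.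
    by apply: open_nbhs_nbhs; split.
  pose D := [set p : R * R | 0 < p.1 < r%:num /\ 0 < p.2].
  pose B (p : R * R) := [set g : disk -> C |
    forall z, normc (\val z) <= p.1 -> normc (g z - f z) < p.2].
  pose G := filter_from D B.
  have FG : Filter G.
    apply: filter_from_filter.
      exists (r%:num / 2, 1); split => //=.
      by rewrite divr_gt0//= ltr_pdivrMr// ltr_pMr// ltr1n.
    move=> [a1 e1] [a2 e2] [/= /andP[a10 a1r] e10] [/= /andP[a20 a2r] e20].
    exists (Num.max a1 a2, Num.min e1 e2).
      by split; rewrite /= ?lt_max ?gt_max ?a10 ?a1r ?a2r ?lt_min ?e10.
    move=> g /= H; split=> z /= za.
      by have := H z; rewrite le_max za lt_min => /(_ isT)/andP[].
    by have := H z; rewrite le_max za orbT lt_min => /(_ isT)/andP[].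
  have : {family compact, G --> holo_fun f}.
    apply/fam_cvgP => A cA W /uniform_nbhs[E [entE EW]].
    have [rho rhor Arho] := compact_in_subdisk cA.
    move: entE; rewrite -entourage_from_ballE => -[d /= d0 dE].
    case: d d0 dE => a b; rewrite ltcE/= => /andP[/eqP b0 a0] dE.
    exists (rho, a); first by split.
    move=> g /= H; apply: EW => z Az; apply: dE; rewrite /= /ball/= ltcE/= b0 eqxx/=.
    have := H z (Arho z Az); rewrite -normcB; exact.
  move=> /(_ _ nV)[[rho e] [/= rhor e0] BV]; exists rho, e; split=> // g gB.
  exact/VU/BV.
- move=> [rho [e [/andP[rho0 rr] e0 BU]]].
  have entE : entourage [set p : C * C | normc (p.1 - p.2) < e].
    rewrite -entourage_from_ballE; exists e%:C; first by rewrite /= ltcR.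
    by move=> [x y]; rewrite /ball/= ltcR.
  have N1 := @fam_nbhs _ _ _ _ _ (holo_fun f : {family compact, disk -> C}) entE
    (compact_subdisk rr).
  have N2 : nbhs f [set g : holo | forall z, normc (\val z) <= rho ->
      normc (f z - g z) < e].
    exact: (@initial_continuous holo _
      (@holo_fun R r : holo -> {family compact, disk -> C}) f _ N1).
  apply: (filterS _ N2) => g /= H; apply: BU => z zrho.
  by rewrite normcB; exact: H.
Qed.

Lemma taylor_poly_tail f (rho sigma B : R) N z : 0 < rho -> rho < sigma ->
  (forall k, normc (holo_coef f k) * sigma ^+ k <= B) -> normc (\val z) <= rho ->
  normc (taylor_poly f N z - f z) <= B * (1 - rho / sigma)^-1 * (rho / sigma) ^+ N.
Proof.
move=> rho0 rs HB zr; have s0 := lt_trans rho0 rs; rewrite taylor_polyE.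
set t := rho / sigma; have t0 : 0 < t by rewrite divr_gt0.
have t1 : 0 < 1 - t by rewrite subr_gt0 ltr_pdivrMr// mul1r.
have B0 : 0 <= B.
  by apply: le_trans (HB 0%N); rewrite mulr_ge0 ?normc_ge0 ?exprn_ge0 ?ltW.
set c := holo_coef f in HB *; set w := \val z in zr *.
have term k : normc (c k * w ^+ k) <= B * t ^+ k.
  rewrite normcM normcX; apply: (@le_trans _ _ (normc (c k) * rho ^+ k)).
    apply: ler_wpM2l; first exact: normc_ge0.
    by apply: lerXn2r => //; rewrite nnegrE ?normc_ge0// ltW.
  have -> : rho = sigma * t by rewrite /t mulrCA mulfV ?mulr1// gt_eqF.
  by rewrite exprMn mulrA; apply: ler_wpM2r; rewrite ?HB// exprn_ge0// ltW.
have tail m : normc (\sum_(k < N + m) c k * w ^+ k - \sum_(k < N) c k * w ^+ k) <=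
    B * (1 - t)^-1 * t ^+ N.
  rewrite big_split_ord/= addrAC subrr add0r mulrAC.
  apply: le_trans (normc_sum _ _ _) _.
  apply: (@geometric_sum_le R (fun k => normc (c (N + k)%N * w ^+ (N + k)))).
  - by rewrite mulr_ge0// exprn_ge0// ltW.
  - by rewrite (ltW t0) -subr_gt0.
  - by move=> k; rewrite -mulrA -exprD; exact: term.
apply/ler_addgt0Pr => e e0.
have [n _ Hn] := (@cvgCP R nat \oo _ _ (f z)).1 (@cvg_holo_coef f z) e e0.
have := Hn (N + n)%N (leq_addl _ _); rewrite /= -/c -/w.
have := tail n; set S := \sum_(k < N + n) _; set S' := \sum_(_ < _) _ => H1 H2.
have -> : S' - f z = (S - f z) - (S - S') by ring.
apply: le_trans (ler_normcD _ _) _; rewrite normcN.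
by move: H1 H2; set X := normc (S - f z); set Y := normc _; lra.
Qed.

Lemma holo_coef_bounded f (sigma : R) : 0 < sigma < r%:num ->
  exists2 B : R, 0 < B & forall k, normc (holo_coef f k) * sigma ^+ k <= B.
Proof.
move=> /andP[s0 sr].
have ns : normc (sigma%:C : C) = sigma by rewrite normcR gtr0_norm.
have sr' : normc (sigma%:C : C) < r%:num by rewrite ns.
have [B B0 HB] := power_series_terms_bounded (@cvg_holo_coef f (to_disk sr')).
by exists B => // k; have := HB k; rewrite ns.
Qed.

(** Polynomials are dense, which reduces identities between continuous linear maps
    to the powers of the coordinate. *)
Lemma cvg_taylor_poly f : taylor_poly f @ \oo --> f.
Proof.
move=> U /holo_nbhsP[rho [e [/andP[rho0 rr] e0 BU]]].
pose sigma := (rho + r%:num) / 2.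
have rs : rho < sigma by rewrite /sigma; lra.
have sr : sigma < r%:num by rewrite /sigma; lra.
have s0 : 0 < sigma by exact: lt_trans rs.
have [|B B0 HB] := @holo_coef_bounded f sigma; first by rewrite s0.
have t01 : 0 <= rho / sigma < 1.
  by rewrite divr_ge0 ?(ltW rho0) ?(ltW s0)//= ltr_pdivrMr// mul1r.
have [m Hm] := geometric_small (B * (1 - rho / sigma)^-1) t01 e0.
exists m => // N /= mN; apply: BU => z zr.
exact: le_lt_trans (taylor_poly_tail N rho0 rs HB zr) (Hm N mN).
Qed.

End HolomorphicDisk.

(** * Topologies defined by seminorms *)

Section SeminormedTopology.
Variable R : realType.

Lemma filter_finite_bigcap (T I : Type) (F : set_system T) (J : set I)
    (P : I -> set T) : Filter F -> finite_set J -> (forall j, J j -> F (P j)) ->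
  F [set x | forall j, J j -> P j x].
Proof.
move=> FF [n]; elim: n J => [|n IH] J.
  rewrite II0 card_eq0 => /eqP -> _.
  by rewrite (_ : [set _ | _] = setT); [exact: filterT|apply/seteqP; split=> // x _ j []].
move=> /eq_cardSP[i Ji Jn] FP.
have H1 : F [set x | forall j, (J `\ i) j -> P j x].
  by apply: IH Jn _ => j [Jj _]; exact: FP.
apply: filterS (filterI (FP i Ji) H1) => x [Pix H] j Jj.
by have [->//|ji] := pselect (j = i); apply: H; split.
Qed.

Section OneSystem.
Variables (A : preTopAlgType R[i]) (I : Type) (p : I -> A -> R).
Hypothesis sp : forall i, seminorm (p i).
Hypothesis tp : topology_defined_by p.

Lemma seminormD i x y : p i (x + y) <= p i x + p i y.
Proof. exact: (sp i).1. Qed.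

Lemma seminormZ i c x : p i (c *: x) = normc c * p i x.
Proof. exact: (sp i).2. Qed.

Lemma seminorm0 i : p i 0 = 0.
Proof. by rewrite -(scale0r 0) seminormZ normc0 mul0r. Qed.

Lemma seminormN i x : p i (- x) = p i x.
Proof. by rewrite -scaleN1r seminormZ normcN normc1 mul1r. Qed.

Lemma seminormB i x y : p i (x - y) = p i (y - x).
Proof. by rewrite -seminormN opprB. Qed.

Lemma seminorm_ge0 i x : 0 <= p i x.
Proof.
have := seminormD i x (- x); rewrite subrr seminorm0 seminormN; lra.
Qed.

Lemma seminorm_sum (T : Type) (s : seq T) (P : pred T) (x : T -> A) i :
  p i (\sum_(k <- s | P k) x k) <= \sum_(k <- s | P k) p i (x k).
Proof.
elim/big_ind2 : _ => [|a b c d ab cd|//]; first by rewrite seminorm0.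
by apply: le_trans (seminormD _ _ _) _; rewrite lerD.
Qed.

Lemma cvg_seminormP (T : Type) (F : set_system T) (f : T -> A) (a : A) : Filter F ->
  (f @ F --> a) <-> (forall i (e : R), 0 < e -> F [set t | p i (f t - a) < e]).
Proof.
move=> FF; split=> [Fa i e e0|H U].
  apply: (Fa [set b | p i (b - a) < e]); rewrite tp; exists [set i], e; split=> //.
  by move=> b /(_ i); exact.
rewrite tp => -[J [e [finJ e0 JU]]].
have := @filter_finite_bigcap _ _ F J (fun j => [set t | p j (f t - a) < e]) FF finJ
  (fun j _ => H j e e0).
by move=> G; apply: (@filterS _ F FF _ (f @^-1` U) _ G) => t; exact: JU.
Qed.

Lemma continuous_seminormP (B : preTopAlgType R[i]) (K : Type) (s : K -> B -> R)
    (f : A -> B) :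
  (forall k, seminorm (s k)) -> topology_defined_by s -> linear f ->
  (forall k, exists i (M : R), forall x, s k (f x) <= M * p i x) -> continuous f.
Proof.
move=> ss ts lf bf a U; rewrite /= ts => -[J [e [finJ e0 JU]]].
have H : nbhs a [set b | forall k, J k -> s k (f b - f a) < e].
  apply: filter_finite_bigcap => // k _; have [i [M sM]] := bf k.
  have M0 : 0 < `|M| + 1 by rewrite ltr_wpDl.
  rewrite tp; exists [set i], (e / (`|M| + 1)); split=> //; first by rewrite divr_gt0.
  move=> b /= /(_ i erefl); rewrite ltr_pdivlMr//; apply: le_lt_trans.
  have -> : f b - f a = f (b - a).
    by have := lf (-1) a b; rewrite !scaleN1r => E; rewrite [b - a]addrC E addrC.
  apply: le_trans (sM _) _; rewrite mulrC ler_wpM2l ?seminorm_ge0//.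
  by have := ler_norm M; lra.
by apply: (@filterS _ (nbhs a) _ _ (f @^-1` U) _ H) => b; exact: JU.
Qed.

Lemma hausdorff_seminormP : hausdorff_space A <->
  (forall x, (forall i, p i x = 0) -> x = 0).
Proof.
split=> [hA x px|H a b ab].
  apply: hA => U V; rewrite tp => -[J [e [_ e0 JU]]] /nbhs_singleton V0.
  by exists 0; split=> //; apply: JU => j _; rewrite /= sub0r seminormN px.
apply/eqP; rewrite -subr_eq0; apply/eqP/H => i; apply/eqP.
rewrite eq_le seminorm_ge0 andbT leNgt; apply/negP => pab.
have e0 : 0 < p i (a - b) / 2 by rewrite divr_gt0.
have N c : nbhs c [set x | p i (x - c) < p i (a - b) / 2].
  rewrite tp; exists [set i], (p i (a - b) / 2); split=> //.
  by move=> x /= /(_ i erefl).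
have [x [/= xa xb]] := ab _ _ (N a) (N b).
have := seminormD i (a - x) (x - b); rewrite addrA subrK (seminormB i a x).
by lra.
Qed.

Lemma cauchy_seminormP (F : set_system A) : ProperFilter F ->
  cauchy_filter F <-> (forall i (e : R), 0 < e ->
    exists2 X, F X & forall x y, X x -> X y -> p i (x - y) < e).
Proof.
move=> PF; rewrite /cauchy_filter cvg_seminormP; split=> H i e e0.
  have [[X Y] /= [FX FY] XY] := H i e e0.
  exists (X `&` Y); first exact: filterI.
  move=> x y [Xx _] [_ Yy]; have := XY (x, y); rewrite /= subr0; apply.
  by split.
have [X FX HX] := H i e e0; exists (X, X) => //= -[x y] [/= Xx Xy].
by rewrite subr0; exact: HX.
Qed.

Lemma complete_cauchy_seq (u : nat -> A) : complete_space A ->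
  (forall i (e : R), 0 < e -> exists N, forall m n, (N <= m)%N -> (N <= n)%N ->
     p i (u m - u n) < e) -> exists a : A, u @ \oo --> a.
Proof.
move=> cA H; apply: cA; apply/cauchy_seminormP => i e e0.
have [N HN] := H i e e0; exists [set x | exists2 m, (N <= m)%N & x = u m].
  by exists N => // m /= Nm; exists m.
by move=> x y [m Nm ->] [n Nn ->]; exact: HN.
Qed.

End OneSystem.

Section Limits.
Variables (A : preTopAlgType R[i]) (I : Type) (p : I -> A -> R).
Hypothesis sp : forall i, seminorm (p i).
Hypothesis mp : forall i, submultiplicative (p i).
Hypothesis tp : topology_defined_by p.
Variables (T : Type) (F : set_system T).
Context {FF : Filter F}.

Lemma cvg_seminormD (u v : T -> A) a b : u @ F --> a -> v @ F --> b ->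
  (fun t => u t + v t) @ F --> a + b.
Proof.
rewrite !(cvg_seminormP tp) => Hu Hv i e e0.
have e2 : 0 < e / 2 by rewrite divr_gt0.
apply: filterS (filterI (Hu i _ e2) (Hv i _ e2)) => t [/= ut vt].
rewrite opprD addrACA; apply: le_lt_trans (seminormD sp _ _ _) _.
by rewrite [e]splitr ltrD.
Qed.

Lemma cvg_seminormMl c (u : T -> A) a : u @ F --> a -> (fun t => c * u t) @ F --> c * a.
Proof.
rewrite !(cvg_seminormP tp) => Hu i e e0.
have c0 : 0 < p i c + 1 by rewrite ltr_wpDl// (seminorm_ge0 sp).
have ec : 0 < e / (p i c + 1) by rewrite divr_gt0.
apply: filterS (Hu i _ ec) => t /=; rewrite ltr_pdivlMr//; apply: le_lt_trans.
rewrite -mulrBr; apply: le_trans (mp _ _ _) _.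
have := seminorm_ge0 sp i (u t - a); lra.
Qed.

Lemma cvg_seminormMr c (u : T -> A) a : u @ F --> a -> (fun t => u t * c) @ F --> a * c.
Proof.
rewrite !(cvg_seminormP tp) => Hu i e e0.
have c0 : 0 < p i c + 1 by rewrite ltr_wpDl// (seminorm_ge0 sp).
have ec : 0 < e / (p i c + 1) by rewrite divr_gt0.
apply: filterS (Hu i _ ec) => t /=; rewrite ltr_pdivlMr//; apply: le_lt_trans.
rewrite -mulrBl; apply: le_trans (mp _ _ _) _.
have := seminorm_ge0 sp i (u t - a); lra.
Qed.

Lemma cvg_seminormZ (c : R[i]) (u : T -> A) a : u @ F --> a ->
  (fun t => c *: u t) @ F --> c *: a.
Proof.
move=> ua; rewrite (_ : (fun t => _) = (fun t => (c *: 1) * u t)).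
  by rewrite -[c *: a]mul1r -scalerAr scalerAl; exact: cvg_seminormMl.
by apply/funext => t; rewrite -scalerAl mul1r.
Qed.

End Limits.

End SeminormedTopology.

(** * The quantum polydisk as a Frechet-Arens-Michael algebra *)

Section QuantumNorms.
Variables (R : realType) (n : nat) (q : R[i]) (r : R).
Local Notation M := {ffun 'I_n -> nat}.
Local Notation Q := (qpolydisk n q r).
Implicit Types (rho : qradius r) (f g : Q) (a b : M).

Definition qcoef f a : R[i] := (qpolydisk_series f) a.

Lemma qcoefD f g a : qcoef (f + g) a = qcoef f a + qcoef g a.
Proof. by []. Qed.

Lemma qcoefZ c f a : qcoef (c *: f) a = c * qcoef f a.
Proof. by []. Qed.

Lemma qcoefB f g a : qcoef (f - g) a = qcoef f a - qcoef g a.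
Proof. by []. Qed.

Lemma qcoef_inj f g : qcoef f =1 qcoef g -> f = g.
Proof. by move=> fg; apply/val_inj/funext => a; exact: fg. Qed.

Lemma qradius_gt0 rho : 0 < sval rho. Proof. by have /andP[] := svalP rho. Qed.

Lemma qradius_lt rho : sval rho < r. Proof. by have /andP[] := svalP rho. Qed.

Lemma qenorm_fin_num rho f : qenorm (sval rho) f \is a fin_num.
Proof.
rewrite ge0_fin_numE; last first.
  by apply: esum_ge0 => a _; rewrite lee_fin qterm_ge0// ltW// qradius_gt0.
by have /asboolP := valP f; apply; exact: (svalP rho).
Qed.

Lemma le_box_qnorm rho f N : \sum_(a <- mbox N) qterm (sval rho) f a <= qnorm rho f.
Proof.
rewrite -lee_fin /qnorm fineK ?qenorm_fin_num// -sumEFin.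
apply: esum_ge; exists [set` mbox N]; first by split=> //; exact: finite_seq.
by rewrite -fsbig_seq// mbox_uniq.
Qed.

Lemma qnorm_le_box rho f (K : R) :
  (forall N, \sum_(a <- mbox N) qterm (sval rho) f a <= K) -> qnorm rho f <= K.
Proof.
move=> fK; rewrite -lee_fin /qnorm fineK ?qenorm_fin_num//.
apply: ge_ereal_sup => _ [X [finX _] <-].
rewrite fsbig_finite//=; have [N XN] := mbox_cover (fset_set X).
rewrite sumEFin lee_fin (le_trans _ (fK N))//.
rewrite [leRHS](bigID (mem (fset_set X)))/= -[leLHS]addr0 lerD//; last first.
  by apply: sumr_ge0 => a _; rewrite qterm_ge0// ltW// qradius_gt0.
rewrite -[leRHS]big_filter (perm_big [seq a <- mbox N | a \in fset_set X])//.
apply: uniq_perm => [||a]; rewrite ?filter_uniq ?mbox_uniq ?fset_uniq//.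
by rewrite mem_filter; have [/XN ->|] := boolP (a \in fset_set X); rewrite ?andbT.
Qed.

Lemma qnorm_ge0 rho f : 0 <= qnorm rho f.
Proof.
apply: le_trans (le_box_qnorm rho f 0); apply: sumr_ge0 => a _.
by rewrite qterm_ge0// ltW// qradius_gt0.
Qed.

Lemma qterm_le_qnorm rho f a : qterm (sval rho) f a <= qnorm rho f.
Proof.
apply: le_trans (le_box_qnorm rho f (mdeg a)).
rewrite (bigD1_seq a) ?mbox_uniq ?mem_mbox_mdeg//= lerDl sumr_ge0// => b _.
by rewrite qterm_ge0// ltW// qradius_gt0.
Qed.

Lemma qnormD rho f g : qnorm rho (f + g) <= qnorm rho f + qnorm rho g.
Proof.
apply: qnorm_le_box => N.
apply: le_trans (lerD (le_box_qnorm rho f N) (le_box_qnorm rho g N)).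
rewrite -big_split ler_sum//= => a _; rewrite /qterm -!mulrDl.
have rho0 := ltW (qradius_gt0 rho).
by do 2! rewrite ler_wpM2r ?exprn_ge0 ?qweight_ge0//; exact: ler_normcD.
Qed.

Lemma qnormZ rho c f : qnorm rho (c *: f) = normc c * qnorm rho f.
Proof.
have le (d : R[i]) (h : Q) : qnorm rho (d *: h) <= normc d * qnorm rho h.
  apply: qnorm_le_box => N.
  apply: le_trans (ler_wpM2l (normc_ge0 d) (le_box_qnorm rho h N)).
  rewrite mulr_sumr ler_sum// => a _; rewrite /qterm.
  by rewrite [X in normc X](_ : _ = d * qcoef h a)// normcM !mulrA.
have [->|c0] := eqVneq c 0.
  apply/eqP; rewrite eq_le le scale0r normc0 mul0r/=.
  exact: qnorm_ge0.
apply/eqP; rewrite eq_le le/=.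
have nc : 0 < normc c.
  by rewrite lt_def normc_ge0 andbT; apply: contraNneq c0 => /eq0_normc ->.
rewrite -ler_pdivlMl// -normcV -[X in qnorm _ X <= _]scale1r -(mulVf c0).
by rewrite -scalerA le.
Qed.

(** The coefficient of x^c in a product is a sum over a + b = c, and [qweightD]
    bounds each summand by the product of the two weighted terms. *)
Lemma qnormM rho f g : qnorm rho (f * g) <= qnorm rho f * qnorm rho g.
Proof.
have rho0 := ltW (qradius_gt0 rho); set x := sval rho.
apply: qnorm_le_box => N; pose s := mbox N : seq M.
pose F a b := qterm x f a * qterm x g b.
have F0 a b : 0 <= F a b by rewrite mulr_ge0 ?qterm_ge0.
apply: (@le_trans _ _ (\sum_(a <- s) \sum_(b <- s) F a b)); last first.
  rewrite -big_distrlr/=; apply: ler_pM; try exact: le_box_qnorm;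
    by apply: sumr_ge0 => a _; exact: qterm_ge0.
apply: (@le_trans _ _ (\sum_(c <- s) \sum_(a <- s) \sum_(b <- s | a + b == c) F a b)).
  rewrite big_seq [leRHS]big_seq ler_sum// => c cN.
  have w0 : 0 <= qweight q c * x ^+ mdeg c by rewrite mulr_ge0 ?qweight_ge0 ?exprn_ge0.
  rewrite /qterm -[X in normc X]/(qmul (qpolydisk_series f) (qpolydisk_series g) c).
  rewrite (qmulE _ _ cN) -mulrA (le_trans (ler_wpM2r w0 (normc_sum _ _ _)))//.
  rewrite mulr_suml ler_sum// => a _.
  rewrite (le_trans (ler_wpM2r w0 (normc_sum _ _ _)))//.
  rewrite mulr_suml ler_sum// => b /eqP <-.
  rewrite !normcM mdegD exprD /F /qterm.
  set t := normc (qtwist _ _ _); set y := normc (_ a); set z := normc (_ b).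
  rewrite [leLHS](_ : _ =
    (t * qweight q (a + b)) * (y * z * (x ^+ mdeg a * x ^+ mdeg b))); last by ring.
  rewrite [leRHS](_ : _ =
    (qweight q a * qweight q b) * (y * z * (x ^+ mdeg a * x ^+ mdeg b))); last by ring.
  by rewrite ler_wpM2r ?qweightD// !mulr_ge0 ?normc_ge0 ?exprn_ge0.
rewrite exchange_big/= ler_sum// => a _.
under eq_bigr do rewrite big_mkcond.
rewrite exchange_big/= ler_sum// => b _.
rewrite -big_mkcond/=; have [abN|abN] := boolP (a + b \in s).
  by rewrite (big_mboxD (fun=> F a b) abN).
rewrite big_seq_cond big1// => c /andP[cN /eqP abc].
by rewrite abc cN in abN.
Qed.

Lemma qseminorm rho : seminorm (@qnorm R n q r rho).
Proof. by split; [exact: qnormD|move=> c x; exact: qnormZ]. Qed.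

Lemma qsubmultiplicative rho : submultiplicative (@qnorm R n q r rho).
Proof. exact: qnormM. Qed.

Lemma qtopology : topology_defined_by (@qnorm R n q r).
Proof. by move=> a. Qed.

Lemma qnorm_homo (rho sigma : qradius r) f : sval rho <= sval sigma ->
  qnorm rho f <= qnorm sigma f.
Proof.
move=> rs; apply: qnorm_le_box => N; apply: le_trans (le_box_qnorm sigma f N).
apply: ler_sum => a _; apply: ler_wpM2l; first by rewrite mulr_ge0 ?normc_ge0 ?qweight_ge0.
by apply: lerXn2r => //; rewrite nnegrE ltW// qradius_gt0.
Qed.

Lemma qpolydisk_of_bound (g : qseries n q) :
  (forall rho, exists K : R, forall N, \sum_(a <- mbox N) qterm (sval rho) g a <= K) ->
  exists f : Q, forall a, qcoef f a = g a.
Proof.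
move=> gK; have gP : g \in @qpolydisk_pred R n q r.
  apply/asboolP => x xr; have [K KP] := gK (exist _ x xr).
  have x0 : 0 <= x by have /andP[/ltW] := xr.
  by apply/(qenorm_boxP _ x0); exists K.
by exists (QPolydisk gP).
Qed.

End QuantumNorms.

Lemma complex_cauchy_seq (R : realType) (u : nat -> R[i]^o) :
  (forall e : R, 0 < e -> exists N, forall m k, (N <= m)%N -> (N <= k)%N ->
    normc (u m - u k) < e) -> exists l : R[i]^o, u @ \oo --> l.
Proof.
move=> H.
have C (v : nat -> R) : (forall e : R, 0 < e -> exists N, forall m k, (N <= m)%N ->
    (N <= k)%N -> `|v m - v k| < e) -> exists l : R, v @ \oo --> l.
  move=> Hv; have : cauchy (v @ \oo).
    apply: cauchy_exP => e e0; have [N HN] := Hv e e0.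
    by exists (v N); exists N => // k /= Nk; exact: HN.
  by move=> /cauchy_cvgP vc; exists (lim (v @ \oo)).
have [|l1 H1] := C (fun k => Re (u k)).
  move=> e e0; have [N HN] := H e e0; exists N => m k Nm Nk.
  by rewrite -cReB; apply: le_lt_trans (normc_Re _) _; exact: HN.
have [|l2 H2] := C (fun k => Im (u k)).
  move=> e e0; have [N HN] := H e e0; exists N => m k Nm Nk.
  by rewrite -cImB; apply: le_lt_trans (normc_Im _) _; exact: HN.
by exists (l1 +i* l2); apply/cvgC_ReIm.
Qed.

Section Radii.
Variables (R : realType) (r : R).
Hypothesis r0 : 0 < r.

Let rad k : R := r * (1 - k.+2%:R^-1).

Let rad_itv k : 0 < rad k < r.
Proof.
rewrite /rad mulr_gt0 ?subr_gt0 ?invf_lt1 ?ltr1n//=.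
by rewrite gtr_pMr// gtrBl invr_gt0.
Qed.

Lemma qrad_spec k : {rho : qradius r | sval rho = rad k}.
Proof. by exists (exist _ (rad k) (rad_itv k)). Qed.

Definition qrad k : qradius r := sval (qrad_spec k).

Let qradE k : sval (qrad k) = rad k. Proof. exact: (svalP (qrad_spec k)). Qed.

Lemma qrad_lt j k : (j < k)%N -> sval (qrad j) < sval (qrad k).
Proof.
move=> jk; rewrite !qradE /rad ltr_pM2l// ltrD2l ltrN2.
by rewrite ltf_pV2 ?posrE// ltr_nat !ltnS.
Qed.

Lemma qrad_le j k : (j <= k)%N -> sval (qrad j) <= sval (qrad k).
Proof. by rewrite leq_eqVlt => /orP[/eqP ->//|/qrad_lt/ltW]. Qed.

Lemma qrad_cofinal (rho : qradius r) : exists k, sval rho <= sval (qrad k).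
Proof.
have /andP[p0 pr] := svalP rho; set x := sval rho in p0 pr *.
have d0 : 0 < 1 - x / r by rewrite subr_gt0 ltr_pdivrMr// mul1r.
pose k := Num.trunc (1 - x / r)^-1; exists k.
have kx : (1 - x / r)^-1 < k.+1%:R by rewrite truncnS_gt.
rewrite qradE /rad -ler_pdivrMl// mulrC lerBrDr -lerBrDl.
rewrite -[leRHS]invrK lef_pV2 ?posrE ?invr_gt0//.
by apply/ltW/(lt_le_trans kx); rewrite ler_nat.
Qed.

End Radii.

Section QuantumFrechet.
Variables (R : realType) (n : nat) (q : R[i]) (r : R).
Hypotheses (r0 : 0 < r) (q0 : q != 0).
Local Notation M := {ffun 'I_n -> nat}.
Local Notation Q := (qpolydisk n q r).
Implicit Types (rho : qradius r) (f g : Q) (a b : M).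

Lemma qweight_gt0 a : 0 < qweight q a.
Proof.
rewrite /qweight; case: ifP => // _; rewrite exprn_gt0// lt_def normc_ge0 andbT.
by apply: contraNneq q0 => /eq0_normc ->.
Qed.

Lemma qweight_exp_gt0 rho a : 0 < qweight q a * sval rho ^+ mdeg a.
Proof. by rewrite mulr_gt0 ?qweight_gt0// exprn_gt0// qradius_gt0. Qed.

Lemma qtermE rho (f : qseries n q) a :
  qterm (sval rho) f a = normc (f a : R[i]) * (qweight q a * sval rho ^+ mdeg a).
Proof. by rewrite /qterm mulrA. Qed.

Lemma normc_qcoef_le rho f a :
  normc (qcoef f a) <= qnorm rho f / (qweight q a * sval rho ^+ mdeg a).
Proof.
rewrite ler_pdivlMr ?qweight_exp_gt0// -qtermE; exact: qterm_le_qnorm.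
Qed.

Lemma qhausdorff : hausdorff_space Q.
Proof.
apply/(hausdorff_seminormP (@qseminorm R n q r) (@qtopology R n q r)) => f f0.
apply: qcoef_inj => a; apply: eq0_normc; apply/eqP.
rewrite eq_le normc_ge0 andbT; apply: le_trans (normc_qcoef_le (qrad r0 0) f a) _.
by rewrite f0 mul0r.
Qed.

(** As for weighted l^1 spaces: choose x k in an element of the Cauchy filter on
    which the k-th norm oscillates by less than 2^-k; the coefficients of x k
    converge, and the estimates on finite boxes of exponents pass to the limit,
    both to show that the limit has finite norms and that it is approached. *)
Lemma qcomplete : complete_space Q.
Proof.
move=> F PF /(cauchy_seminormP (@qtopology R n q r) PF) cF.
have /choice[X XP] k : exists X, F X /\ forall f g, X f -> X g ->
    qnorm (qrad r0 k) (f - g) < 2^-1 ^+ k.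
  have [|X FX HX] := cF (qrad r0 k) (2^-1 ^+ k); first by rewrite exprn_gt0.
  by exists X.
have /choice[x xP] k : exists f, forall j, (j <= k)%N -> X j f.
  have [f Xf] := filter_ex (@filter_finite_bigcap _ _ F `I_k.+1 X _
    (finite_II _) (fun j _ => (XP j).1)).
  by exists f => j jk; apply: Xf; rewrite /= ltnS.
have xx j m k : (j <= m)%N -> (j <= k)%N ->
    qnorm (qrad r0 j) (x m - x k) < 2^-1 ^+ j.
  by move=> jm jk; apply: (XP j).2; exact: xP.
have small (e : R) : 0 < e -> exists N, 2^-1 ^+ N < e.
  move=> e0; have [N HN] := geometric_small 1 (half01 R) e0.
  by exists N; have := HN N (leqnn N); rewrite mul1r.
have /choice[c cP] a : exists l : R[i]^o, (fun k => qcoef (x k) a : R[i]^o) @ \oo --> l.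
  apply: complex_cauchy_seq => e e0.
  have w0 := qweight_exp_gt0 (qrad r0 0) a.
  have [N HN] := small _ (mulr_gt0 e0 w0); exists N => m k Nm Nk.
  rewrite -qcoefB; apply: le_lt_trans (normc_qcoef_le (qrad r0 0) _ a) _.
  rewrite ltr_pdivrMr//; apply: lt_trans HN.
  apply: le_lt_trans (xx N m k Nm Nk); apply: qnorm_homo; exact: qrad_le.
have lim_box j k N : (j <= k)%N ->
    \sum_(a <- mbox N) normc (qcoef (x k) a - c a) *
      (qweight q a * sval (qrad r0 j) ^+ mdeg a) <= 2^-1 ^+ j.
  move=> jk; apply/ler_addgt0Pr => e e0.
  pose W := \sum_(a <- (mbox N : seq M)) qweight q a * sval (qrad r0 j) ^+ mdeg a.
  have W0 : 0 <= W by apply: sumr_ge0 => a _; exact/ltW/qweight_exp_gt0.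
  have eW : 0 < e / (W + 1) by rewrite divr_gt0// ltr_wpDl.
  have : \forall m \near \oo, forall a, a \in mbox N ->
      normc (qcoef (x m) a - c a) < e / (W + 1).
    elim: (mbox N : seq M) => [|b s IH]; first by near=> m.
    have /(@cvgCP R nat \oo _ _ (c b))/(_ _ eW) Hb := cP b.
    apply: filterS (filterI Hb IH) => m [Hbm Hsm] a.
    by rewrite inE => /orP[/eqP ->//|]; exact: Hsm.
  move=> [m0 _ Hm]; pose m := maxn m0 j.
  have cm a : a \in mbox N -> normc (qcoef (x m) a - c a) < e / (W + 1).
    by apply: Hm; rewrite /= leq_maxl.
  apply: (@le_trans _ _ (\sum_(a <- mbox N) (qterm (sval (qrad r0 j)) (x k - x m) a +
      e / (W + 1) * (qweight q a * sval (qrad r0 j) ^+ mdeg a)))).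
    rewrite big_seq [leRHS]big_seq; apply: ler_sum => a aN.
    rewrite qtermE -mulrDl; apply: ler_wpM2r; first exact/ltW/qweight_exp_gt0.
    rewrite -[X in normc X + _]/(qcoef (x k) a - qcoef (x m) a).
    have := ler_normcD (qcoef (x k) a - qcoef (x m) a) (qcoef (x m) a - c a).
    by rewrite addrA subrK; have := cm a aN; lra.
  rewrite big_split/= -mulr_sumr -/W; apply: lerD.
    apply: le_trans (le_box_qnorm (qrad r0 j) (x k - x m) N) _.
    by apply/ltW/xx => //; rewrite leq_maxr.
  by rewrite mulrAC ler_pdivrMr ?ltr_wpDl// ler_pM2l// lerDl.
have [f fc] : exists f : Q, forall a, qcoef f a = c a.
  apply: qpolydisk_of_bound => rho; have [j rj] := qrad_cofinal r0 rho.
  exists (2^-1 ^+ j + qnorm (qrad r0 j) (x j)) => N.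
  apply: le_trans (lerD (lim_box j j N (leqnn _)) (le_box_qnorm _ _ N)).
  rewrite -big_split/=; apply: ler_sum => a _; rewrite !qtermE -mulrDl.
  apply: ler_pM; [exact: normc_ge0|exact/ltW/qweight_exp_gt0| | ].
    have := ler_normcD (c a - qcoef (x j) a) (qcoef (x j) a).
    by rewrite subrK normcB; exact.
  apply: ler_wpM2l; first exact: qweight_ge0.
  by apply: lerXn2r => //; rewrite nnegrE ltW// qradius_gt0.
exists f; apply/(cvg_seminormP (@qtopology R n q r)) => rho e e0.
have [j rj] := qrad_cofinal r0 rho.
have [k ke] := small _ (divr_gt0 e0 (ltr0Sn R 1)).
pose i := maxn j k.
have ik : 2^-1 ^+ i <= 2^-1 ^+ k :> R.
  by apply: ler_wiXn2l; rewrite ?leq_maxr ?invf_le1 ?ler1n.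
apply: filterS (XP i).1 => y Xy /=.
have ri : sval rho <= sval (qrad r0 i).
  by apply: le_trans rj _; apply: qrad_le; rewrite leq_maxl.
have H1 : qnorm (qrad r0 i) (y - x i) < 2^-1 ^+ i by apply: (XP i).2 => //; exact: xP.
have H2 : qnorm (qrad r0 i) (x i - f) <= 2^-1 ^+ i.
  apply: qnorm_le_box => N; apply: le_trans (lim_box i i N (leqnn _)).
  apply: ler_sum => a _; rewrite qtermE.
  by rewrite -fc.
apply: le_lt_trans (qnorm_homo _ ri) _.
have -> : y - f = (y - x i) + (x i - f) by rewrite addrA subrK.
by apply: le_lt_trans (qnormD _ _ _) _; lra.
Unshelve. all: by end_near. Qed.

Lemma qpolydisk_arens_michael : arens_michael Q.
Proof.
split; [|exact: qhausdorff|exact: qcomplete].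
exists (qradius r), (@qnorm R n q r); split; last exact: qtopology.
by move=> rho; split; [exact: qseminorm|exact: qsubmultiplicative].
Qed.

Lemma qtopology_qrad : @topology_defined_by R Q nat (fun k => qnorm (qrad r0 k)).
Proof.
move=> f; apply/seteqP; split=> U.
  move=> [J [e [finJ e0 JU]]].
  have [k kJ] : exists k, forall rho, J rho -> sval rho <= sval (qrad r0 k).
    case: finJ => m; elim: m J {JU} => [|m IH] J.
      by rewrite II0 card_eq0 => /eqP ->; exists 0%N.
    move=> /eq_cardSP[rho Jrho Jm]; have [k HK] := IH _ Jm.
    have [j Hj] := qrad_cofinal r0 rho; exists (maxn k j) => sigma Js.
    have [->|sr] := pselect (sigma = rho).
      by apply: le_trans Hj _; apply: qrad_le; rewrite leq_maxr.
    by apply: le_trans (HK _ _) _; [split|apply: qrad_le; rewrite leq_maxl].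
  exists [set k], e; split=> // g /= H; apply: JU => rho /kJ rk.
  by apply: le_lt_trans (qnorm_homo _ rk) _; exact: H.
move=> [J [e [finJ e0 JU]]].
exists (qrad r0 @` J), e; split=> //; first exact: finite_image.
by move=> g /= H; apply: JU => k Jk; apply: H; exists k.
Qed.

Lemma qpolydisk_frechet : frechet_arens_michael Q.
Proof.
split; first exact: qpolydisk_arens_michael.
exists (fun k => qnorm (qrad r0 k)); split; last exact: qtopology_qrad.
by move=> k; exact: qseminorm.
Qed.

End QuantumFrechet.

(** * Ordered monomials *)

Section OrderedMonomials.
Variables (R : realType) (n : nat) (q : R[i]).
Local Notation M := {ffun 'I_n -> nat}.
Implicit Types (a b : M).

(** The order of the variables depends on |q| in such a way that the monomials
    written in this order have norm exactly rho ^ |a|; the weight [qweight] is the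
    cost of rewriting x_1^a_1 ... x_n^a_n in it. *)
Definition ord_seq : seq 'I_n :=
  if 1 <= normc q then enum 'I_n else rev (enum 'I_n).

Definition omon (A : nzRingType) (z : 'I_n -> A) a : A :=
  \prod_(i <- ord_seq) z i ^+ a i.

(** The coefficient of x_1^a_1 ... x_n^a_n in the ordered monomial. *)
Definition kap a : R[i] := if 1 <= normc q then 1 else q^-1 ^+ mcross a a.

Lemma mem_ord_seq i : i \in ord_seq.
Proof. by rewrite /ord_seq; case: ifP => _; rewrite ?mem_rev mem_enum. Qed.

Lemma uniq_ord_seq : uniq ord_seq.
Proof. by rewrite /ord_seq; case: ifP => _; rewrite ?rev_uniq enum_uniq. Qed.

Lemma perm_ord_seq : perm_eq ord_seq (enum 'I_n).
Proof.
apply: uniq_perm; rewrite ?uniq_ord_seq ?enum_uniq// => i.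
by rewrite mem_ord_seq mem_enum.
Qed.

Lemma mulrn_ffunE b k l : (b *+ k) l = (k * b l)%N.
Proof.
elim: k => [|k IH]; first by rewrite mulr0n ffunE.
by rewrite mulrS ffunE IH mulSn.
Qed.

Lemma sum_munit a : \sum_(i <- ord_seq) munit i *+ a i = a.
Proof.
rewrite (perm_big _ perm_ord_seq) big_enum /=; apply/ffunP => k.
rewrite sum_ffunE (bigD1 k)//= big1 => [|i ik].
  by rewrite addr0 mulrn_ffunE ffunE eqxx muln1.
by rewrite mulrn_ffunE ffunE eq_sym (negPf ik) muln0.
Qed.

Lemma qgenX (i : 'I_n) k : qgen q i ^+ k = qmonomial q (munit i *+ k).
Proof.
have E (b c : M) : mcross c b = 0%N ->
    qmonomial q b * qmonomial q c = qmonomial q (b + c).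
  move=> bc; transitivity (qtwist q b c *: qmonomial q (b + c)).
    exact: qmonomial_mul.
  by rewrite /qtwist bc expr0 scale1r.
elim: k => [|k IH]; first by rewrite expr0 mulr0n.
rewrite exprS IH E ?mulrS// -{2}[munit i]mulr1n mcrossMn mcross_munit.
by rewrite ltnn muln0.
Qed.

Lemma prod_qgen_decreasing (s : seq 'I_n) a : sorted (fun i j : 'I_n => j < i)%N s ->
  let b := \sum_(i <- s) munit i *+ a i in
  \prod_(i <- s) qgen q i ^+ a i = q^-1 ^+ mcross b b *: qmonomial q b.
Proof.
elim: s => [|j s IH] /=.
  by rewrite !big_nil mcross0l expr0 scale1r.
move=> js; rewrite !big_cons IH ?(path_sorted js)// qgenX -scalerAr.
set u := munit j *+ a j; set b := \sum_(i <- s) _.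
transitivity (q^-1 ^+ mcross b b *: (qtwist q u b *: qmonomial q (u + b))).
  by congr (_ *: _); exact: qmonomial_mul.
rewrite scalerA /qtwist -exprD; congr (_ ^+ _ *: _).
have ub : mcross u b = 0%N.
  have : all (fun i : 'I_n => i < j)%N s.
    by apply: order_path_min js => x y z xy yz; exact: ltn_trans xy.
  rewrite /b; elim: s {IH js b} => [|i s IH] /=; first by rewrite big_nil mcross0r.
  move=> /andP[ij /IH E0]; rewrite big_cons mcrossDr E0 addn0 mcrossMn.
  by rewrite mcross_munit ltnNge (ltnW ij) muln0.
have uu : mcross u u = 0%N by rewrite mcrossMn mcross_munit ltnn muln0.
by rewrite mcrossDl !mcrossDr uu ub !add0n addnC.
Qed.

Lemma omon_qgen a : omon (qgen q) a = kap a *: qmonomial q a.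
Proof.
rewrite /omon /kap /ord_seq; case: ifP => q1.
  by rewrite scale1r qmonomialE enumT [index_enum _]unlock.
have S : sorted (fun i j : 'I_n => j < i)%N (rev (enum 'I_n)).
  rewrite rev_sorted -(@sorted_map _ _ val ltn) val_enum_ord.
  exact: iota_ltn_sorted.
rewrite (prod_qgen_decreasing a S).
by have := sum_munit a; rewrite /ord_seq q1 => ->.
Qed.

Hypothesis q0 : q != 0.

Lemma kap_neq0 a : kap a != 0.
Proof. by rewrite /kap; case: ifP => _; rewrite ?oner_neq0// expf_neq0// invr_eq0. Qed.

Lemma normc_kap_inv a : normc (kap a)^-1 = qweight q a.
Proof.
rewrite normcV /kap /qweight; case: ifP => _; first by rewrite normc1 invr1.
by rewrite normcX normcV exprVn invrK.
Qed.

Variable r : R.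
Local Notation Q := (qpolydisk n q r).

Lemma qgen_in i : exists x : Q, qpolydisk_series x = qgen q i.
Proof.
have [x xE] : exists f : Q, forall a, qcoef f a = qgen q i a.
  apply: qpolydisk_of_bound => rho; exists (qterm (sval rho) (qgen q i) (munit i)) => N.
  have rho0 := ltW (qradius_gt0 rho).
  have T0 a : a != munit i -> qterm (sval rho) (qgen q i) a = 0.
    move=> ai; rewrite /qterm (_ : qgen q i a = 0) ?normc0 ?mul0r//.
    by rewrite /qgen /qmonomial eq_sym (negPf ai).
  have [iN|iN] := boolP (munit i \in (mbox N : seq M)).
    by rewrite (bigD1_seq (munit i)) ?mbox_uniq//= big1 ?addr0// => a; exact: T0.
  rewrite big_seq big1 ?qterm_ge0// => a aN; apply: T0.
  by apply: contraNneq iN => <-.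
by exists x; apply/funext => a; exact: xE.
Qed.

Definition qx i : Q := projT1 (cid (qgen_in i)).

Lemma qxE i : qpolydisk_series (qx i) = qgen q i.
Proof. exact: (projT2 (cid (qgen_in i))). Qed.

Lemma qcoef_omon a b : qcoef (omon qx a) b = kap a * (a == b)%:R.
Proof.
rewrite /qcoef (_ : qpolydisk_series (omon qx a) = omon (qgen q) a); last first.
  rewrite /omon; elim: ord_seq => [|i s IH]; first by rewrite !big_nil.
  rewrite !big_cons -IH.
  have -> : qgen q i ^+ a i = qpolydisk_series (qx i ^+ a i).
    by elim: (a i) => [//|k IHk]; rewrite !exprS IHk -qxE.
  by [].
by rewrite omon_qgen.
Qed.

Lemma qx_comm (i j : 'I_n) : (i < j)%N -> qx i * qx j = q *: (qx j * qx i).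
Proof.
move=> ij; apply: val_inj; transitivity (qgen q i * qgen q j).
  by rewrite -!qxE.
by rewrite qgen_comm// -!qxE.
Qed.

(** The expansion of [f] along ordered monomials is evaluated at arbitrary elements
    of an algebra: at the generators of the quantum polydisk it gives back [f],
    and at those of the free polydisk it gives the inverse isomorphism. *)
Definition qpartial (A : lalgType R[i]) (z : 'I_n -> A) (f : Q) N : A :=
  \sum_(a <- mbox N) (qcoef f a / kap a) *: omon z a.

Lemma qcoef_sum (I : Type) (s : seq I) (P : pred I) (F : I -> Q) b :
  qcoef (\sum_(i <- s | P i) F i) b = \sum_(i <- s | P i) qcoef (F i) b.
Proof. by elim/big_ind2 : _ => [//|x c y d <- <-|//]. Qed.

Lemma qcoef_qpartial f N b :
  qcoef (qpartial qx f N) b = if b \in mbox N then qcoef f b else 0.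
Proof.
rewrite /qpartial qcoef_sum.
under eq_bigr do rewrite qcoefZ qcoef_omon mulrA divfK ?kap_neq0//.
have [bN|bN] := boolP (b \in mbox N).
  rewrite (bigD1_seq b) ?mbox_uniq//= eqxx mulr1 big1 ?addr0// => a ab.
  by rewrite (negPf ab) mulr0.
rewrite big_seq big1// => a aN; rewrite (_ : (a == b) = false) ?mulr0//.
by apply/negbTE; apply: contraNneq bN => <-.
Qed.

Lemma sum_mbox_split (V : nmodType) (N N' : nat) (G : M -> V) : (N <= N')%N ->
  \sum_(a <- mbox N') G a =
  \sum_(a <- mbox N) G a + \sum_(a <- mbox N' | a \notin (mbox N : seq M)) G a.
Proof.
move=> NN'; rewrite (bigID (fun a => a \in (mbox N : seq M)))/=; congr (_ + _).
rewrite -big_filter; apply: perm_big.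
apply: uniq_perm => [||a]; rewrite ?filter_uniq ?mbox_uniq//.
rewrite mem_filter; case: (boolP (a \in mbox N)) => //=.
rewrite !mem_mbox => /forallP aN; apply/forallP => i.
exact: leq_trans (aN i) NN'.
Qed.

Lemma qnorm_tail (rho : qradius r) (f : Q) (e : R) : 0 < e -> exists N0, forall N N', (N0 <= N)%N ->
  \sum_(a <- mbox N' | a \notin (mbox N : seq M)) qterm (sval rho) f a <= e.
Proof.
move=> e0; have rho0 := ltW (qradius_gt0 rho).
have T0 a : 0 <= qterm (sval rho) f a by rewrite qterm_ge0.
have [N0 HN0] : exists N0, qnorm rho f - e < \sum_(a <- mbox N0) qterm (sval rho) f a.
  apply: contrapT => /forallNP H; have : qnorm rho f <= qnorm rho f - e.
    by apply: qnorm_le_box => N; rewrite leNgt; apply/negP; exact: H.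
  by lra.
exists N0 => N N' N0N; pose L := maxn N N'.
have LN : (N <= L)%N by rewrite leq_maxl.
have := le_box_qnorm rho f L; rewrite (sum_mbox_split _ LN).
have := sum_mbox_split (qterm (sval rho) f) N0N.
have := sum_mbox_split (qterm (sval rho) f) (leq_maxr N N').
have : \sum_(a <- mbox N' | a \notin (mbox N : seq M)) qterm (sval rho) f a <=
    \sum_(a <- mbox L | a \notin (mbox N : seq M)) qterm (sval rho) f a.
  rewrite big_mkcond [leRHS]big_mkcond (@sum_mbox_split _ N' L _ (leq_maxr _ _)).
  by rewrite lerDl sumr_ge0// => a _; case: ifP.
have : 0 <= \sum_(a <- mbox N | a \notin (mbox N0 : seq M)) qterm (sval rho) f a.
  by rewrite sumr_ge0.
by lra.
Qed.

Lemma cvg_qpartial (f : Q) : qpartial qx f @ \oo --> f.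
Proof.
apply/(cvg_seminormP (@qtopology R n q r)) => rho e e0.
have [N0 HN0] := qnorm_tail rho f (divr_gt0 e0 (ltr0Sn R 1)).
exists N0 => // N /= N0N.
apply: le_lt_trans (_ : e / 2 < e); last by rewrite ltr_pdivrMr// ltr_pMr// ltr1n.
apply: qnorm_le_box => N'; apply: le_trans (HN0 N N' N0N).
rewrite [leRHS]big_mkcond; apply: ler_sum => a _.
rewrite /qterm -[X in normc X]/(qcoef (qpartial qx f N) a - qcoef f a).
rewrite qcoef_qpartial; case: ifP => _ /=; last by rewrite sub0r normcN.
by rewrite subrr normc0 !mul0r.
Qed.

End OrderedMonomials.

(** * Holomorphic functions of one generator *)

Section Univariate.
Variables (R : realType) (n : nat) (q : R[i]) (r : {posnum R}).
Hypothesis q0 : q != 0.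
Local Notation M := {ffun 'I_n -> nat}.
Local Notation Q := (qpolydisk n q r%:num).
Local Notation holo := (holo_disk r).
Local Notation x_ := (@qx R n q r%:num).
Implicit Types (a : M) (i : 'I_n) (c : nat -> R[i]) (rho : qradius r%:num).

Lemma qweight_munit i k : qweight q (munit i *+ k) = 1.
Proof.
rewrite /qweight; case: ifP => // _.
by rewrite mcrossMn mcross_munit ltnn muln0 expr0.
Qed.

Lemma mdeg_munit i k : mdeg (munit i *+ k) = k.
Proof.
rewrite /mdeg (bigD1 i)//= big1 => [|j ji].
  by rewrite addn0 mulrn_ffunE ffunE eqxx muln1.
by rewrite mulrn_ffunE ffunE (negPf ji) muln0.
Qed.

(** The coefficients of sum_k c k x_i^k. *)
Definition uni_coef i c : qseries n q :=
  fun a => if a == munit i *+ a i then c (a i) else 0.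

(** Powers of a single generator have weight 1, so that the norm of
    sum_k c k x_i^k is that of the power series sum_k c k z^k. *)
Lemma sum_uni_coef rho i c N :
  \sum_(a <- mbox N) qterm (sval rho) (uni_coef i c) a =
  \sum_(k < N.+1) normc (c k) * sval rho ^+ k.
Proof.
have ui k : (munit i *+ k : M) i = k by rewrite mulrn_ffunE ffunE eqxx muln1.
pose G (k : nat) : R := normc (c k) * sval rho ^+ k.
transitivity (\sum_(a <- mbox N) \sum_(k < N.+1 | munit i *+ k == a) G k).
  rewrite big_seq [RHS]big_seq; apply: eq_bigr => a aN.
  have aiN : (a i < N.+1)%N.
    by move: aN; rewrite mem_mbox => /forallP /(_ i).
  rewrite /qterm /uni_coef; case: eqP => [E|E]; last first.
    rewrite normc0 !mul0r big1// => k /eqP ka; case: E.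
    by rewrite -ka ui.
  rewrite (bigD1 (Ordinal aiN)) /=; last by rewrite -E.
  rewrite big1 ?addr0 => [|k /andP[/eqP ka kai]]; last first.
    case/eqP: kai; apply/val_inj => /=.
    by rewrite -ka ui.
  by rewrite {2 3}E qweight_munit mdeg_munit mulr1.
rewrite (exchange_big_dep predT)//=; apply: eq_bigr => k _.
rewrite (@big_mboxD _ _ N (munit i *+ k) (fun=> G k))// mem_mbox; apply/forallP => j.
rewrite mulrn_ffunE ffunE; case: eqP => _; rewrite ?muln1 ?muln0//.
by rewrite -ltnS.
Qed.

Lemma uni_exists i c :
  (forall rho, exists K : R, forall N, \sum_(k < N) normc (c k) * sval rho ^+ k <= K) ->
  exists x : Q, qpolydisk_series x = uni_coef i c.
Proof.
move=> H; have [x xP] : exists x : Q, forall a, qcoef x a = uni_coef i c a.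
  apply: qpolydisk_of_bound => rho; have [K KP] := H rho; exists K => N.
  by rewrite sum_uni_coef.
by exists x; apply/funext.
Qed.

Lemma uni_norm_le i c (x : Q) rho (K : R) : qpolydisk_series x = uni_coef i c ->
  (forall N, \sum_(k < N) normc (c k) * sval rho ^+ k <= K) -> qnorm rho x <= K.
Proof. by move=> xE KP; apply: qnorm_le_box => N; rewrite xE sum_uni_coef. Qed.

Lemma qxX_coef i k : qpolydisk_series (x_ i ^+ k) = uni_coef i (fun j => (j == k)%:R).
Proof.
have -> : qpolydisk_series (x_ i ^+ k) = qgen q i ^+ k.
  by elim: k => [//|k IH]; rewrite !exprS -IH -(@qxE R n q r%:num i).
rewrite qgenX; apply/funext => a; rewrite /qmonomial /uni_coef.
have ui : (munit i *+ k : M) i = k by rewrite mulrn_ffunE ffunE eqxx muln1.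
have [<-|ka] := eqVneq (munit i *+ k) a; first by rewrite ui !eqxx.
case: ifPn => // /eqP E; rewrite (_ : (a i == k) = false)//.
by apply/negbTE; apply: contraNneq ka => <-; rewrite -E.
Qed.

Lemma qnorm_qxX rho i k : qnorm rho (x_ i ^+ k) <= sval rho ^+ k.
Proof.
apply: (uni_norm_le (qxX_coef i k)) => N; have p0 := ltW (qradius_gt0 rho).
have [kN|Nk] := ltnP k N.
  rewrite (bigD1 (Ordinal kN))//= eqxx normc1 mul1r big1 ?addr0// => j jk.
  by rewrite (_ : (j == k :> nat) = false) ?normc0 ?mul0r//; apply/negbTE.
rewrite big1 ?exprn_ge0// => j _; rewrite (_ : (j == k :> nat) = false) ?normc0 ?mul0r//.
by apply/negbTE; rewrite neq_ltn (leq_trans (ltn_ord j)).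
Qed.

Let mid rho : R := (sval rho + r%:num) / 2.

Let mid_itv rho : 0 < mid rho < r%:num.
Proof.
by rewrite /mid; have := qradius_gt0 rho; have := qradius_lt rho; move=> ? ?; lra.
Qed.

Let mid_ratio rho : 0 <= sval rho / mid rho < 1.
Proof.
have /andP[m0 _] := mid_itv rho; rewrite divr_ge0 ?ltW ?qradius_gt0//=.
rewrite ltr_pdivrMr// mul1r /mid; have := qradius_lt rho; lra.
Qed.

Lemma holo_coef_sum_le (f : holo) rho (B : R) N : 0 <= B ->
  (forall k, normc (holo_coef f k) * mid rho ^+ k <= B) ->
  \sum_(k < N) normc (holo_coef f k) * sval rho ^+ k <=
    B / (1 - sval rho / mid rho).
Proof.
move=> B0 HB; have /andP[m0 _] := mid_itv rho.
have := mid_ratio rho; set t := sval rho / mid rho => t01.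
have E : sval rho = mid rho * t by rewrite /t mulrCA mulfV ?mulr1// gt_eqF.
apply: (@geometric_sum_le R (fun k => normc (holo_coef f k) * sval rho ^+ k)) => //.
move=> k; rewrite E exprMn mulrA; apply: ler_wpM2r => //.
by rewrite exprn_ge0//; have /andP[] := t01.
Qed.

Lemma holo_uni_exists i (f : holo) :
  exists x : Q, qpolydisk_series x = uni_coef i (holo_coef f).
Proof.
apply: uni_exists => rho; have [B B0 HB] := holo_coef_bounded f (mid_itv rho).
exists (B / (1 - sval rho / mid rho)) => N.
by apply: holo_coef_sum_le; [exact: ltW|].
Qed.

(** The functional calculus of the generator [x_i]: the only continuous morphism
    from the functions holomorphic on the disk that sends the coordinate to it. *)
Definition holo_calc i (f : holo) : Q := projT1 (cid (holo_uni_exists i f)).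

Lemma holo_calcE i f : qpolydisk_series (holo_calc i f) = uni_coef i (holo_coef f).
Proof. exact: (projT2 (cid (holo_uni_exists i f))). Qed.

Lemma holo_calc_linear i : linear (holo_calc i).
Proof.
move=> c f g; apply: qcoef_inj => a.
have E h : qcoef (holo_calc i h) a = uni_coef i (holo_coef h) a.
  by rewrite /qcoef holo_calcE.
rewrite E (qcoefD (c *: holo_calc i f) (holo_calc i g)) (qcoefZ c (holo_calc i f)).
transitivity (c * uni_coef i (holo_coef f) a + uni_coef i (holo_coef g) a); last first.
  by congr (c * _ + _); exact/esym/E.
rewrite /uni_coef holo_coefD.
case: ifP => _; first by [].
by rewrite mulr0 addr0.
Qed.

Lemma holo_calcX i k : holo_calc i (disk_coord r ^+ k) = x_ i ^+ k.
Proof.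
have E1 := holo_calcE i (disk_coord r ^+ k).
have E2 := qxX_coef i k.
rewrite holo_coef_coordX in E1.
apply: val_inj.
exact: etrans E1 (esym E2).
Qed.

Lemma holo_calc_continuous i : continuous (holo_calc i).
Proof.
move=> f; apply/(@cvg_seminormP _ _ _ _ (@qtopology R n q r%:num) _ (nbhs f) _ _
  (nbhs_filter f)) => rho e e0.
have /andP[m0 mr] := mid_itv rho; have /andP[t0 t1] := mid_ratio rho.
set t := sval rho / mid rho in t0 t1.
have t1' : 0 < 1 - t by rewrite subr_gt0.
(* The Cauchy estimate costs a factor 2 and the geometric series 1 / (1 - t). *)
pose d := e * (1 - t) / 4.
have d0 : 0 < d by rewrite divr_gt0// mulr_gt0.
apply/holo_nbhsP; exists (mid rho), d; split; [exact: mid_itv|exact: d0|].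
move=> g gf /=.
have lf := holo_calc_linear i.
have -> : holo_calc i g - holo_calc i f = holo_calc i (-1 *: f + g).
  by rewrite lf scaleN1r addrC.
apply: (@le_lt_trans _ _ (2 * d / (1 - t))).
  apply: (uni_norm_le (holo_calcE i _)) => N; apply: holo_coef_sum_le.
    by rewrite mulr_ge0// ltW.
  move=> k; apply: holo_coef_le; first by rewrite m0.
  move=> z zm; have -> : (-1 *: f + g) z = g z - f z.
    by rewrite addrC -[(g + -1 *: f) z]/(g z + -1 * f z) mulN1r.
  by apply/ltW/gf; rewrite zm.
by rewrite /d ltr_pdivrMr//; have := mulr_gt0 e0 t1'; lra.
Qed.

Lemma continuous_holo_mul (g : holo) : continuous (fun f : holo => f * g).
Proof.
move=> f U /holo_nbhsP[rho [e [/andP[rho0 rr] e0 BU]]].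
have [B B0 gB] : exists2 B : R, 0 < B & forall z : disk r, normc (\val z) <= rho ->
    normc (g z) <= B.
  pose s := (rho + r%:num) / 2.
  have rs : rho < s by rewrite /s; lra.
  have s0 : 0 < s by exact: lt_trans rs.
  have [|B B0 HB] := @holo_coef_bounded R r g s; first by rewrite s0/= /s; lra.
  exists (B * (1 - rho / s)^-1).
    by rewrite divr_gt0// subr_gt0 ltr_pdivrMr// mul1r.
  (* The error of the Taylor polynomial of index 0 is g up to sign. *)
  move=> z zr; have := taylor_poly_tail 0 rho0 rs HB zr.
  by rewrite taylor_polyE big_ord0 sub0r normcN mulr1.
apply/holo_nbhsP; exists rho, (e / B); split; rewrite ?rho0 ?divr_gt0//.
move=> h hf; apply: BU => z zr.
have -> : (h * g) z - (f * g) z = (h z - f z) * g z.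
  by rewrite mulrBl.
rewrite normcM; apply: (@le_lt_trans _ _ (normc (h z - f z) * B)).
  by apply: ler_wpM2l; [exact: normc_ge0|exact: gB].
by rewrite -ltr_pdivlMr//; exact: hf.
Qed.

End Univariate.

Lemma linear_eq0 (K : pzRingType) (V W : lmodType K) (f : V -> W) :
  linear f -> f 0 = 0.
Proof. by move=> lf; have := lf (-1) 0 0; rewrite scaler0 addr0 scaleN1r addNr. Qed.

Lemma linear_fun_sum (K : pzRingType) (V W : lmodType K) (f : V -> W) (T : Type)
    (s : seq T) (P : pred T) (c : T -> K) (v : T -> V) : linear f ->
  f (\sum_(i <- s | P i) c i *: v i) = \sum_(i <- s | P i) c i *: f (v i).
Proof.
move=> lf; elim: s => [|i s IH]; first by rewrite !big_nil linear_eq0.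
by rewrite !big_cons; case: ifP => _; rewrite // lf IH.
Qed.

Section HoloExt.
Variables (R : realType) (r : {posnum R}).
Local Notation holo := (holo_disk r).

Lemma holo_ext (A : preTopAlgType R[i]) (f g : holo -> A) : hausdorff_space A ->
  linear f -> linear g -> continuous f -> continuous g ->
  (forall k, f (disk_coord r ^+ k) = g (disk_coord r ^+ k)) -> f = g.
Proof.
move=> hA lf lg cf cg fg; apply/funext => h.
have Hf : (fun N => f (taylor_poly h N)) @ \oo --> f h.
  by apply: (@cvg_comp _ _ _ (taylor_poly h) f \oo (nbhs h)); [exact: cvg_taylor_poly|exact: cf].
have Hg : (fun N => g (taylor_poly h N)) @ \oo --> g h.
  by apply: (@cvg_comp _ _ _ (taylor_poly h) g \oo (nbhs h)); [exact: cvg_taylor_poly|exact: cg].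
apply: (cvg_unique hA Hf); rewrite (_ : (fun N => _) = (fun N => g (taylor_poly h N)))//.
apply/funext => N; rewrite /taylor_poly (linear_fun_sum _ _ _ _ lf) (linear_fun_sum _ _ _ _ lg).
by apply: eq_bigr => k _; rewrite fg.
Qed.

Lemma holo_mulC (f g : holo) : f * g = g * f.
Proof. by apply/val_inj/funext => z; exact: mulrC. Qed.

Variables (n : nat) (q : R[i]).
Hypothesis q0 : q != 0.
Local Notation Q := (qpolydisk n q r%:num).

Lemma qcontinuous_mulr (c : Q) : continuous (fun x : Q => x * c).
Proof.
move=> x; apply: (@cvg_seminormMr _ _ _ _ (@qseminorm R n q r%:num)
  (@qsubmultiplicative R n q r%:num) (@qtopology R n q r%:num) _ (nbhs x)
  (nbhs_filter x)).
exact: cvg_id.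
Qed.

Lemma qcontinuous_mull (c : Q) : continuous (fun x : Q => c * x).
Proof.
move=> x; apply: (@cvg_seminormMl _ _ _ _ (@qseminorm R n q r%:num)
  (@qsubmultiplicative R n q r%:num) (@qtopology R n q r%:num) _ (nbhs x)
  (nbhs_filter x)).
exact: cvg_id.
Qed.

(** Multiplicativity holds on powers of the coordinate and extends by density,
    one factor at a time. *)
Lemma holo_calcM (i : 'I_n) (f g : holo) :
  @holo_calc R n q r i (f * g) = holo_calc q i f * holo_calc q i g.
Proof.
set phi := @holo_calc R n q r i.
have hQ : hausdorff_space Q by exact: qhausdorff.
have lphi : linear phi by exact: holo_calc_linear.
have cphi : continuous phi by exact: holo_calc_continuous.
have lin1 (c : holo) : linear (fun h => phi (h * c)).
  by move=> a u v; rewrite mulrDl -scalerAl lphi.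
have lin2 (c : Q) : linear (fun h => phi h * c).
  by move=> a u v; rewrite lphi mulrDl -scalerAl.
have lin3 (c : Q) : linear (fun h => c * phi h).
  by move=> a u v; rewrite lphi mulrDr -scalerAr.
have c1 (c : holo) : continuous (fun h => phi (h * c)).
  move=> h; apply: (@continuous_comp _ _ _ (fun h : holo => h * c) phi).
    exact: continuous_holo_mul.
  exact: cphi.
have H1 k h : phi (h * disk_coord r ^+ k) = phi h * phi (disk_coord r ^+ k).
  suff E : (fun h => phi (h * disk_coord r ^+ k)) =
    (fun h => phi h * phi (disk_coord r ^+ k)) by exact: (congr1 (fun F => F h) E).
  apply: (holo_ext hQ (lin1 _) (lin2 _) (@c1 _)) => [u|j].
    apply: (@continuous_comp _ _ _ phi (fun x : Q => x * phi (disk_coord r ^+ k))).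
      exact: cphi.
    exact: qcontinuous_mulr.
  by rewrite -exprD /phi !holo_calcX exprD.
suff E : (fun h => phi (h * f)) = (fun h => phi f * phi h).
  by rewrite holo_mulC -/phi; exact: (congr1 (fun F => F g) E).
apply: (holo_ext hQ (lin1 _) (lin3 _) (@c1 _)) => [u|k].
  apply: (@continuous_comp _ _ _ phi (fun x : Q => phi f * x)); first exact: cphi.
  exact: qcontinuous_mull.
by rewrite holo_mulC H1.
Qed.

Lemma holo_calc_hom (i : 'I_n) : continuous_hom (@holo_calc R n q r i).
Proof.
split; [exact: holo_calc_linear| |exact: holo_calc_continuous].
split=> [|f g]; last exact: holo_calcM.
by rewrite -(expr0 (disk_coord r)) holo_calcX expr0.
Qed.

End HoloExt.

(** * Closed subalgebras of an analytic free product *)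

Section ClosedSubalgebra.
Variables (R : realType) (A : preTopAlgType R[i]) (P : {pred A}).
Hypothesis subP : subalg_closed P.

(** Carrying the closure proof lets the algebra structure be inferred. *)
Definition subalg_pred of subalg_closed P : {pred A} := P.

HB.instance Definition _ :=
  GRing.isSubalgClosed.Build R[i] A (subalg_pred subP) subP.

Record subalg_of :=
  SubalgOf { subalg_val :> A; _ : subalg_val \in subalg_pred subP }.

HB.instance Definition _ := [isSub for subalg_val].
HB.instance Definition _ := [Choice of subalg_of by <:].
HB.instance Definition _ := [SubChoice_isSubAlgebra of subalg_of by <:].
HB.instance Definition _ := Topological.copy subalg_of
  (initial_topology (subalg_val : subalg_of -> A)).

Lemma subalg_val_continuous : continuous subalg_val.
Proof. exact: initial_continuous. Qed.

Lemma arens_michael_subalg : closed [set x | x \in P] -> arens_michael A ->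
  arens_michael subalg_of.
Proof.
move=> cP [[I [p [sp tp]]] hA cA].
pose s i (x : subalg_of) := p i (subalg_val x).
have ss i : seminorm (s i).
  by split=> [x y|c x]; [exact: (sp i).1.1|exact: (sp i).1.2].
have ts : topology_defined_by s.
  move=> a; apply/seteqP; split=> U.
    move=> [_ [[V oV <-] /= Va VU]].
    have : nbhs (subalg_val a) V by apply: open_nbhs_nbhs; split.
    rewrite tp => -[J [e [finJ e0 JV]]]; exists J, e; split=> // b /= H.
    by apply: VU; apply: JV => j Jj; exact: H.
  move=> [J [e [finJ e0 JU]]].
  have N : nbhs (subalg_val a) [set b | forall j, J j -> p j (b - subalg_val a) < e].
    by rewrite tp; exists J, e; split.
  have N2 : nbhs a [set b | forall j, J j -> p j (subalg_val b - subalg_val a) < e].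
    exact: (subalg_val_continuous N).
  by apply: (filterS _ N2) => b /= H; exact: JU.
split.
- exists I, s; split=> // i; split; first exact: ss.
  by move=> x y; exact: (sp i).2.
- apply/(hausdorff_seminormP ss ts) => x sx; apply: val_inj.
  exact: ((hausdorff_seminormP (fun i => (sp i).1) tp).1 hA).
- move=> G PG /(cauchy_seminormP ts PG) cG.
  have [|a Ga] := cA (subalg_val @ G) (fmap_proper_filter _ PG).
    apply/(cauchy_seminormP tp) => i e e0; have [X GX HX] := cG i e e0.
    pose Y := [set x | exists2 y, X y & x = subalg_val y].
    have GY : G [set y | Y (subalg_val y)] by apply: (filterS _ GX) => y Xy; exists y.
    exists Y; first exact: GY.
    by move=> _ _ [x Xx ->] [y Xy ->]; exact: HX.
  have aP : a \in P.
    apply: cP => U /Ga GU.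
    have [y /= Uy] := @filter_ex _ G _ (fun y => U (subalg_val y)) GU.
    by exists (subalg_val y); split=> //=; case: (y).
  exists (@SubalgOf a aP); apply/(cvg_seminormP ts) => i e e0.
  exact: ((@cvg_seminormP _ _ _ _ tp _ G subalg_val a _).1 Ga i e e0).
Qed.

End ClosedSubalgebra.

(** An analytic free product is topologically generated by its factors: the
    universal property yields a morphism from [F] to the closed subalgebra [P],
    and composing it with the inclusion gives an endomorphism of [F] that fixes
    the factors, hence the identity. *)
Lemma free_product_generated (R : realType) (I : Type) (A : I -> preTopAlgType R[i])
    (F : preTopAlgType R[i]) (iota : forall i, A i -> F) (P : set F) :
  analytic_free_product iota -> subalgebra P -> closed P ->
  (forall i a, P (iota i a)) -> forall x, P x.
Proof.
move=> [amF homi univ] [P1 PD PZ PM] cP Pi x.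
pose p : {pred F} := fun y => `[< P y >].
have pE y : (y \in p) <-> P y by split=> [/asboolP|/asboolP].
have sp : subalg_closed p.
  split; first exact/pE.
    move=> c u v /pE Pu /pE Pv; apply/pE; apply: PD => //; exact: PZ.
  by move=> u v /pE Pu /pE Pv; apply/pE; exact: PM.
pose S : preTopAlgType R[i] := subalg_of sp.
have ep : [set y | y \in p] = P by apply/seteqP; split=> y /pE.
have amS : arens_michael S by apply: arens_michael_subalg => //; rewrite ep.
pose io i (a : A i) : S := @SubalgOf _ _ p sp _ ((pE _).2 (Pi i a)).
have hio i : continuous_hom (@io i).
  have [li mi ci] := homi i; split.
  - by move=> c u v; apply: val_inj; exact: li.
  - by split=> [|u v]; apply: val_inj; [exact: mi.1|exact: mi.2].
  - move=> a U [_ [[V oV <-] /= Va VU]].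
    have NV : nbhs (iota i a) V by apply: open_nbhs_nbhs; split.
    have N2 : nbhs a [set b | V (iota i b)] by exact: (ci a _ NV).
    by apply: (filterS _ N2) => b Vb; apply: VU.
have [g [[[lg mg cg] gio] _]] := univ S io amS hio.
have [e [_ uniq]] := univ F iota amF homi.
have E1 : e = id.
  apply: uniq; split; last by [].
  by split; [move=> c u v| |move=> u; exact: cvg_id].
have E2 : e = (fun y => subalg_val (g y)).
  apply: uniq; split; last by move=> i a; rewrite gio.
  split.
  - by move=> c u v; rewrite lg.
  - by split=> [|u v]; rewrite ?mg.1 ?mg.2.
  - move=> y; apply: (@continuous_comp _ _ _ g (@subalg_val _ _ p sp)); first exact: cg.
    exact: subalg_val_continuous.
by have := congr1 (fun h => h x) (etrans (esym E1) E2) => /= ->; apply/pE; case: (g x).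
Qed.

(** * Rewriting monomials modulo the commutation relations *)

Section Straightening.
Variables (R : realType) (n : nat) (q : R[i]).
Hypothesis q0 : q != 0.
Local Notation M := {ffun 'I_n -> nat}.

Definition swap_coef (i j : 'I_n) : R[i] := if (i < j)%N then q else q^-1.

(** The factor collected by the letter [i] on its way to its place in the ordered
    word, from left to right through [s]. *)
Fixpoint insert_coef (s : seq 'I_n) (i : 'I_n) (a : M) : R[i] :=
  if s is j :: s' then
    if j == i then 1 else swap_coef i j ^+ a j * insert_coef s' i a
  else 1.

Variables (A : preTopAlgType R[i]) (J : set A) (z : 'I_n -> A).
Hypothesis idJ : two_sided_ideal J.
Hypothesis relJ : forall i j : 'I_n, (i < j)%N -> J (z i * z j - q *: (z j * z i)).

Let cong x y := J (x - y).

Let cong_refl x : cong x x.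
Proof. by rewrite /cong subrr; case: idJ. Qed.

Let cong_trans y x w : cong x y -> cong y w -> cong x w.
Proof.
have [_ JD _ _] := idJ; move=> /JD H /H.
by rewrite /cong addrA subrK.
Qed.

Let congMl c x y : cong x y -> cong (c * x) (c * y).
Proof. by have [_ _ Jl _] := idJ; rewrite /cong -mulrBr; exact: Jl. Qed.

Let congMr c x y : cong x y -> cong (x * c) (y * c).
Proof. by have [_ _ _ Jr] := idJ; rewrite /cong -mulrBl; exact: Jr. Qed.

Let congZ c x y : cong x y -> cong (c *: x) (c *: y).
Proof.
by move=> /(congMl (c *: 1)); rewrite -!scalerAl !mul1r.
Qed.

Let cong_swap i j : i != j -> cong (z i * z j) (swap_coef i j *: (z j * z i)).
Proof.
rewrite /swap_coef neq_ltn; case: ltnP => [ij _|_ /= ji]; first exact: relJ.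
have [_ _ Jl _] := idJ; have := Jl (- q^-1 *: 1) _ (relJ ji).
rewrite -scalerAl mul1r scalerBr scalerA mulNr mulVf// scaleN1r opprK addrC.
by rewrite scaleNr.
Qed.

Let cong_swapX i j k : i != j ->
  cong (z i * z j ^+ k) (swap_coef i j ^+ k *: (z j ^+ k * z i)).
Proof.
move=> ij; elim: k => [|k IH]; first by rewrite !expr0 mulr1 mul1r scale1r; exact: cong_refl.
rewrite exprSr mulrA; apply: cong_trans (congMr _ IH) _.
rewrite -scalerAl -(mulrA (z j ^+ k) (z i)).
apply: cong_trans (congZ (swap_coef i j ^+ k) (congMl (z j ^+ k) (cong_swap ij))) _.
by rewrite -scalerAr mulrA scalerA -(exprSr (swap_coef i j)); exact: cong_refl.
Qed.

Lemma straighten_seq (s : seq 'I_n) i (a : M) : uniq s -> i \in s ->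
  cong (z i * \prod_(j <- s) z j ^+ a j)
       (insert_coef s i a *: \prod_(j <- s) z j ^+ (a + munit i)%R j).
Proof.
have aE k : (a + munit i)%R k = (a k + (k == i))%N by rewrite !ffunE.
elim: s => [//|j s IH] /= /andP[js us]; rewrite inE !big_cons aE (eq_sym j i).
have [ij|ij] := eqVneq i j => /=.
  move=> _; rewrite scale1r ij mulrA -exprS addn1.
  rewrite [X in cong _ (_ * X)](eq_big_seq (fun k => z k ^+ a k)).
    exact: cong_refl.
  move=> k ks; rewrite -ij aE ij; case: eqP => [kj|_]; last by rewrite addn0.
  by rewrite -kj ks in js.
move=> iss; rewrite addn0.
rewrite mulrA; apply: cong_trans (congMr _ (cong_swapX _ ij)) _.
rewrite -scalerAl -mulrA -scalerA; apply: congZ.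
rewrite scalerAr; apply: congMl; exact: IH.
Qed.

(** The coefficient only depends on [i] and [a]: the same formula computes in the
    quantum polydisk, with J = 0, and in the free polydisk modulo the relations. *)
Lemma straighten_omon i (a : M) :
  J (z i * omon q z a - insert_coef (ord_seq n q) i a *: omon q z (a + munit i)).
Proof. by apply: straighten_seq; rewrite ?uniq_ord_seq ?mem_ord_seq. Qed.

End Straightening.

(** * Ordered expansions in a complete algebra *)

Section Summation.
Variables (R : realType) (n : nat) (q : R[i]) (r : R).
Hypothesis q0 : q != 0.
Local Notation M := {ffun 'I_n -> nat}.
Local Notation Q := (qpolydisk n q r).
Variables (A : preTopAlgType R[i]) (K : Type) (p : K -> A -> R).
Hypothesis sp : forall k, seminorm (p k).
Hypothesis mp : forall k, submultiplicative (p k).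
Hypothesis tp : topology_defined_by p.
Hypothesis hA : hausdorff_space A.
Hypothesis cA : complete_space A.
Variable z : 'I_n -> A.
Hypothesis growth : forall k, exists rho : qradius r, exists2 C : R, 0 <= C &
  forall i m, p k (z i ^+ m) <= C * sval rho ^+ m.

Lemma omon_growth k : exists rho : qradius r, exists2 D : R, 0 <= D &
  forall a, p k (omon q z a) <= D * sval rho ^+ mdeg a.
Proof.
have [rho [C C0 zC]] := growth k; exists rho; exists (p k 1 * C ^+ size (ord_seq n q)).
  by rewrite mulr_ge0 ?exprn_ge0 ?(seminorm_ge0 sp).
move=> a; have -> : mdeg a = (\sum_(i <- ord_seq n q) a i)%N.
  by rewrite (perm_big _ (perm_ord_seq n q)) big_enum.
rewrite /omon; elim: (ord_seq n q) => [|i s IH].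
  by rewrite !big_nil !expr0 !mulr1.
rewrite !big_cons /=; apply: le_trans (mp _ _ _) _.
apply: le_trans (ler_pM (seminorm_ge0 sp _ _) (seminorm_ge0 sp _ _) (zC i (a i)) IH) _.
by rewrite exprS exprD; apply: le_of_eq; ring.
Qed.

Let term_le k (rho : qradius r) D (f : Q) a :
  (forall a, p k (omon q z a) <= D * sval rho ^+ mdeg a) ->
  p k ((qcoef f a / kap q a) *: omon q z a) <= D * qterm (sval rho) f a.
Proof.
move=> HD; rewrite (seminormZ sp) normcM normc_kap_inv /qterm.
rewrite -[X in _ <= _ * (normc X * _ * _)]/(qcoef f a).
apply: le_trans (ler_wpM2l _ (HD a)) _.
  by rewrite mulr_ge0 ?normc_ge0 ?qweight_ge0.
by apply: le_of_eq; ring.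
Qed.

Lemma cvg_qpartial_ex (f : Q) : exists x : A, qpartial z f @ \oo --> x.
Proof.
apply: (complete_cauchy_seq tp cA) => k e e0.
have [rho [D D0 HD]] := omon_growth k.
have D1 : 0 < D + 1 by rewrite ltr_wpDl.
have d0 : 0 < e / (D + 1) / 2 by rewrite !divr_gt0.
have [N0 HN0] := qnorm_tail rho f d0; exists N0.
suff H N N' : (N0 <= N)%N -> (N <= N')%N -> p k (qpartial z f N' - qpartial z f N) < e.
  move=> m j mN jN; have [mj|/ltnW jm] := leqP m j.
    by rewrite (seminormB sp); exact: H.
  exact: H.
move=> N0N NN'.
have -> : qpartial z f N' - qpartial z f N =
    \sum_(a <- mbox N' | a \notin (mbox N : seq M)) (qcoef f a / kap q a) *: omon q z a.
  by rewrite /qpartial (sum_mbox_split _ NN') addrAC subrr add0r.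
apply: le_lt_trans (seminorm_sum sp _ _ _ _) _.
apply: (@le_lt_trans _ _ (D * (e / (D + 1) / 2))).
  apply: le_trans (_ : D * \sum_(a <- mbox N' | a \notin (mbox N : seq M))
      qterm (sval rho) f a <= _); last by apply: ler_wpM2l => //; exact: HN0.
  by rewrite mulr_sumr; apply: ler_sum => a _; exact: term_le.
have -> : D * (e / (D + 1) / 2) = e * (D / (D + 1) / 2) by ring.
rewrite gtr_pMr// ltr_pdivrMr// mul1r ltr_pdivrMr//; move: D0; lra.
Qed.

Definition qsum (f : Q) : A := projT1 (cid (cvg_qpartial_ex f)).

Lemma cvg_qsum (f : Q) : qpartial z f @ \oo --> qsum f.
Proof. exact: (projT2 (cid (cvg_qpartial_ex f))). Qed.

Lemma qsum_linear : linear qsum.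
Proof.
move=> c f g; apply: (cvg_unique hA (@cvg_qsum _)).
rewrite (_ : qpartial z (c *: f + g) = (fun N => c *: qpartial z f N + qpartial z g N)).
  apply: (cvg_seminormD sp tp); last exact: cvg_qsum.
  by apply: (cvg_seminormZ sp mp tp); exact: cvg_qsum.
apply/funext => N; rewrite /qpartial scaler_sumr -big_split; apply: eq_bigr => a _.
rewrite (qcoefD (c *: f)) qcoefZ [RHS]/= scalerA -scalerDl; congr (_ *: _).
by rewrite mulrDl mulrA.
Qed.

(** The terms of the expansion satisfy p k (term) <= D * (term of the norm of
    radius rho), so that p k (qsum f) <= D * |f|_rho. *)
Lemma qsum_continuous : continuous qsum.
Proof.
apply: (continuous_seminormP (@qseminorm R n q r) (@qtopology R n q r) sp tp qsum_linear).
move=> k; have [rho [D D0 HD]] := omon_growth k; exists rho, D => f.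
have B N : p k (qpartial z f N) <= D * qnorm rho f.
  apply: le_trans (seminorm_sum sp _ _ _ _) _.
  apply: le_trans (_ : D * \sum_(a <- mbox N) qterm (sval rho) f a <= _).
    by rewrite mulr_sumr; apply: ler_sum => a _; exact: term_le.
  by apply: ler_wpM2l => //; exact: le_box_qnorm.
apply/ler_addgt0Pr => e e0.
have [N _ HN] := (@cvg_seminormP _ _ _ _ tp nat \oo _ _ _).1 (@cvg_qsum f) k e e0.
have := HN N (leqnn N); rewrite /= (seminormB sp).
have := seminormD sp k (qsum f - qpartial z f N) (qpartial z f N); rewrite subrK.
by have := B N; lra.
Qed.

Lemma qsum_omon a : qsum (omon q (@qx R n q r) a) = omon q z a.
Proof.
apply: (cvg_unique hA (@cvg_qsum _)).
apply/(cvg_seminormP tp) => k e e0; exists (mdeg a) => // N /= aN.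
have aI : a \in (mbox N : seq M).
  have := mem_mbox_mdeg a; rewrite !mem_mbox => /forallP H; apply/forallP => i.
  exact: leq_trans (H i) aN.
rewrite /qpartial (bigD1_seq a) ?mbox_uniq//= big1 => [|b ba].
  rewrite qcoef_omon// eqxx mulr1 mulfV ?kap_neq0// scale1r addr0 subrr.
  by rewrite (seminorm0 sp).
by rewrite qcoef_omon// eq_sym (negPf ba) mulr0 mul0r scale0r.
Qed.

End Summation.

(** * The quantum polydisk as a quotient of the free polydisk *)

Section Isomorphism.
Variables (R : realType) (n : nat) (r : {posnum R}) (q : R[i]).
Hypothesis q0 : q != 0.
Variables (F : preTopAlgType R[i]) (iota : 'I_n -> holo_disk r -> F).
Hypothesis univF : free_polydisk iota.
Local Notation M := {ffun 'I_n -> nat}.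
Local Notation Q := (qpolydisk n q r%:num).
Let zeta i := iota i (disk_coord r).
Let S := q_relations q zeta.
Let J := closed_ideal_gen S.
Let r0 : 0 < r%:num. Proof. by []. Qed.

Let homi i : continuous_hom (iota i).
Proof. by have [_ + _] := univF. Qed.

Let iotaX i m : iota i (disk_coord r ^+ m) = zeta i ^+ m.
Proof.
have [_ mi _] := homi i; elim: m => [|m IH]; first by rewrite !expr0 mi.1.
by rewrite !exprS mi.2 IH.
Qed.

(** By continuity of [iota i], there are rho < r and e such that p k (iota i f) < 1
    whenever |f| < e on the disk of radius rho; this is applied to the multiple
    e / (2 rho^m) of the m-th power of the coordinate. *)
Lemma generator_growth (K : Type) (p : K -> F -> R) : (forall k, seminorm (p k)) ->
  topology_defined_by p ->
  forall k, exists rho : qradius r%:num, exists2 C : R, 0 <= C &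
    forall i m, p k (zeta i ^+ m) <= C * sval rho ^+ m.
Proof.
move=> sp tp k.
have iota0 i : iota i 0 = 0 by have [li _ _] := homi i; exact: linear_eq0.
have N i : nbhs (0 : holo_disk r) [set f | p k (iota i f) < 1].
  have [_ _ ci] := homi i.
  have H : nbhs (iota i 0) [set x | p k x < 1].
    rewrite iota0 tp; exists [set k], 1; split=> // x /= /(_ k erefl).
    by rewrite subr0.
  exact: (ci 0 _ H).
have /holo_nbhsP[rho [e [rhor e0 HU]]] :
    nbhs (0 : holo_disk r) [set f | forall i, p k (iota i f) < 1].
  have := @filter_finite_bigcap _ 'I_n (nbhs (0 : holo_disk r)) setT
    (fun i => [set f | p k (iota i f) < 1]) (nbhs_filter _) (@finite_finset _ _) (fun i _ => N i).
  by apply: filterS => f H i; exact: H.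
have /andP[rho0 rr] := rhor.
exists (exist _ rho rhor), (2 / e); first by rewrite divr_ge0// ltW.
move=> i m /=; have rm : 0 < rho ^+ m by rewrite exprn_gt0.
have c0 : 0 < e / 2 / rho ^+ m by rewrite !divr_gt0.
have nc : normc ((e / 2 / rho ^+ m)%:C : R[i]) = e / 2 / rho ^+ m.
  by rewrite normcR gtr0_norm.
pose g : holo_disk r := (e / 2 / rho ^+ m)%:C *: disk_coord r ^+ m.
have g_small : holo_close 0 rho e g.
  move=> z zrho.
  have -> : g z - (0 : holo_disk r) z = (e / 2 / rho ^+ m)%:C * \val z ^+ m.
    by rewrite -disk_coordX subr0.
  rewrite normcM nc normcX.
  apply: (@le_lt_trans _ _ (e / 2)); last by rewrite ltr_pdivrMr// ltr_pMr// ltr1n.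
  have e2 : 0 < e / 2 by rewrite divr_gt0.
  rewrite mulrAC -mulrA ler_piMr ?(ltW e2)// ler_pdivrMr// mul1r.
  by apply: lerXn2r => //; rewrite nnegrE ?normc_ge0// ltW.
have := HU g g_small i; have [li _ _] := homi i.
have -> : iota i g = (e / 2 / rho ^+ m)%:C *: zeta i ^+ m.
  by rewrite /g -[_ *: _]addr0 li iota0 addr0 iotaX.
rewrite /= (seminormZ sp) nc mulrC -ltr_pdivlMr// mul1r => /ltW /le_trans; apply.
by rewrite !invfM !invrK (mulrC e^-1).
Qed.

(** The morphism [phi] induced by the functional calculi of the generators and the
    linear map [G] given by ordered expansions are inverse to each other modulo
    [J]. That [phi (G a) = a] is the convergence of ordered expansions. For
    [G (phi x) - x] in [J], one multiplies from the left by the generators, then by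
    the factors, and finally by all of the free product. *)
Lemma isomorphic_free_polydisk_quotient : isomorphic_to_closed_quotient Q S.
Proof.
have [amF _ univ] := univF.
have [[K [p [smp tp]]] hF cF] := amF.
have sp k := (smp k).1; have mp k := (smp k).2.
have growth := generator_growth sp tp.
have hQ : hausdorff_space Q by exact: qhausdorff.
have [phi [[[lphi mphi cphi] phii] _]] := univ Q (@holo_calc R n q r)
  (qpolydisk_arens_michael n r0 q0) (holo_calc_hom r q0).
have phiz i : phi (zeta i) = qx q r%:num i.
  by rewrite /zeta phii -[disk_coord r]expr1 holo_calcX expr1.
have phi0 : phi 0 = 0 by exact: linear_eq0.
have phi_omon a : phi (omon q zeta a) = omon q (@qx R n q r%:num) a.
  have phiX i m : phi (zeta i ^+ m) = qx q r%:num i ^+ m.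
    elim: m => [|m IHm]; first by rewrite !expr0; exact: mphi.1.
    by rewrite exprS (mphi.2 (zeta i)) IHm phiz -exprS.
  rewrite /omon; elim: (ord_seq n q) => [|i s IH].
    by rewrite !big_nil; exact: mphi.1.
  by rewrite !big_cons (mphi.2 (zeta i ^+ a i)) IH phiX.
pose G : Q -> F := qsum sp mp tp cF growth.
have lG : linear G by exact: qsum_linear.
have cG : continuous G by exact: qsum_continuous.
have G0 : G 0 = 0 by exact: linear_eq0.
have GZ c x : G (c *: x) = c *: G x by rewrite -[c *: x]addr0 lG G0 addr0.
have Gomon a : G (omon q (@qx R n q r%:num) a) = omon q zeta a.
  exact: qsum_omon.
have phiG a : phi (G a) = a.
  have H : (phi \o qpartial zeta a) @ \oo --> phi (G a).
    apply: (@cvg_comp _ _ _ (qpartial zeta a) phi \oo (nbhs (G a))).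
      exact: cvg_qsum.
    exact: cphi.
  have E : phi \o qpartial zeta a = qpartial (@qx R n q r%:num) a.
    apply/funext => N /=; rewrite /qpartial (linear_fun_sum _ _ _ _ lphi).
    by apply: eq_bigr => b _; rewrite phi_omon.
  rewrite E in H.
  exact: (cvg_unique hQ H (@cvg_qpartial R n q q0 r%:num a)).
have idJ : two_sided_ideal J by exact: closed_ideal_gen_ideal.
have [J0 JD JMl JMr] := idJ.
have JZ c x : J x -> J (c *: x).
  by move=> /(JMl (c *: 1)); rewrite -scalerAl mul1r.
have clJ : closed J.
  have -> : J = \bigcap_(I in [set I | (two_sided_ideal I /\ closed I) /\ S `<=` I]) I.
    by [].
  by apply: closed_bigI => I [[_ cI] _].
have relJ (i j : 'I_n) : (i < j)%N -> J (zeta i * zeta j - q *: (zeta j * zeta i)).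
  by move=> ij I [_ SI]; apply: SI; exists i, j.
have kerJ x : J x -> phi x = 0.
  move=> Jx; apply: (Jx [set y | phi y = 0]); split; last first.
    move=> _ [i [j [ij ->]]] /=.
    rewrite (_ : _ - _ = (- q) *: (zeta j * zeta i) + zeta i * zeta j); last first.
      by rewrite scaleNr addrC.
    rewrite lphi (mphi.2 (zeta j)) (mphi.2 (zeta i)) !phiz (qx_comm q0 r%:num ij).
    by rewrite scaleNr addNr.
  split.
    split=> //= [x1 y1 H1 H2|x1 y1 H1|x1 y1 H1].
    - by have := lphi 1 x1 y1; rewrite !scale1r H1 H2 addr0.
    - by rewrite (mphi.2 x1) H1 mulr0.
    - by rewrite (mphi.2 x1) H1 mul0r.
  rewrite -[X in closed X]/(phi @^-1` [set 0]).
  apply: closed_comp; first by move=> y _; exact: cphi.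
  exact/accessible_closed_set1/hausdorff_accessible.
(* [H] is a closed subspace containing 1; it remains to see that it is a left
   submodule of [F]. *)
pose H := [set x | J (G (phi x) - x)].
have HD c x y : H x -> H y -> H (c *: x + y).
  rewrite /H /= => Hx Hy; rewrite lphi lG opprD addrACA -scalerBr.
  by apply: (JD) => //; exact: JZ.
have cvgBF (T : topologicalType) (u v : T -> F) t : {for t, continuous u} ->
    {for t, continuous v} -> {for t, continuous (fun s => u s - v s)}.
  move=> cu cv; rewrite (_ : (fun s => _) = (fun s => u s + (-1) *: v s)); last first.
    by apply/funext => s; rewrite scaleN1r.
  apply: (@cvg_seminormD _ _ _ _ sp tp _ (nbhs t) (nbhs_filter t)); first exact: cu.
  exact: (@cvg_seminormZ _ _ _ _ sp mp tp _ (nbhs t) (nbhs_filter t)).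
have cH : closed H.
  rewrite -[X in closed X]/((fun x => G (phi x) - x) @^-1` J).
  apply: closed_comp => // x _.
  apply: (@cvgBF F (fun x => G (phi x)) id x); last exact: cvg_id.
  by apply: (@continuous_comp _ _ _ phi G); [exact: cphi|exact: cG].
have Hzeta i x : H x -> H (zeta i * x).
  rewrite /H /= => Hx; rewrite mphi.2 phiz.
  rewrite -(subrK (zeta i * G (phi x)) (G (qx q r%:num i * phi x))) -addrA -mulrBr.
  apply: (JD); last exact: JMl.
  (* [G] commutes with multiplication by the i-th generator modulo [J]: this holds
     on ordered monomials by straightening in both algebras. *)
  pose T := [set y : Q | J (G (qx q r%:num i * y) - zeta i * G y)].
  suff : T (phi x) by [].
  have cT : closed T.
    rewrite -[X in closed X]/((fun y => G (qx q r%:num i * y) - zeta i * G y) @^-1` J).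
    apply: closed_comp => // y _.
    apply: (@cvgBF Q (fun y => G (qx q r%:num i * y)) (fun y => zeta i * G y) y).
      apply: (@continuous_comp _ _ _ (fun y : Q => qx q r%:num i * y) G); last exact: cG.
      exact: qcontinuous_mull.
    apply: (@cvg_seminormMl _ _ _ _ sp mp tp _ (nbhs y) (nbhs_filter y)).
    exact: cG.
  have TD c u v : T u -> T v -> T (c *: u + v).
    rewrite /T /= => Tu Tv; rewrite mulrDr -scalerAr !lG mulrDr -scalerAr.
    by rewrite opprD addrACA -scalerBr; apply: (JD) => //; exact: JZ.
  have T0 : T 0 by rewrite /T /= mulr0 !G0 mulr0 subrr.
  have Tomon a : T (omon q (@qx R n q r%:num) a).
    rewrite /T /= Gomon.
    have idQ : two_sided_ideal [set 0 : Q].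
      split=> //= [x1 y1 -> ->|x1 y1 ->|x1 y1 ->]; by rewrite ?addr0 ?mulr0 ?mul0r.
    have relQ (k j : 'I_n) : (k < j)%N -> [set 0 : Q]
        (qx q r%:num k * qx q r%:num j - q *: (qx q r%:num j * qx q r%:num k)).
      by move=> kj /=; rewrite (qx_comm q0 r%:num kj) subrr.
    have := straighten_omon q0 idQ relQ i a => /= /eqP; rewrite subr_eq0 => /eqP ->.
    rewrite GZ Gomon.
    by have := JZ (-1) _ (straighten_omon q0 idJ relJ i a); rewrite scaleN1r opprB.
  apply: (@closed_cvg _ _ \oo _ _ T cT _ _ (@cvg_qpartial R n q q0 r%:num (phi x))).
  apply: nearW => N; rewrite /qpartial.
  elim: (mbox N : seq M) => [|b s IH]; first by rewrite big_nil.
  by rewrite big_cons; apply: TD.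
(* The elements that stabilise [H] form a closed subalgebra, so it is enough that
   they include the factors. *)
pose P := [set x | forall y, H y -> H (x * y)].
have subP : subalgebra P.
  split=> [y|x1 x2 H1 H2 y Hy|c x1 H1 y Hy|x1 x2 H1 H2 y Hy]; rewrite /P /=.
  - by rewrite mul1r.
  - by rewrite mulrDl -[x1 * y]scale1r; apply: HD; [exact: H1|exact: H2].
  - rewrite -scalerAl -[_ *: _]addr0; apply: HD; first exact: H1.
    by rewrite /H /= phi0 G0 subrr.
  - by rewrite -mulrA; apply: H1; exact: H2.
have clP : closed P.
  rewrite (_ : P = \bigcap_(y in H) ((fun x => x * y) @^-1` H)); last first.
    by apply/seteqP; split=> x.
  apply: closed_bigI => y _; apply: closed_comp => // x _.
  apply: (@cvg_seminormMr _ _ _ _ sp mp tp _ (nbhs x) (nbhs_filter x)).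
  exact: cvg_id.
have Piota i a : P (iota i a).
  have [li mi ci] := homi i.
  have C : (iota i \o taylor_poly a) @ \oo --> iota i a.
    apply: (@cvg_comp _ _ _ (taylor_poly a) (iota i) \oo (nbhs a)); last exact: ci.
    exact: cvg_taylor_poly.
  apply: (@closed_cvg _ _ \oo _ _ P clP _ _ C).
  apply: nearW => N /= y Hy; rewrite /taylor_poly (linear_fun_sum _ _ _ _ li).
  rewrite mulr_suml; elim: (index_enum _) => [|k s IH].
    by rewrite big_nil /H /= phi0 G0 subrr.
  rewrite big_cons -scalerAl; apply: HD => //; rewrite iotaX.
  elim: (k : nat) => [|m IHm]; first by rewrite expr0 mul1r.
  by rewrite exprS -mulrA; exact: Hzeta.
have HT x : H x.
  have omon0 (B : nzRingType) (y : 'I_n -> B) : omon q y 0 = 1.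
    by rewrite /omon big1 => [//|k _]; rewrite ffunE expr0.
  have H1 : H 1.
    by rewrite /H /= mphi.1 -(omon0 _ (@qx R n q r%:num)) Gomon omon0 subrr.
  by rewrite -[x]mulr1; apply: (free_product_generated univF subP clP Piota).
pose f : Q -> closed_quotient S := fun a => closed_quotient_proj S (G a).
pose g : closed_quotient S -> Q := fun y => phi (repr y).
have reprK (y : closed_quotient S) : closed_quotient_proj S (repr y) = y.
  exact: reprK.
have gproj x : g (closed_quotient_proj S x) = phi x.
  have /closed_quotient_projP/kerJ := reprK (closed_quotient_proj S x).
  have := lphi (-1) x (repr (closed_quotient_proj S x)).
  rewrite scaleN1r [- x + _]addrC => -> E; apply/eqP; rewrite -subr_eq0 -E.
  by rewrite scaleN1r addrC.
have fproj x : f (phi x) = closed_quotient_proj S x.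
  by apply/closed_quotient_projP; exact: HT.
have gf y : f (g y) = y by rewrite -{2}(reprK y) -fproj.
have fg a : g (f a) = a by rewrite gproj phiG.
have [p1 pM] := closed_quotient_proj_monoid_morphism S.
have gM y1 y2 : g (y1 * y2) = g y1 * g y2.
  by rewrite -(reprK y1) -(reprK y2) -pM !gproj; exact: mphi.2.
exists f, g; split; last by split.
- by move=> c a b; rewrite /f lG; exact: closed_quotient_proj_linear.
- split=> [|a b].
    by rewrite -p1 -fproj; congr f; exact/esym/mphi.1.
  by rewrite -{1}(fg a) -{1}(fg b) -gM gf.
- move=> a; apply: (@continuous_comp _ _ _ G (closed_quotient_proj S)); first exact: cG.
  suff : continuous (closed_quotient_proj S) by exact.
  by apply/continuousP => U; rewrite closed_quotient_openE.
- apply/continuousP => U oU; rewrite closed_quotient_openE.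
  rewrite (_ : _ @^-1` _ = phi @^-1` U); first by move/continuousP: cphi; exact.
  by apply/funext => x; rewrite /preimage /= gproj.
Qed.

End Isomorphism.

(** * Entire series from sums of noncommutative polynomials *)

Section WordPolynomials.
Variables (R : realType) (m : nat) (A : preTopAlgType R[i]) (b : 'I_m -> A).
Local Notation word := (seq 'I_m).
Local Notation wpoly := (seq (R[i] * word)).
Implicit Types (l : wpoly) (M K L : R) (x y : A).

Definition weval l : A := \sum_(t <- l) t.1 *: \prod_(i <- t.2) b i.

Definition wnorm M l : R := \sum_(t <- l) normc t.1 * M ^+ size t.2.

(** The l^1 norms of free polynomials, with letters of weight [M], define the
    topology of the algebra of free entire functions; [wrep M K] is the image of a
    ball under evaluation at [b]. Representatives [l] may repeat words, which
    keeps the algebraic operations on them elementary. *)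
Definition wrep M K x : Prop := exists2 l, weval l = x & wnorm M l <= K.

Lemma wnorm_ge0 M l : 0 <= M -> 0 <= wnorm M l.
Proof.
by move=> M0; apply: sumr_ge0 => t _; rewrite mulr_ge0 ?normc_ge0 ?exprn_ge0.
Qed.

Lemma wnorm_homo M M' l : 0 <= M -> M <= M' -> wnorm M l <= wnorm M' l.
Proof.
move=> M0 MM'; apply: ler_sum => t _; apply: ler_wpM2l; first exact: normc_ge0.
by apply: lerXn2r => //; rewrite nnegrE (le_trans M0).
Qed.

Lemma wrep_le M K L x : K <= L -> wrep M K x -> wrep M L x.
Proof. by move=> KL [l lx lK]; exists l => //; exact: le_trans KL. Qed.

Lemma wrep0 M : wrep M 0 0.
Proof. by exists [::]; rewrite /weval /wnorm ?big_nil. Qed.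

Lemma wrep1 M : wrep M 1 1.
Proof.
exists [:: (1, [::])]; rewrite /weval /wnorm !big_seq1/=.
  by rewrite big_nil scale1r.
by rewrite mulr1 [X in X <= _](normc1 R).
Qed.

Lemma wrep_gen M i : wrep M M (b i).
Proof.
exists [:: (1, [:: i])]; rewrite /weval /wnorm !big_seq1/=.
  by rewrite scale1r.
by rewrite [X in X * _](normc1 R) expr1 mul1r.
Qed.

Lemma wrepD M K L x y : wrep M K x -> wrep M L y -> wrep M (K + L) (x + y).
Proof.
move=> [l <- lK] [l' <- lL]; exists (l ++ l').
  by rewrite /weval big_cat.
by rewrite /wnorm big_cat lerD.
Qed.

Lemma wrepZ M K c x : wrep M K x -> wrep M (normc c * K) (c *: x).
Proof.
move=> [l <- lK]; exists [seq (c * t.1, t.2) | t <- l].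
  by rewrite /weval big_map scaler_sumr; apply: eq_bigr => t _; rewrite scalerA.
apply: le_trans (ler_wpM2l (normc_ge0 c) lK).
rewrite /wnorm big_map mulr_sumr; apply: ler_sum => t _ /=.
by rewrite normcM mulrA.
Qed.

Lemma wrepN M K x : wrep M K x -> wrep M K (- x).
Proof. by move=> /(wrepZ (-1)); rewrite scaleN1r normcN normc1 mul1r. Qed.

Lemma wrepB M K L x y : wrep M K x -> wrep M L y -> wrep M (K + L) (x - y).
Proof. by move=> Hx /wrepN; exact: wrepD. Qed.

Lemma wrepM M K L x y : 0 <= M -> wrep M K x -> wrep M L y -> wrep M (K * L) (x * y).
Proof.
move=> M0 [l <- lK] [l' <- lL].
exists [seq (t.1 * u.1, t.2 ++ u.2) | t <- l, u <- l'].
  rewrite /weval big_allpairs_dep mulr_suml; apply: eq_bigr => t _.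
  rewrite mulr_sumr; apply: eq_bigr => u _ /=.
  by rewrite big_cat/= -scalerAl -scalerAr scalerA.
apply: le_trans (ler_pM (wnorm_ge0 _ M0) (wnorm_ge0 _ M0) lK lL).
rewrite /wnorm big_allpairs_dep mulr_suml; apply: ler_sum => t _.
rewrite mulr_sumr; apply: ler_sum => u _ /=.
by rewrite normcM size_cat exprD mulrACA.
Qed.

Lemma wrepX M K x k : 0 <= M -> wrep M K x -> wrep M (K ^+ k) (x ^+ k).
Proof.
move=> M0 Hx; elim: k => [|k IH]; first by rewrite !expr0; exact: wrep1.
by rewrite !exprS; exact: wrepM.
Qed.

Lemma wrep_sum M (T : Type) (s : seq T) (P : pred T) (K : T -> R) (x : T -> A) :
  (forall t, P t -> wrep M (K t) (x t)) ->
  wrep M (\sum_(t <- s | P t) K t) (\sum_(t <- s | P t) x t).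
Proof.
move=> H; elim: s => [|t s IH]; first by rewrite !big_nil; exact: wrep0.
by rewrite !big_cons; case: ifP => // Pt; apply: wrepD IH; exact: H.
Qed.

Definition wcoef l w : R[i] := \sum_(t <- l | t.2 == w) t.1.

Lemma weval_wcoef l (W : seq word) : uniq W -> {subset [seq t.2 | t <- l] <= W} ->
  weval l = \sum_(w <- W) wcoef l w *: \prod_(i <- w) b i.
Proof.
move=> uW lW; transitivity
  (\sum_(t <- l) \sum_(w <- W | t.2 == w) t.1 *: \prod_(i <- w) b i).
  rewrite /weval big_seq [RHS]big_seq; apply: eq_bigr => t tl.
  have tW : t.2 \in W by apply: lW; apply: map_f.
  rewrite [RHS]big_mkcond [RHS](bigD1_seq t.2)//= eqxx [X in _ + X]big1 ?addr0// => w.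
  by rewrite eq_sym => /negPf ->.
rewrite (exchange_big_dep predT)//=; apply: eq_bigr => w _.
by rewrite /wcoef scaler_suml; apply: eq_bigr => t _.
Qed.

Lemma wcoef_le_wnorm M l (W : seq word) : 0 <= M -> uniq W ->
  \sum_(w <- W) normc (wcoef l w) * M ^+ size w <= wnorm M l.
Proof.
move=> M0 uW.
apply: (@le_trans _ _ (\sum_(w <- W) \sum_(t <- l | t.2 == w) normc t.1 * M ^+ size w)).
  apply: ler_sum => w _; rewrite -mulr_suml; apply: ler_wpM2r.
    exact: exprn_ge0.
  exact: normc_sum.
rewrite (exchange_big_dep predT)//=; apply: ler_sum => t _.
have [tW|tW] := boolP (t.2 \in W).
  rewrite big_mkcond (bigD1_seq t.2)//= eqxx big1 ?addr0// => w.
  by rewrite eq_sym => /negPf ->.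
rewrite big_seq_cond big1 => [|w /andP[wW /eqP tw]]; last by rewrite tw wW in tW.
by rewrite mulr_ge0 ?normc_ge0 ?exprn_ge0.
Qed.

End WordPolynomials.

Section Assembly.
Variables (R : realType) (m : nat) (A : preTopAlgType R[i]) (b : 'I_m -> A).
Variables (I : Type) (p : I -> A -> R).
Hypothesis sp : forall i, seminorm (p i).
Hypothesis mp : forall i, submultiplicative (p i).
Hypothesis tp : topology_defined_by p.
Local Notation word := (seq 'I_m).
Variables (l : nat -> seq (R[i] * word)) (K : R) (f : A).
Hypothesis lK : forall j, wnorm j%:R (l j) <= K * 2^-1 ^+ j.
Hypothesis lf : (fun N => \sum_(j < N) weval b (l j)) @ \oo --> f.

Let C N w : R[i]^o := \sum_(j < N) wcoef (l j) w.

Let K0 : 0 <= K.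
Proof. by have := lK 0; rewrite expr0 mulr1; apply: le_trans; exact: wnorm_ge0. Qed.

(** For N >= M the norm with letters of weight M is smaller than that of index N,
    hence the coefficients of the partial sums form a Cauchy sequence for every
    weight. *)
Let tail_sum (M : R) N k (W : seq word) : 0 <= M -> M <= N%:R -> uniq W ->
  \sum_(w <- W) normc (C (N + k) w - C N w) * M ^+ size w <=
    2 * K * 2^-1 ^+ N * (1 - 2^-1 ^+ k).
Proof.
move=> M0 MN uW; elim: k => [|k IH].
  by rewrite addn0 big1 => [|w _]; rewrite ?expr0 ?subrr ?normc0 ?mul0r ?mulr0.
apply: (@le_trans _ _ (\sum_(w <- W) normc (C (N + k) w - C N w) * M ^+ size w +
    \sum_(w <- W) normc (wcoef (l (N + k)%N) w) * M ^+ size w)).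
  rewrite -big_split; apply: ler_sum => w _ /=; rewrite -mulrDl; apply: ler_wpM2r.
    exact: exprn_ge0.
  rewrite /C addnS big_ord_recr/= addrAC; exact: ler_normcD.
have H : wnorm M (l (N + k)%N) <= K * 2^-1 ^+ (N + k).
  apply: le_trans (lK _); apply: wnorm_homo => //.
  by apply: le_trans MN _; rewrite ler_nat leq_addr.
have := le_trans (wcoef_le_wnorm (l (N + k)%N) M0 uW) H.
move: IH; rewrite exprD [2^-1 ^+ k.+1]exprS.
by set a := 2^-1 ^+ N; set c := 2^-1 ^+ k; lra.
Qed.

Let coef_cvg w : exists c : R[i]^o, C^~ w @ \oo --> c.
Proof.
apply: complex_cauchy_seq => e e0.
have [N0 HN0] := geometric_small (2 * (2 * K)) (half01 R) e0; pose N := maxn N0 1; exists N.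
have N1 : (1 : R) <= N%:R by rewrite ler1n leq_maxr.
have H k : (N <= k)%N -> normc (C k w - C N w) <= 2 * K * 2^-1 ^+ N.
  move=> /subnKC <-; have := @tail_sum 1 N (k - N) [:: w] ler01 N1 isT.
  rewrite big_seq1 expr1n mulr1 => /le_trans; apply.
  by rewrite ler_piMr ?gerBl ?exprn_ge0// !mulr_ge0 ?exprn_ge0.
move=> k k' Nk Nk'; have {}HN0 : 2 * (2 * K) * 2^-1 ^+ N < e.
  by apply: HN0; exact: leq_maxl.
apply: le_lt_trans HN0; rewrite -(subrK (C N w) (C k w)) -addrA.
apply: le_trans (ler_normcD _ _) _; rewrite [X in _ + X <= _]normcB.
have := H _ Nk; have := H _ Nk'; lra.
Qed.

Let c w : R[i]^o := sval (cid (coef_cvg w)).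

Let cC w : C^~ w @ \oo --> c w.
Proof. exact: svalP (cid (coef_cvg w)). Qed.

Let tail_lim (M : R) N (W : seq word) : 0 <= M -> M <= N%:R -> uniq W ->
  \sum_(w <- W) normc (c w - C N w) * M ^+ size w <= 2 * K * 2^-1 ^+ N.
Proof.
move=> M0 MN uW; apply/ler_addgt0Pr => e e0.
pose d := e / (size W).+1%:R; have d0 : 0 < d by rewrite divr_gt0.
have H : \forall k \near \oo, forall w, [set` W] w -> normc (C k w - c w) * M ^+ size w <= d.
  apply: (@filter_finite_bigcap nat word \oo [set` W]
    (fun w => [set k | normc (C k w - c w) * M ^+ size w <= d])).
    exact: finite_seq.
  move=> w _; have M1 : 0 < M ^+ size w + 1 by rewrite ltr_wpDl ?exprn_ge0.
  have dM : 0 < d / (M ^+ size w + 1) by rewrite divr_gt0.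
  have := cC (w := w) ; rewrite (@cvgCP R nat \oo _ _ (c w)) => /(_ _ dM).
  apply: filterS => k /=; rewrite ltr_pdivlMr// => /ltW; apply: le_trans.
  by apply: ler_wpM2l; rewrite ?normc_ge0// lerDl.
have [k Nk Hk] : exists2 k, (N <= k)%N & forall w, w \in W ->
    normc (C k w - c w) * M ^+ size w <= d.
  by have [N1 _ HN1] := H; exists (maxn N N1);
    [exact: leq_maxl|exact: (HN1 (maxn N N1) (leq_maxr _ _))].
apply: (@le_trans _ _ (\sum_(w <- W) normc (C k w - C N w) * M ^+ size w +
    \sum_(w <- W) normc (C k w - c w) * M ^+ size w)).
  rewrite -big_split; apply: ler_sum => w _ /=; rewrite -mulrDl; apply: ler_wpM2r.
    exact: exprn_ge0.
  rewrite [X in _ <= _ + X]normcB.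
  have -> : c w - C N w = (C k w - C N w) + (c w - C k w).
    by rewrite [RHS]addrC addrA subrK.
  exact: ler_normcD.
apply: lerD.
  have := tail_sum (k - N) M0 MN uW; rewrite subnKC// => /le_trans; apply.
  by rewrite ler_piMr ?gerBl ?exprn_ge0// !mulr_ge0 ?exprn_ge0.
apply: (@le_trans _ _ (\sum_(w <- W) d)).
  by rewrite big_seq [leRHS]big_seq; apply: ler_sum => w; exact: Hk.
rewrite big_const_seq count_predT iter_addr_0 -mulr_natr /d mulrAC ler_pdivrMr//.
by rewrite ler_pM2l// ler_nat.
Qed.

Let C_bound (M : R) N (W : seq word) : 0 <= M -> uniq W ->
  \sum_(w <- W) normc (C N w) * M ^+ size w <= \sum_(j < N) wnorm M (l j).
Proof.
move=> M0 uW; apply: (@le_trans _ _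
  (\sum_(w <- W) \sum_(j < N) normc (wcoef (l j) w) * M ^+ size w)).
  apply: ler_sum => w _; rewrite -mulr_suml; apply: ler_wpM2r.
    exact: exprn_ge0.
  exact: normc_sum.
by rewrite exchange_big; apply: ler_sum => j _; exact: wcoef_le_wnorm.
Qed.

Let c_entire : free_entire c.
Proof.
move=> rho /ltW rho0; pose N := (Num.truncn rho).+1.
have rN : rho <= N%:R by apply/ltW; rewrite truncnS_gt.
rewrite (@le_lt_trans _ _ (2 * K * 2^-1 ^+ N + \sum_(j < N) wnorm rho (l j))%:E) ?ltry//.
apply: ge_ereal_sup => _ [X [finX _] <-].
rewrite fsbig_finite//= sumEFin lee_fin.
apply: le_trans (lerD (tail_lim rho0 rN (fset_uniq (fset_set X)))
  (C_bound N rho0 (fset_uniq (fset_set X)))).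
rewrite -big_split; apply: ler_sum => w _ /=; rewrite -mulrDl; apply: ler_wpM2r.
  exact: exprn_ge0.
have E : (c w - C N w) + C N w = c w by rewrite subrK.
by rewrite -{1}E; exact: ler_normcD.
Qed.

Let seminorm_word i (B : R) w : (forall k, p i (b k) <= B) ->
  p i (\prod_(k <- w) b k) <= p i 1 * B ^+ size w.
Proof.
move=> bB; elim: w => [|k w IH]; first by rewrite big_nil mulr1.
rewrite big_cons; apply: le_trans (mp _ _ _) _; rewrite exprS mulrCA.
by apply: ler_pM; rewrite ?(seminorm_ge0 sp).
Qed.

Let c_eval : free_eval c b f.
Proof.
apply/(@cvg_seminormP _ _ _ _ tp _ totally _ _ (@totally_filter _)) => i e e0.
pose B := \sum_k p i (b k); have B0 : 0 <= B.
  by apply: sumr_ge0 => k _; exact: seminorm_ge0.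
have bB k : p i (b k) <= B.
  rewrite /B (bigD1 k)//= lerDl; apply: sumr_ge0 => j _; exact: seminorm_ge0.
have e2 : 0 < e / 2 by rewrite divr_gt0.
have [N1 HN1] := geometric_small (2 * K * p i 1) (half01 R) e2.
move: lf; rewrite (cvg_seminormP tp) => /(_ i _ e2)[N2 _ HN2].
pose N := maxn (maxn N1 N2) (Num.truncn B).+1.
have NB : B <= N%:R.
  by apply: (@le_trans _ _ (Num.truncn B).+1%:R); [exact/ltW/truncnS_gt|rewrite ler_nat leq_maxr].
have {}HN1 : 2 * K * p i 1 * 2^-1 ^+ N < e / 2.
  by apply: HN1; rewrite /N !leq_max leqnn.
have {}HN2 : p i (\sum_(j < N) weval b (l j) - f) < e / 2.
  by apply: HN2; rewrite /= /N !leq_max leqnn orbT.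
(* On a set of words containing [W0] the first N polynomials are fully evaluated,
   and only the tail of the coefficients remains. *)
pose W0 := flatten [seq [seq t.2 | t <- l (val j)] | j <- enum 'I_N].
exists [fset w in W0]%fset => // J /= W0J.
have JW (j : 'I_N) : {subset [seq t.2 | t <- l j] <= J}.
  move=> w wj; apply: (fsubsetP W0J); rewrite !inE; apply/flattenP.
  exists [seq t.2 | t <- l j] => //.
  by apply: (map_f (fun j : 'I_N => [seq t.2 | t <- l j])); rewrite mem_enum.
rewrite (_ : partial_sum _ J = \sum_(w <- J) c w *: \prod_(k <- w) b k); last first.
  by rewrite /partial_sum [RHS]big_seq_fsetE.
have E : \sum_(j < N) weval b (l j) = \sum_(w <- J) C N w *: \prod_(k <- w) b k.
  transitivity (\sum_(j < N) \sum_(w <- J) wcoef (l j) w *: \prod_(k <- w) b k).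
    by apply: eq_bigr => j _; apply: weval_wcoef => //; exact: fset_uniq.
  rewrite exchange_big; apply: eq_bigr => w _ /=.
  by rewrite /C scaler_suml.
move: HN2; rewrite E => HN2.
rewrite -(subrK (\sum_(w <- J) C N w *: \prod_(k <- w) b k) (\sum_(w <- J) _)) -addrA.
apply: le_lt_trans (seminormD sp _ _ _) _.
rewrite [ltRHS](splitr e); apply: ler_ltD => //.
rewrite -sumrB; apply: le_trans (seminorm_sum sp _ _ _ _) _.
apply/ltW; apply: le_lt_trans HN1.
rewrite -mulrAC; apply: le_trans (ler_wpM2r (seminorm_ge0 sp i 1)
  (tail_lim B0 NB (fset_uniq J))).
rewrite mulr_suml; apply: ler_sum => w _.
rewrite -scalerBl (seminormZ sp) -mulrA; apply: ler_wpM2l; first exact: normc_ge0.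
by rewrite mulrC; exact: seminorm_word.
Qed.

(** Since the weights of the letters tend to infinity with j, the series converges
    in every l^1 norm, and can be resummed word by word into a single entire
    series. *)
Lemma holomorphically_closed_wseries (B : set A) :
  holomorphically_closed B -> (forall i, B (b i)) -> B f.
Proof. by move=> [_ HB] Bb; exact: (HB m b c f Bb c_entire c_eval). Qed.

End Assembly.

(** * Lacunary exponents and coefficients *)

Section Lacunary.
Variable R : realType.
Implicit Types t c d : R.

(** With [s] the square root of [t], Bernoulli's inequality bounds [k * s ^ k], and
    the other factor [s ^ k] tends to 0. *)
Lemma natmul_expr_small t c d : 0 < t -> t < 1 -> 0 < d ->
  exists N, forall k, (N <= k)%N -> c * k%:R * t ^+ k <= d.
Proof.
move=> t0 t1 d0; pose s := Num.sqrt t.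
have s0 : 0 < s by rewrite sqrtr_gt0.
have s1 : s < 1 by rewrite -sqrtr1 ltr_sqrt.
pose h := s^-1 - 1; have h0 : 0 < h by rewrite subr_gt0 invf_gt1.
have ks k : k%:R * s ^+ k <= h^-1.
  have B : 1 + h *+ k <= s^-1 ^+ k.
    elim: k => [|k IH]; first by rewrite mulr0n addr0 expr0.
    rewrite exprS; apply: (@le_trans _ _ (s^-1 * (1 + h *+ k))); last first.
      by rewrite ler_wpM2l// invr_ge0 ltW.
    rewrite [s^-1](_ : _ = 1 + h); last by rewrite /h addrC subrK.
    rewrite -![h *+ _]mulr_natr -natr1.
    have : 0 <= h * (h * k%:R) by rewrite !mulr_ge0// ltW.
    lra.
  have : k%:R * h <= s^-1 ^+ k by apply: le_trans B; rewrite mulr_natl lerDr.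
  move=> /(ler_wpM2r (exprn_ge0 k (ltW s0))).
  rewrite -exprMn mulVf ?gt_eqF// expr1n mulrAC => H.
  by rewrite -[h^-1]mul1r ler_pdivlMr.
have s01 : 0 <= s < 1 by rewrite ltW.
have [N HN] := geometric_small (c / h) s01 d0; exists N => k /HN /ltW H.
have [c0|c0] := leP 0 c; last first.
  apply: le_trans (ltW d0); rewrite -mulrA; apply: mulr_le0_ge0; first exact: ltW.
  by rewrite mulr_ge0// exprn_ge0// ltW.
apply: le_trans H.
rewrite -[t](sqr_sqrtr (ltW t0)) -/s -exprM mulnC exprM expr2 -!mulrA.
by apply: ler_wpM2l => //; rewrite mulrA ler_wpM2r// exprn_ge0// ltW.
Qed.

Variable rho : nat -> R.
Hypothesis rho_gt0 : forall k, 0 < rho k.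
Hypothesis rho_lt : forall k l, (k < l)%N -> rho k < rho l.

Local Notation val := ({posnum R} * nat)%type.

(** The conditions on the coefficient and exponent of index [j] of the series
    sum_j A j x^(N j), in terms of those of smaller index. The first one leaves
    room for an iteration between the radii of index 2j+2 and 2j+3. By the second
    one, A j^-1 times the earlier terms has small norm when letters weigh j. The
    third one bounds the Lipschitz constant of the new term relative to that of
    each earlier one, and the last one makes the new term a polynomial in the
    earlier powers. Only terms of the same parity interact, whence the bound
    i + 2 <= j, under which the radius of index 2i+3 is smaller than that of index
    2j. The form of the exponent [v.2.+1] and the type of [v.1] make both
    positive. *)
Definition lacunary_step (j : nat) (s : nat -> val) (v : val) : Prop :=
  [/\ 2 * rho (2 * j + 2) ^+ v.2.+1 <= rho (2 * j + 3) ^+ v.2.+1,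
      2 * (j%:R + \sum_(i < j | odd i == odd j) (s i).1%:num * j%:R ^+ (s i).2.+1)
        <= v.1%:num * rho (2 * j) ^+ v.2.+1,
      forall i, (i.+2 <= j)%N ->
        v.1%:num * v.2.+1%:R * rho (2 * i + 3) ^+ v.2.+1 <=
        2^-1 ^+ j.+2 * ((s i).1%:num * (s i).2.+1%:R * rho (2 * i + 3) ^+ (s i).2.+1) &
      forall i, (i < j)%N -> ((s i).2.+1 %| v.2.+1)%N].

(** A large multiple of the previous exponents satisfies the exponential
    conditions once the coefficient is tied to it by A * rho (2j)^N = c, where [c]
    only depends on the previous terms. *)
Lemma lacunary_stepP j s : exists v, lacunary_step j s v.
Proof.
pose c := 2 * (j%:R + \sum_(i < j | odd i == odd j) (s i).1%:num * j%:R ^+ (s i).2.+1) + 1.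
have c0 : 0 < c.
  rewrite ltr_wpDl// mulr_ge0// addr_ge0//; apply: sumr_ge0 => i _.
  by rewrite mulr_ge0 ?exprn_ge0.
have [N1 HN1] : exists N1, forall k, (N1 <= k)%N ->
    2 * rho (2 * j + 2) ^+ k <= rho (2 * j + 3) ^+ k.
  have l23 : rho (2 * j + 2) < rho (2 * j + 3) by apply: rho_lt; rewrite ltn_add2l.
  have t0 : 0 < rho (2 * j + 2) / rho (2 * j + 3) by rewrite divr_gt0.
  have t1 : rho (2 * j + 2) / rho (2 * j + 3) < 1 by rewrite ltr_pdivrMr// mul1r.
  have [N1 HN1] := natmul_expr_small 2 t0 t1 (ltr01).
  exists N1.+1 => k Nk; have := HN1 k (ltnW Nk).
  rewrite expr_div_n mulrA ler_pdivrMr ?exprn_gt0// mul1r; apply: le_trans.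
  rewrite ler_wpM2r ?exprn_ge0 ?(ltW (rho_gt0 _))// ler_peMr// ler1n.
  exact: leq_ltn_trans Nk.
pose d i := 2^-1 ^+ j.+2 * ((s i).1%:num * (s i).2.+1%:R * rho (2 * i + 3) ^+ (s i).2.+1).
have d0 i : 0 < d i.
  rewrite /d; apply: mulr_gt0; first by rewrite exprn_gt0 ?invr_gt0.
  by apply: mulr_gt0; [apply: mulr_gt0|apply: exprn_gt0].
have [N2 HN2] : exists N2 : nat -> nat, forall i, (i.+2 <= j)%N -> forall k, (N2 i <= k)%N ->
    c * k%:R * (rho (2 * i + 3) / rho (2 * j)) ^+ k <= d i.
  have H i : exists N2, (i.+2 <= j)%N -> forall k, (N2 <= k)%N ->
      c * k%:R * (rho (2 * i + 3) / rho (2 * j)) ^+ k <= d i.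
    have [ij|ij] := leqP i.+2 j; last by exists 0%N.
    have l : rho (2 * i + 3) < rho (2 * j).
      by apply: rho_lt; apply: leq_trans (leq_mul (leqnn 2) ij); rewrite !mulnS addnC.
    have t0 : 0 < rho (2 * i + 3) / rho (2 * j) by rewrite divr_gt0.
    have t1 : rho (2 * i + 3) / rho (2 * j) < 1 by rewrite ltr_pdivrMr// mul1r.
    by have [N2 HN2] := natmul_expr_small c t0 t1 (d0 i); exists N2.
  by have [N2 HN2] := choice H; exists N2.
pose P := (\prod_(i < j) (s i).2.+1)%N.
have P0 : (0 < P)%N by apply: prodn_gt0.
pose N := ((N1 + \sum_(i < j) N2 i).+1 * P)%N.
have N0 : (0 < N)%N by rewrite muln_gt0.
have NN1 : (N1 + \sum_(i < j) N2 i <= N)%N.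
  by apply: ltnW; apply: leq_pmulr.
have NE : N.-1.+1 = N by rewrite prednK.
have A0 : 0 < c / rho (2 * j) ^+ N by rewrite divr_gt0 ?exprn_gt0.
exists (PosNum A0, N.-1); split; rewrite /= ?NE.
- by apply: HN1; apply: leq_trans NN1; rewrite leq_addr.
- by rewrite divfK ?gt_eqF ?exprn_gt0// /c lerDl.
- move=> i ij; have := HN2 i ij N; rewrite expr_div_n => H.
  apply: le_trans (H _); last first.
    by apply: leq_trans NN1; rewrite (bigD1 (Ordinal (leq_trans (leqnSn _) ij)))//= addnCA leq_addr.
  apply: le_of_eq; ring.
- move=> i ij; apply: dvdn_mull.
  by rewrite /P (bigD1 (Ordinal ij))//= dvdn_mulr.
Qed.

Lemma lacunary_exists : exists s : nat -> val, forall j, lacunary_step j s (s j).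
Proof.
have [f Hf] := choice (fun js : nat * (nat -> val) => lacunary_stepP js.1 js.2).
pose d : nat -> val := fun=> (PosNum ltr01, 0%N).
pose st := fix st k : nat -> val := if k is j.+1 then
  fun i => if (i < j)%N then st j i else f (j, st j) else d.
pose s j := f (j, st j).
have stE j i : (i < j)%N -> st j i = s i.
  elim: j => // j IH; rewrite ltnS leq_eqVlt => /predU1P[->|ij] /=.
    by rewrite ltnn.
  by rewrite ij IH.
exists s => j; have := Hf (j, st j); rewrite /= -/(s j) => -[H1 H2 H3 H4].
split=> // [|i ij|i ij].
- move: H2; rewrite (eq_bigr (fun i : 'I_j => (s i).1%:num * j%:R ^+ (s i).2.+1))//.
  by move=> i _; rewrite stE.
- by move: (H3 i ij); rewrite stE// (leq_trans _ ij).
- by move: (H4 i ij); rewrite stE.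
Qed.

End Lacunary.

(** * Approximation by noncommutative polynomials *)

Section Approximation.
Variables (R : realType) (m : nat) (A : preTopAlgType R[i]) (b : 'I_m -> A).
Variables (I : Type) (p : I -> A -> R) (i : I) (M : R).
Hypothesis sp : forall i, seminorm (p i).
Hypothesis mp : forall i, submultiplicative (p i).
Hypothesis p1 : p i 1 <= 1.
Hypothesis M0 : 0 <= M.
Implicit Types (K L : R) (x y : A).

Let p_ge0 x : 0 <= p i x. Proof. exact: (seminorm_ge0 sp). Qed.

Let pM x y : p i (x * y) <= p i x * p i y. Proof. exact: (mp i x y). Qed.

Lemma seminormX_le x (s : R) k : p i x <= s -> p i (x ^+ k) <= s ^+ k.
Proof.
move=> xs; elim: k => [|k IH]; first by rewrite !expr0.
rewrite !exprS; apply: le_trans (pM _ _) _; exact: ler_pM.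
Qed.

Lemma seminormX_lipschitz x y (s : R) k : p i x <= s -> p i y <= s ->
  p i (x ^+ k.+1 - y ^+ k.+1) <= k.+1%:R * s ^+ k * p i (x - y).
Proof.
move=> xs ys; elim: k => [|k IH]; first by rewrite !expr1 expr0 !mul1r.
have -> : x ^+ k.+2 - y ^+ k.+2 = (x ^+ k.+1 - y ^+ k.+1) * x + y ^+ k.+1 * (x - y).
  by rewrite mulrBl mulrBr addrA subrK -!exprSr.
apply: le_trans (seminormD sp _ _ _) _.
have H1 : p i ((x ^+ k.+1 - y ^+ k.+1) * x) <= k.+1%:R * s ^+ k * p i (x - y) * s.
  by apply: le_trans (pM _ _) _; apply: ler_pM.
have H2 : p i (y ^+ k.+1 * (x - y)) <= s ^+ k.+1 * p i (x - y).
  by apply: le_trans (pM _ _) _; apply: ler_wpM2r => //; exact: seminormX_le.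
apply: le_trans (lerD H1 H2) _; apply: le_of_eq.
by rewrite -[k.+2%:R]natr1 [s ^+ k.+1]exprS; ring.
Qed.

Section Picard.
Variables (T : Type) (s : seq T) (P : pred T) (a : T -> R) (k : T -> nat).
Variables (sigma tau delta : R) (V w : A).
Let E x := \sum_(t <- s | P t) (a t)%:C *: x ^+ (k t).+1.
Hypothesis a0 : forall t, P t -> 0 <= a t.
Hypothesis contract : \sum_(t <- s | P t) a t * ((k t).+1%:R * sigma ^+ k t) <= 2^-1.
Hypothesis tau0 : 0 <= tau.
Hypothesis tau_sigma : tau <= sigma.
Hypothesis delta0 : 0 < delta.
Hypothesis delta_sigma : delta <= sigma / 4.
Hypothesis repV : wrep b M (tau / 2) V.
Hypothesis w_sigma : p i w <= sigma / 2.
Hypothesis VE : p i (V - (w + E w)) <= delta.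

Let normcE (c : R) : 0 <= c -> normc c%:C = c.
Proof. by move=> c0; rewrite normcR ger0_norm. Qed.

Let repE x : wrep b M tau x -> wrep b M (tau / 2) (E x).
Proof.
move=> xtau; apply: (@wrep_le _ _ _ _ _ (\sum_(t <- s | P t) a t * tau ^+ (k t).+1)).
  apply: le_trans (_ : \sum_(t <- s | P t) a t * ((k t).+1%:R * sigma ^+ k t) * tau <= _).
    apply: ler_sum => t Pt; rewrite exprSr mulrA ler_wpM2r//.
    rewrite ler_wpM2l ?a0//; apply: le_trans (_ : sigma ^+ k t <= _).
      by apply: lerXn2r; rewrite ?nnegrE// (le_trans tau0).
    by rewrite ler_peMl ?exprn_ge0 ?(le_trans tau0)// ler1n.
  by rewrite -mulr_suml mulrC ler_wpM2l.
apply: wrep_sum => t Pt; rewrite -{1}(normcE (a0 Pt)).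
by apply: wrepZ; apply: wrepX.
Qed.

Let lipE x y : p i x <= sigma -> p i y <= sigma -> p i (E x - E y) <= 2^-1 * p i (x - y).
Proof.
move=> xs ys; rewrite /E -sumrB; apply: le_trans (seminorm_sum sp _ _ _ _) _.
apply: le_trans (ler_wpM2r (p_ge0 _) contract); rewrite mulr_suml.
apply: ler_sum => t Pt; rewrite -scalerBr (seminormZ sp) normcE ?a0// -mulrA.
by rewrite ler_wpM2l ?a0//; exact: seminormX_lipschitz.
Qed.

Let U := fix U j : A := if j is j'.+1 then V - E (U j') else 0.

Let repU j : wrep b M tau (U j).
Proof.
elim: j => [|j IH] /=; first by apply: wrep_le (wrep0 _ _).
by rewrite [tau](splitr tau); apply: wrepB => //; exact: repE.
Qed.

(* The second bound keeps the iterates in the ball of radius [sigma]. *)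
Let nearU j : p i (U j - w) <= sigma / 2 * 2^-1 ^+ j + 2 * delta * (1 - 2^-1 ^+ j) /\
  p i (U j - w) <= sigma / 2.
Proof.
elim: j => [|j [IH1 IH2]].
  by rewrite expr0 /= sub0r (seminormN sp) mulr1 subrr mulr0 addr0.
have Uj : p i (U j) <= sigma.
  rewrite -(subrK w (U j)); apply: le_trans (seminormD sp _ _ _) _.
  by rewrite [leRHS]splitr; exact: lerD.
have ws : p i w <= sigma.
  apply: le_trans w_sigma _; rewrite ler_pdivrMr// ler_peMr ?ler1n//.
  exact: le_trans tau_sigma.
have H : p i (U j.+1 - w) <= delta + 2^-1 * p i (U j - w).
  have -> : U j.+1 - w = (V - (w + E w)) + (E w - E (U j)).
    by rewrite /= opprD [RHS]addrA [V + (_ - _)]addrA subrK addrAC.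
  apply: le_trans (seminormD sp _ _ _) _; apply: lerD => //; rewrite (seminormB sp i (U j)).
  exact: lipE.
have h0 : 0 <= 2^-1 ^+ j :> R by rewrite exprn_ge0.
move: H IH1 IH2 h0 delta_sigma; rewrite exprS.
move: (p i (U j.+1 - w)) (p i (U j - w)) (2^-1 ^+ j : R) => x y h.
by move=> H1 H2 H3 H4 H5; split; lra.
Qed.

(** The map x |-> V - E x halves distances on the ball of radius [sigma], where [w]
    is fixed up to [delta]; its iterates from 0 therefore approach [w], and they
    are polynomials in [V], represented with norm at most [tau] because the same
    bound on E holds for the l^1 norm of representatives. *)
Lemma picard_approximation : exists2 x, wrep b M tau x & p i (x - w) <= 3 * delta.
Proof.
have [N /(_ N (leqnn N)) H] := geometric_small (sigma / 2) (half01 R) delta0.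
exists (U N); first exact: repU.
have [H1 _] := nearU N.
have : 0 <= delta * 2^-1 ^+ N by rewrite mulr_ge0 ?exprn_ge0// ltW.
lra.
Qed.

End Picard.

(** The closure, for one seminorm, of the elements represented by free polynomials
    of norm at most [K]: unlike [wrep], it is stable under limits. *)
Definition wapprox K x : Prop :=
  forall e : R, 0 < e -> exists2 u, wrep b M K u & p i (u - x) <= e.

Lemma wrep_wapprox K x : wrep b M K x -> wapprox K x.
Proof. by move=> Kx e e0; exists x; rewrite ?subrr ?(seminorm0 sp)// ltW. Qed.

Lemma wapprox_le K L x : K <= L -> wapprox K x -> wapprox L x.
Proof. by move=> KL Kx e /Kx[u Ku ux]; exists u => //; exact: wrep_le Ku. Qed.

Lemma wapproxD K L x y : wapprox K x -> wapprox L y -> wapprox (K + L) (x + y).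
Proof.
move=> Kx Ly e e0; have e2 : 0 < e / 2 by rewrite divr_gt0.
have [u Ku ux] := Kx _ e2; have [v Lv vy] := Ly _ e2.
exists (u + v); first exact: wrepD.
rewrite opprD addrACA [e]splitr; apply: le_trans (seminormD sp _ _ _) _; exact: lerD.
Qed.

Lemma wapproxZ K c x : wapprox K x -> wapprox (normc c * K) (c *: x).
Proof.
move=> Kx e e0; have c1 : 0 < normc c + 1 by rewrite ltr_wpDl ?normc_ge0.
have [u Ku ux] := Kx _ (divr_gt0 e0 c1).
exists (c *: u); first exact: wrepZ.
rewrite -scalerBr (seminormZ sp); apply: le_trans (ler_wpM2l (normc_ge0 c) ux) _.
by rewrite mulrA ler_pdivrMr// mulrC ler_wpM2l ?(ltW e0)// lerDl.
Qed.

Lemma wapproxM K L x y : wapprox K x -> wapprox L y -> wapprox (K * L) (x * y).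
Proof.
move=> Kx Ly e e0; have e2 : 0 < e / 2 by rewrite divr_gt0.
have y1 : 0 < p i y + 1 by rewrite ltr_wpDl.
have [u Ku ux] := Kx _ (divr_gt0 e2 y1).
have u1 : 0 < p i u + 1 by rewrite ltr_wpDl.
have [v Lv vy] := Ly _ (divr_gt0 e2 u1).
exists (u * v); first exact: wrepM.
have -> : u * v - x * y = u * (v - y) + (u - x) * y by rewrite mulrBr mulrBl addrA subrK.
apply: le_trans (seminormD sp _ _ _) _; rewrite [e]splitr; apply: lerD.
  apply: le_trans (pM _ _) _; apply: le_trans (ler_wpM2l (p_ge0 u) vy) _.
  by rewrite mulrA ler_pdivrMr// mulrC ler_wpM2l ?(ltW e2)// lerDl.
apply: le_trans (pM _ _) _; apply: le_trans (ler_wpM2r (p_ge0 y) ux) _.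
by rewrite mulrAC ler_pdivrMr// ler_wpM2l ?(ltW e2)// lerDl.
Qed.

Lemma wapproxX K x k : wapprox K x -> wapprox (K ^+ k) (x ^+ k).
Proof.
move=> Kx; elim: k => [|k IH]; first by rewrite !expr0; apply: wrep_wapprox; exact: wrep1.
by rewrite !exprS; exact: wapproxM.
Qed.

Lemma wapprox_sum (T : Type) (s : seq T) (P : pred T) (K : T -> R) (x : T -> A) :
  (forall t, P t -> wapprox (K t) (x t)) ->
  wapprox (\sum_(t <- s | P t) K t) (\sum_(t <- s | P t) x t).
Proof.
move=> H; elim: s => [|t s IH]; first by rewrite !big_nil; apply: wrep_wapprox; exact: wrep0.
by rewrite !big_cons; case: ifP => // Pt; apply: wapproxD IH; exact: H.
Qed.

Lemma wapprox_prod (T : Type) (s : seq T) (P : pred T) (K : T -> R) (x : T -> A) :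
  (forall t, P t -> wapprox (K t) (x t)) ->
  wapprox (\prod_(t <- s | P t) K t) (\prod_(t <- s | P t) x t).
Proof.
move=> H; elim: s => [|t s IH]; first by rewrite !big_nil; apply: wrep_wapprox; exact: wrep1.
by rewrite !big_cons; case: ifP => // Pt; apply: wapproxM IH; exact: H.
Qed.

Lemma wapprox_closed K x :
  (forall e : R, 0 < e -> exists2 y, wapprox K y & p i (y - x) <= e) -> wapprox K x.
Proof.
move=> H e e0; have e2 : 0 < e / 2 by rewrite divr_gt0.
have [y Ky yx] := H _ e2; have [u Ku uy] := Ky _ e2; exists u => //.
rewrite -(subrK y u) -addrA [e]splitr; apply: le_trans (seminormD sp _ _ _) _.
exact: lerD.
Qed.

End Approximation.

(** * Powers recovered from lacunary series *)

Section LacunarySeries.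
Variables (R : realType) (A : preTopAlgType R[i]) (p : nat -> A -> R).
Hypothesis sp : forall k, seminorm (p k).
Hypothesis mp : forall k, submultiplicative (p k).
Hypothesis tp : topology_defined_by p.
Hypothesis cA : complete_space A.
Variables (rho : nat -> R) (s : nat -> {posnum R} * nat).
Hypothesis rho_gt0 : forall k, 0 < rho k.
Hypothesis rho_lt : forall k l, (k < l)%N -> rho k < rho l.
Hypothesis sP : forall j, lacunary_step rho j s (s j).
Local Notation a j := ((s j).1%:num : R).
Local Notation N j := (s j).2.+1.

Let rho_le k l : (k <= l)%N -> rho k <= rho l.
Proof. by rewrite leq_eqVlt => /predU1P[->//|/rho_lt/ltW]. Qed.

Lemma geometric_half_sum m n : (m <= n)%N ->
  \sum_(m <= t < n) 2^-1 ^+ t.+2 <= 2^-1 ^+ m.+1 :> R.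
Proof.
move=> mn; rewrite (eq_bigr (fun t => - 2^-1 ^+ t.+2 - - 2^-1 ^+ t.+1)).
  by rewrite (telescope_sumr (fun t => - 2^-1 ^+ t.+1))// opprK addrC gerBl exprn_ge0.
by move=> t _; rewrite opprK [2^-1 ^+ t.+2]exprS; lra.
Qed.

Variable x : A.
Hypothesis px : forall k l, p k (x ^+ l) <= rho k ^+ l.

(** At the radius of index k, the third condition of [lacunary_step], for i = k,
    bounds the terms by a geometric sequence. *)
Lemma lacunary_cvg e : exists g : A,
  (fun L => \sum_(0 <= t < L | odd t == e) (a t)%:C *: x ^+ N t) @ \oo --> g.
Proof.
apply: (complete_cauchy_seq tp cA) => k d d0.
pose B := a k * (N k)%:R * rho (2 * k + 3) ^+ N k.
have B0 : 0 < B by rewrite /B; apply: mulr_gt0; [apply: mulr_gt0|apply: exprn_gt0].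
have term t : (k.+2 <= t)%N -> p k ((a t)%:C *: x ^+ N t) <= 2^-1 ^+ t.+2 * B.
  move=> kt; rewrite (seminormZ sp) normcR ger0_norm//.
  have [_ _ /(_ k kt) H _] := sP t; apply: le_trans H.
  apply: (@le_trans _ _ (a t * rho (2 * k + 3) ^+ N t)).
    rewrite ler_wpM2l//; apply: le_trans (px _ _) _.
    apply: lerXn2r; rewrite ?nnegrE ?(ltW (rho_gt0 _))//; apply: rho_le.
    by rewrite mul2n -addnn -addnA leq_addr.
  by rewrite ler_wpM2r ?exprn_ge0 ?(ltW (rho_gt0 _))// ler_peMr// ler1n.
have tail m n : (k.+2 <= m)%N -> (m <= n)%N ->
    p k (\sum_(0 <= t < n | odd t == e) (a t)%:C *: x ^+ N t -
         \sum_(0 <= t < m | odd t == e) (a t)%:C *: x ^+ N t) <= B * 2^-1 ^+ m.+1.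
  move=> km mn; rewrite (big_cat_nat (n := m))//= addrAC subrr add0r.
  apply: le_trans (seminorm_sum sp _ _ _ _) _.
  apply: le_trans (ler_wpM2l (ltW B0) (geometric_half_sum mn)).
  rewrite mulr_sumr big_nat_cond [leRHS]big_nat_cond.
  rewrite [leRHS](bigID (fun t => odd t == e))/= -[leLHS]addr0; apply: lerD.
    rewrite (eq_bigl (fun t => (m <= t < n)%N && true && (odd t == e))) => [|t]; last first.
      by rewrite andbT.
    apply: ler_sum => t /andP[/andP[/andP[mt _] _] _]; rewrite mulrC.
    by apply: term; exact: leq_trans mt.
  by apply: sumr_ge0 => t _; rewrite mulr_ge0 ?exprn_ge0 ?ltW.
have [M HM] := geometric_small B (half01 R) d0; exists (maxn M k.+2) => m n.
wlog mn : m n / (m <= n)%N => [W|].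
  have [mn|/ltnW nm] := leqP m n; first exact: W.
  by rewrite (seminormB sp) => Mm Mn; exact: W.
rewrite !geq_max => /andP[Mm km] _.
rewrite (seminormB sp); apply: le_lt_trans (tail _ _ km mn) _.
by apply: HM; exact: leqW.
Qed.

Hypothesis p1 : forall k, p k 1 <= 1.
Variables (m : nat) (b : 'I_m -> A) (g : bool -> A).
Hypothesis gE : forall e,
  (fun L => \sum_(0 <= t < L | odd t == e) (a t)%:C *: x ^+ N t) @ \oo --> g e.
Hypothesis xb : forall M, wrep b M M x.
Hypothesis gb : forall e M, wrep b M M (g e).

(** Subtracting from [g] the terms of index less than j, which are polynomials in
    [x], and dividing by [a j] leaves [w + E w], where [w = x ^+ N j] and [E] is a
    power series in [w] with small Lipschitz constant; [w] is recovered from this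
    by Picard iteration, after truncating [E]. *)
Lemma lacunary_power j :
  wapprox b p (2 * j + 2)%N j%:R (rho (2 * j) ^+ N j) (x ^+ N j).
Proof.
set i := (2 * j + 2)%N; set e := odd j.
have [C0 HN _ _] := sP j.
pose sigma := rho (2 * j + 3) ^+ N j; pose tau := rho (2 * j) ^+ N j.
have sigma0 : 0 < sigma by rewrite exprn_gt0.
have tau0 : 0 < tau by rewrite exprn_gt0.
have aj0 : 0 < a j by [].
move=> d d0.
pose delta := Num.min (sigma / 4) (d / 3).
have delta0 : 0 < delta by rewrite lt_min !divr_gt0.
have := gE (e := e); rewrite (cvg_seminormP tp) => /(_ i _ (mulr_gt0 delta0 aj0)) [L0 _ HL].
pose L := maxn L0 j.+1; have jL : (j < L)%N by rewrite leq_maxr.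
have {}HL := HL L (leq_maxl _ _).
pose V := ((a j)^-1)%:C *: (g e - \sum_(0 <= t < j | odd t == e) (a t)%:C *: x ^+ N t).
have tj t : (j < t)%N -> odd t == e -> (j.+2 <= t)%N.
  rewrite leq_eqVlt => /predU1P[<-|//]; rewrite /= /e; by case: (odd j).
pose k t := (N t %/ N j).-1.
have kE t : (j < t)%N -> (N j * (k t).+1)%N = N t.
  move=> jt; have [_ _ _ /(_ j jt) D] := sP t.
  rewrite /k prednK ?divn_gt0 ?(dvdn_leq _ D)//.
  by rewrite mulnC divnK.
have a0 t : odd t == e -> 0 <= a t / a j by move=> _; rewrite divr_ge0.
have contract : \sum_(t <- index_iota j.+1 L | odd t == e)
    a t / a j * ((k t).+1%:R * sigma ^+ k t) <= 2^-1.
  have H : 2^-1 ^+ j.+2 <= 2^-1 :> R.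
    by rewrite exprS ler_piMr// exprn_ile1// invf_le1// ler1n.
  apply: le_trans (le_trans (geometric_half_sum jL) H).
  rewrite big_nat_cond [leRHS]big_nat_cond.
  rewrite [leRHS](bigID (fun t => odd t == e))/= -[leLHS]addr0; apply: lerD; last first.
    by apply: sumr_ge0 => t _; rewrite exprn_ge0.
  rewrite [leRHS](eq_bigl (fun t => (j < t < L)%N && (odd t == e))) => [|t]; last first.
    by rewrite andbT.
  apply: ler_sum => t /andP[/andP[jt _] te].
  have [_ _ /(_ j (tj t jt te)) T _] := sP t.
  rewrite -(ler_pM2l (mulr_gt0 (mulr_gt0 aj0 (ltr0Sn R (s j).2)) sigma0)).
  rewrite mulrC; apply: le_trans (le_trans T _); last by rewrite mulrC.
  rewrite -(kE t jt) natrM exprM -/sigma exprS; apply: le_of_eq.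
  move: (sigma ^+ k t) ((k t).+1%:R : R) ((N j)%:R : R) => X Y Z.
  by rewrite -[X in _ = X](divfK (lt0r_neq0 aj0)); field; exact: lt0r_neq0.
have tau_sigma : tau <= sigma.
  apply: lerXn2r; rewrite ?nnegrE ?(ltW (rho_gt0 _))//; apply: rho_le; exact: leq_addr.
have delta_sigma : delta <= sigma / 4 by rewrite ge_min lexx.
have repV : wrep b j%:R (tau / 2) V.
  apply: (@wrep_le _ _ _ _ _ (normc ((a j)^-1)%:C *
    (j%:R + \sum_(0 <= t < j | odd t == e) normc (a t)%:C * j%:R ^+ N t))).
    rewrite normcR ger0_norm ?invr_ge0// ler_pdivrMl// mulrA ler_pdivlMr//.
    rewrite (eq_bigr (fun t => a t * j%:R ^+ N t)) => [|t _]; last first.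
      by rewrite normcR ger0_norm.
    by rewrite big_mkord mulrC; exact: HN.
  apply: wrepZ; apply: wrepB; first exact: gb.
  by apply: wrep_sum => t _; apply: wrepZ; apply: wrepX => //; exact: xb.
have w_sigma : p i (x ^+ N j) <= sigma / 2.
  apply: le_trans (px _ _) _; rewrite ler_pdivlMr// mulrC; exact: C0.
have VE : p i (V - (x ^+ N j + \sum_(t <- index_iota j.+1 L | odd t == e)
    (a t / a j)%:C *: (x ^+ N j) ^+ (k t).+1)) <= delta.
  rewrite (_ : V - _ = - (((a j)^-1)%:C *:
      (\sum_(0 <= t < L | odd t == e) (a t)%:C *: x ^+ N t - g e))).
    rewrite (seminormN sp) (seminormZ sp) normcR ger0_norm ?invr_ge0//.
    by rewrite ler_pdivrMl// mulrC ltW.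
  rewrite [\sum_(0 <= t < L | _) _](big_cat_nat (n := j))//=; last exact: ltnW.
  rewrite [\sum_(j <= t < L | _) _]big_ltn_cond// eqxx/=.
  rewrite -scalerN opprB /V.
  set S0 := \sum_(0 <= t < j | _) _; set S1 := \sum_(j.+1 <= t < L | _) _.
  rewrite opprD addrA scalerBr [in RHS]scalerDr [in RHS]scalerN !scalerDr.
  have -> : ((a j)^-1)%:C *: ((a j)%:C *: x ^+ N j) = x ^+ N j.
    by rewrite scalerA -rmorphM/= mulVf// scale1r.
  rewrite !opprD !addrA; congr (_ - _ - _ - _).
  rewrite /S1 scaler_sumr big_nat_cond [RHS]big_nat_cond; apply: eq_bigr.
  move=> t /andP[/andP[jt _] _]; rewrite scalerA -rmorphM/= mulrC -exprM kE//.
have [u Ku uw] := picard_approximation sp mp (p1 i) (ler0n _ _) a0 contract (ltW tau0)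
  tau_sigma delta0 delta_sigma repV w_sigma VE.
exists u => //; apply: le_trans uw _.
by rewrite mulrC -ler_pdivlMr// ge_min lexx orbT.
Qed.

End LacunarySeries.

(** * Holomorphic generation of the quantum polydisk *)

Section HolomorphicGeneration.
Variables (R : realType) (n : nat) (q : R[i]) (r : {posnum R}).
Hypothesis n0 : (0 < n)%N.
Hypothesis q0 : q != 0.
Local Notation Q := (qpolydisk n q r%:num).
Local Notation x_ := (@qx R n q r%:num).

Let r0 : 0 < r%:num. Proof. by []. Qed.
Let rho k : R := sval (qrad r0 k).
Let p k (f : Q) : R := qnorm (qrad r0 k) f.

Let rho_gt0 k : 0 < rho k. Proof. exact: qradius_gt0. Qed.
Let rho_lt k l : (k < l)%N -> rho k < rho l. Proof. exact: qrad_lt. Qed.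
Let sp k : seminorm (p k). Proof. exact: qseminorm. Qed.
Let mp k : submultiplicative (p k). Proof. exact: qsubmultiplicative. Qed.
Let tp : topology_defined_by p. Proof. exact: qtopology_qrad. Qed.
Let cQ : complete_space Q. Proof. exact: qcomplete. Qed.
Let px i k l : p k (x_ i ^+ l) <= rho k ^+ l. Proof. exact: qnorm_qxX. Qed.
Let p1 k : p k 1 <= 1.
Proof. by have := px (Ordinal n0) k 0; rewrite !expr0. Qed.
Let p_le k l f : (k <= l)%N -> p k f <= p l f.
Proof. by move=> kl; apply: qnorm_homo; exact: qrad_le. Qed.

Let s := sval (cid (lacunary_exists rho_gt0 rho_lt)).
Let sP j : lacunary_step rho j s (s j).
Proof. exact: (svalP (cid (lacunary_exists rho_gt0 rho_lt))). Qed.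
Local Notation N j := (s j).2.+1.

Let lac i e : Q := sval (cid (lacunary_cvg sp tp cQ rho_gt0 rho_lt sP (px i) e)).

Let lacE i e : (fun L => \sum_(0 <= t < L | odd t == e) ((s t).1%:num : R)%:C *: x_ i ^+ N t)
  @ \oo --> lac i e.
Proof. exact: (svalP (cid (lacunary_cvg sp tp cQ rho_gt0 rho_lt sP (px i) e))). Qed.

Local Notation index := ('I_n * option bool)%type.

Let gen (u : index) : Q := if u.2 is Some e then lac u.1 e else x_ u.1.

Let b (t : 'I_#|{: index}|) : Q := gen (enum_val t).

Let gen_wrep M u : wrep b M M (gen u).
Proof. by rewrite -(enum_rankK u); exact: wrep_gen. Qed.

Let x_wrep i M : wrep b M M (x_ i). Proof. exact: (gen_wrep M (i, None)). Qed.

Let lac_wrep i e M : wrep b M M (lac i e). Proof. exact: (gen_wrep M (i, Some e)). Qed.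

Section Level.
Variable j : nat.
Let rj := rho (2 * j).
Let B := Num.max 1 (j%:R / rj).
Let B1 : 1 <= B. Proof. by rewrite le_max lexx. Qed.
Let rj0 : 0 < rj. Proof. exact: rho_gt0. Qed.
Let C1 := B ^+ N j.
Let C10 : 0 <= C1. Proof. by rewrite exprn_ge0// (le_trans ler01). Qed.

Let approx K f := wapprox b p (2 * j + 2)%N j%:R K f.

(* Division of [l] by [N j]: the remainder is less than [N j], so that representing
   that power by the letter itself, of weight j, costs a bounded factor. *)
Let approx_xX i l : approx (C1 * rj ^+ l) (x_ i ^+ l).
Proof.
have H := lacunary_power sp mp tp rho_gt0 rho_lt sP (px i) p1
  (@lacE i) (x_wrep i) (lac_wrep i) j.
rewrite {2}(divn_eq l (N j)) exprD [(l %/ N j * N j)%N]mulnC exprM.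
have Hr : approx (j%:R ^+ (l %% N j)) (x_ i ^+ (l %% N j)).
  by apply: wrep_wapprox => //; apply: wrepX => //; exact: x_wrep.
apply: wapprox_le (wapproxM sp mp (ler0n _ _) (wapproxX sp mp (ler0n _ _) (l %/ N j) H) Hr).
rewrite [in leRHS](divn_eq l (N j)) exprD [(l %/ N j * N j)%N]mulnC exprM mulrCA.
rewrite ler_wpM2l ?exprn_ge0 ?(ltW rj0)//.
apply: (@le_trans _ _ ((B * rj) ^+ (l %% N j))).
  apply: lerXn2r; rewrite ?nnegrE ?ler0n ?mulr_ge0 ?(ltW rj0) ?(le_trans ler01)//.
  by rewrite -ler_pdivrMr// le_max lexx orbT.
rewrite exprMn ler_wpM2r ?exprn_ge0 ?(ltW rj0)//.
by apply: ler_weXn2l => //; rewrite ltnW// ltn_mod.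
Qed.

Let approx_omon a : approx (C1 ^+ n * rj ^+ mdeg a) (omon q x_ a).
Proof.
have H : approx (\prod_(i <- ord_seq n q) (C1 * rj ^+ a i)) (omon q x_ a).
  by apply: wapprox_prod => // i _; exact: approx_xX.
apply: wapprox_le H; rewrite (perm_big _ (perm_ord_seq n q)) big_enum/=.
by rewrite big_split/= prodr_const card_ord -expr_sum.
Qed.

(** Ordered monomials are products of powers of the generators, and the norm of [f]
    is the sum of the norms of the terms of its ordered expansion. *)
Lemma word_approximation f : approx (C1 ^+ n * p (2 * j) f) f.
Proof.
apply: wapprox_closed => // e e0.
have : qpartial x_ f @ \oo --> f by exact: (@cvg_qpartial R n q q0 r%:num f).
rewrite (cvg_seminormP tp) => /(_ (2 * j + 2)%N e e0)[L _ /(_ L (leqnn L)) HL].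
exists (qpartial x_ f L); last exact: ltW.
have H : approx (\sum_(a <- mbox L) normc (qcoef f a / kap q a) * (C1 ^+ n * rj ^+ mdeg a))
    (qpartial x_ f L).
  by apply: wapprox_sum => // a _; apply: wapproxZ => //; exact: approx_omon.
apply: wapprox_le H.
apply: le_trans (ler_wpM2l (exprn_ge0 n C10) (le_box_qnorm (qrad r0 (2 * j)) f L)).
rewrite mulr_sumr; apply: ler_sum => a _.
rewrite normcM normc_kap_inv /qterm -/(rho (2 * j)) -/rj.
by apply: le_of_eq; ring.
Qed.

End Level.

(** One approximates [f] at level 0, then the error at level 1, and so on: level j
    leaves an error that is small at the radius of index 2j+2 = 2(j+1), which is
    the radius that level j+1 takes as input. *)
Lemma word_series (f : Q) : exists (l : nat -> seq (R[i] * seq 'I_#|{: index}|)) (K : R),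
  (forall j, wnorm j%:R (l j) <= K * 2^-1 ^+ j) /\
  (fun L => \sum_(j < L) weval b (l j)) @ \oo --> f.
Proof.
have /choice[C HC] j : exists C : R, 0 <= C /\ forall f,
    wapprox b p (2 * j + 2)%N j%:R (C * p (2 * j) f) f.
  eexists; split; last by move=> h; exact: word_approximation.
  by rewrite !exprn_ge0// le_max ler01.
(* The error entering level j is divided in advance by the constant of that level. *)
pose d j : R := 2^-1 ^+ j / (C j + 1).
have C0 j : 0 < C j + 1 by rewrite ltr_wpDl// (HC j).1.
have d0 j : 0 < d j by rewrite divr_gt0// exprn_gt0.
have /choice[S HS] (jf : nat * Q) : exists l,
    wnorm jf.1%:R l <= C jf.1 * p (2 * jf.1) jf.2 /\
    p (2 * jf.1 + 2) (jf.2 - weval b l) <= d jf.1.+1.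
  have [u [l lu lC] uf] := (HC jf.1).2 jf.2 _ (d0 jf.1.+1).
  by exists l; split=> //; rewrite lu (seminormB sp).
pose F := fix F j : Q := if j is j'.+1 then F j' - weval b (S (j', F j')) else f.
pose l j := S (j, F j).
have FS j : F j.+1 = F j - weval b (l j) by [].
have pF j : p (2 * j.+1) (F j.+1) <= d j.+1.
  by have := (HS (j, F j)).2; rewrite -FS/= mulnS addnC.
exists l, (Num.max 1 (C 0%N * p 0 f)); split=> [[|j]|].
- rewrite expr0 mulr1 le_max; apply/orP; right; exact: (HS (0%N, f)).1.
- apply: le_trans (HS (j.+1, F j.+1)).1 _.
  apply: le_trans (ler_wpM2l (HC j.+1).1 (pF j)) _.
  apply: (@le_trans _ _ (2^-1 ^+ j.+1)); last by rewrite ler_peMl ?exprn_ge0// le_max lexx.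
  by rewrite /d mulrCA ler_piMr ?exprn_ge0// ler_pdivrMr// mul1r lerDl.
apply/(cvg_seminormP tp) => k e e0.
have sumF L : \sum_(j < L) weval b (l j) = f - F L.
  elim: L => [|L IH]; first by rewrite big_ord0 subrr.
  by rewrite FS big_ord_recr/= IH opprB addrA addrAC.
have [L0 HL] := geometric_small 1 (half01 R) e0; exists (maxn k.+1 L0) => // L /=.
rewrite geq_max => /andP[kL /HL]; rewrite mul1r => HLe.
rewrite sumF addrAC subrr add0r (seminormN sp).
case: L kL HLe => // L kL HLe.
apply: (@le_lt_trans _ _ (d L.+1)).
  apply: le_trans (p_le _ _) (pF L); apply: leq_trans (ltnW kL) _.
  exact: leq_pmull.
apply: le_lt_trans HLe.
by rewrite /d ler_pdivrMr// ler_peMr ?exprn_ge0// lerDr (HC _).1.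
Qed.

Lemma holomorphically_finitely_generated_qpolydisk :
  holomorphically_finitely_generated Q.
Proof.
split; first exact: qpolydisk_frechet.
exists (range b); split; first by apply: finite_image; exact: finite_finset.
apply/seteqP; split=> // f _ X [HX bX].
have [l [K [lK lf]]] := word_series f.
apply: (holomorphically_closed_wseries sp mp tp lK lf HX) => t.
by apply: bX; exists t.
Qed.

End HolomorphicGeneration.

Theorem proposition5p2 (R : realType) (n : nat) (r : {posnum R}) (q : R[i])
    (hn : (0 < n)%N) (hq : q != 0) :
  (forall (F : preTopAlgType R[i]) (iota : 'I_n -> holo_disk r -> F),
      free_polydisk iota ->
      isomorphic_to_closed_quotient (qpolydisk n q r%:num)
        (q_relations q (fun i => iota i (disk_coord r)))) /\
  holomorphically_finitely_generated (qpolydisk n q r%:num).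
Proof.
split; last exact: holomorphically_finitely_generated_qpolydisk.
by move=> F iota; exact: isomorphic_free_polydisk_quotient.
Qed.
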